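(* Let $\Theta_1,\Theta_2$ be nonconstant pure $\mathcal{L}(E)$-valued inner functions, and let $\Phi\in L^2(\mathcal{L}(E))$ be such that the matrix valued asymmetric truncated Toeplitz operator $A_\Phi^{\Theta_1,\Theta_2}:K_{\Theta_1}\to K_{\Theta_2}$ is bounded. Then $A_\Phi^{\Theta_1,\Theta_2}=0$ if and only if $$\Phi\in[\Theta_1H^2(\mathcal{L}(E))]^*+\Theta_2H^2(\mathcal{L}(E)).$$
   Context: $\mathbb{D}$ is the open unit disc, $\mathbb{T}$ the unit circle, $E$ is a complex Hilbert space of finite dimension $d$, and $\mathcal{L}(E)$ is the algebra of (bounded) linear operators on $E$ (identified with $d\times d$ matrices). $L^2(E)$ is the space of square-integrable $E$-valued functions on $\mathbb{T}$ with inner product $\langle f,g\rangle=\frac1{2\pi}\int_0^{2\pi}\langle f(e^{it}),g(e^{it})\rangle_E\,dt$; $H^2(E)$ is the Hardy space of $E$-valued analytic functions on $\mathbb{D}$ with square-summable Taylor coefficients, viewed as the closed subspace of $L^2(E)$ of functions whose Fourier coefficients of negative index vanish; $H^\infty(E)$ is the space of bounded $E$-valued analytic functions on $\mathbb{D}$. $L^2(\mathcal{L}(E))$, $H^2(\mathcal{L}(E))$, $H^\infty(\mathcal{L}(E))$ are the corresponding spaces of $\mathcal{L}(E)$-valued functions, with $\mathcal{L}(E)$ carrying the Hilbert–Schmidt norm in the $L^2$ and $H^2$ cases. A function $\Theta\in H^\infty(\mathcal{L}(E))$ is inner if its boundary values $\Theta(e^{it})$ are isometries for almost every $e^{it}\in\mathbb{T}$;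 it is pure if $\|\Theta(0)\|<1$. The model space is $K_\Theta=H^2(E)\ominus\Theta H^2(E)$; $K_\Theta^\infty=K_\Theta\cap H^\infty(E)$, which is dense in $K_\Theta$; $P_\Theta$ is the orthogonal projection of $L^2(E)$ onto $K_\Theta$. For $\Phi\in L^2(\mathcal{L}(E))$, the matrix valued asymmetric truncated Toeplitz operator $A_\Phi^{\Theta_1,\Theta_2}$ from $K_{\Theta_1}$ into $K_{\Theta_2}$ is densely defined by $A_\Phi^{\Theta_1,\Theta_2}f=P_{\Theta_2}(\Phi f)$ for $f\in K_{\Theta_1}^\infty$; when bounded, it is extended by continuity to $K_{\Theta_1}$. $[\Theta_1H^2(\mathcal{L}(E))]^*=\{(\Theta_1F)^*:F\in H^2(\mathcal{L}(E))\}$, where $*$ denotes the pointwise (a.e. on $\mathbb{T}$) adjoint. *)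

(* Defs.v *)
From HB Require Import structures.
From mathcomp Require Import all_boot all_order all_algebra.
From mathcomp Require Import sesquilinear spectral complex.
From mathcomp Require Import all_classical all_reals all_analysis.

Set Implicit Arguments.
Unset Strict Implicit.
Unset Printing Implicit Defensive.

Import Order.TTheory GRing.Theory Num.Theory.
Import numFieldNormedType.Exports.

Local Open Scope classical_set_scope.
Local Open Scope ring_scope.
Local Open Scope complex_scope.
Local Open Scope sesquilinear_scope.

(* The Hilbert space E of dimension d is 'cV[R[i]]_d and L(E) is 'M[R[i]]_d.
   Both are handled as instances of 'M[R[i]]_(m, n); for n = 1 the
   Hilbert-Schmidt norm below is the Hilbert space norm of E. *)

Section Matrices.
Context {R : realType}.
Implicit Types m n d : nat.

Definition hsdot m n (A B : 'M[R[i]]_(m, n)) : R[i] := \tr (A *m B^t*).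

Definition hsnorm m n (A : 'M[R[i]]_(m, n)) : R :=
  Num.sqrt (complex.Re (hsdot A A)).

Definition opnorm d (A : 'M[R[i]]_d) : R :=
  sup [set hsnorm (A *m x) | x in [set x : 'cV[R[i]]_d | hsnorm x <= 1]].

Definition isometrymx d (A : 'M[R[i]]_d) : Prop :=
  forall x : 'cV[R[i]]_d, hsnorm (A *m x) = hsnorm x.

End Matrices.

(* A function f on the unit circle is represented by the function
   t |-> f(e^{it}) of the angle t, of which only the restriction to
   [0, 2 pi], up to almost everywhere equality, matters. *)

Section CircleFunctions.
Context {R : realType}.
Implicit Types m n : nat.

Definition expi (t : R) : R[i] := cos t +i* sin t.

Definition angles : set R := `[0, 2 * pi].

Definition circle_ae (P : R -> Prop) : Prop :=
  {ae (@lebesgue_measure R), forall t, angles t -> P t}.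

(* (1 / 2 pi) \int_0^{2 pi} g(t) dt *)
Definition circle_mean (g : R -> R[i]) : R[i] :=
  ((2 * pi)^-1 * \int[@lebesgue_measure R]_(t in angles) complex.Re (g t)) +i*
  ((2 * pi)^-1 * \int[@lebesgue_measure R]_(t in angles) complex.Im (g t)).

Definition circle_measurable m n (f : R -> 'M[R[i]]_(m, n)) : Prop :=
  forall i j, measurable_fun angles (fun t => complex.Re (f t i j)) /\
              measurable_fun angles (fun t => complex.Im (f t i j)).

Definition L2 m n : set (R -> 'M[R[i]]_(m, n)) :=
  [set f | circle_measurable f /\
    (\int[@lebesgue_measure R]_(t in angles) ((hsnorm (f t)) ^+ 2)%:E
       < +oo)%E].

Definition L2dot m n (f g : R -> 'M[R[i]]_(m, n)) : R[i] :=
  circle_mean (fun t => hsdot (f t) (g t)).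

Definition L2norm m n (f : R -> 'M[R[i]]_(m, n)) : R :=
  Num.sqrt (complex.Re (L2dot f f)).

Definition fourier m n (f : R -> 'M[R[i]]_(m, n)) (k : int) : 'M[R[i]]_(m, n) :=
  \matrix_(i, j) circle_mean (fun t => f t i j * expi (- (k%:~R * t))).

Definition H2 m n : set (R -> 'M[R[i]]_(m, n)) :=
  [set f | L2 f /\ forall k : int, k < 0 -> fourier f k = 0].

Definition orth_proj m n (K : set (R -> 'M[R[i]]_(m, n)))
    (f : R -> 'M[R[i]]_(m, n)) : R -> 'M[R[i]]_(m, n) :=
  xget (fun=> 0) [set g | K g /\
    forall h, K h -> L2dot (fun t => f t - g t) h = 0].

End CircleFunctions.

Section DiscFunctions.
Context {R : realType}.
Implicit Types m n d : nat.

(* On the disc, analytic means being the sum of a power series in z. *)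
Definition analytic_on_disc m n (F : R[i] -> 'M[R[i]]_(m, n)) : Prop :=
  exists a : nat -> 'M[R[i]]_(m, n), forall z : R[i], `|z| < 1 ->
    hsnorm (F z - \sum_(k < N) z ^+ k *: a k) @[N --> \oo] --> (0 : R).

Definition Hinf m n : set (R[i] -> 'M[R[i]]_(m, n)) :=
  [set F | analytic_on_disc F /\
    exists M : R, forall z : R[i], `|z| < 1 -> hsnorm (F z) <= M].

Definition radial_limit m n (F : R[i] -> 'M[R[i]]_(m, n)) (t : R)
    (L : 'M[R[i]]_(m, n)) : Prop :=
  hsnorm (F (r%:C * expi t) - L) @[r --> (1 : R)^'-] --> (0 : R).

Definition bdry m n (F : R[i] -> 'M[R[i]]_(m, n)) (t : R) : 'M[R[i]]_(m, n) :=
  xget 0 (radial_limit F t).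

Definition inner_function d (Theta : R[i] -> 'M[R[i]]_d) : Prop :=
  Hinf Theta /\
  circle_ae (fun t => exists2 L, radial_limit Theta t L & isometrymx L).

Definition pure_function d (Theta : R[i] -> 'M[R[i]]_d) : Prop :=
  opnorm (Theta 0) < 1.

Definition nonconstant d (Theta : R[i] -> 'M[R[i]]_d) : Prop :=
  ~ exists A, forall z : R[i], `|z| < 1 -> Theta z = A.

Definition model_space d (Theta : R[i] -> 'M[R[i]]_d) :
    set (R -> 'cV[R[i]]_d) :=
  [set f | H2 f /\
    forall h, H2 h -> L2dot f (fun t => bdry Theta t *m h t) = 0].

Definition model_space_inf d (Theta : R[i] -> 'M[R[i]]_d) :
    set (R -> 'cV[R[i]]_d) :=
  [set f | model_space Theta f /\
    exists2 F, Hinf F & circle_ae (fun t => radial_limit F t (f t))].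

(* The densely defined operator f |-> P_{Theta2}(Phi f), for f in the space
   model_space_inf Theta1. *)
Definition attoeplitz0 d (Theta2 : R[i] -> 'M[R[i]]_d) (Phi : R -> 'M[R[i]]_d)
    (f : R -> 'cV[R[i]]_d) : R -> 'cV[R[i]]_d :=
  orth_proj (model_space Theta2) (fun t => Phi t *m f t).

Definition attoeplitz_bounded d (Theta1 Theta2 : R[i] -> 'M[R[i]]_d)
    (Phi : R -> 'M[R[i]]_d) : Prop :=
  exists M : R, forall f, model_space_inf Theta1 f ->
    L2norm (attoeplitz0 Theta2 Phi f) <= M * L2norm f.

(* Its extension by continuity: the value at f is the L^2 limit of
   attoeplitz0 along a sequence of model_space_inf Theta1 converging to f. *)
Definition attoeplitz d (Theta1 Theta2 : R[i] -> 'M[R[i]]_d)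
    (Phi : R -> 'M[R[i]]_d) (f : R -> 'cV[R[i]]_d) : R -> 'cV[R[i]]_d :=
  xget (fun=> 0) [set g | model_space Theta2 g /\
    exists u : nat -> R -> 'cV[R[i]]_d,
    [/\ forall k, model_space_inf Theta1 (u k),
        L2norm (fun t => u k t - f t) @[k --> \oo] --> (0 : R) &
        L2norm (fun t => attoeplitz0 Theta2 Phi (u k) t - g t)
          @[k --> \oo] --> (0 : R)]].

Definition mulH2 d (Theta : R[i] -> 'M[R[i]]_d) : set (R -> 'M[R[i]]_d) :=
  [set Psi | exists2 F : R -> 'M[R[i]]_d,
    H2 F & circle_ae (fun t => Psi t = bdry Theta t *m F t)].

Definition adjset d (S : set (R -> 'M[R[i]]_d)) : set (R -> 'M[R[i]]_d) :=
  [set Psi | exists2 G, S G & circle_ae (fun t => Psi t = (G t)^t*)].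

Definition addset d (S T : set (R -> 'M[R[i]]_d)) : set (R -> 'M[R[i]]_d) :=
  [set Psi | exists F G, [/\ S F, T G & circle_ae (fun t => Psi t = F t + G t)]].

End DiscFunctions.

(* Main.v *)
From HB Require Import structures.
From mathcomp Require Import all_boot all_order all_algebra.
From mathcomp Require Import sesquilinear complex.
From mathcomp Require Import all_classical all_reals all_analysis.
From mathcomp Require Import measurable_realfun.
From mathcomp Require Import zify ring lra.
Require Import Defs.

(** Let [T1], [T2] be the boundary functions of the two inner functions; they are
    unitary almost everywhere. Say that a function has spectrum in a set of
    integers if its other Fourier coefficients vanish. Then [f] is in the model
    space of [T] when [f] is analytic (spectrum in [0, +oo)) and [T^* f] has
    negative spectrum, and [g] is orthogonal to the model space when
    [g = T h + r] with [h] analytic and [r] of negative spectrum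
    ([model_spaceP], [orth_proj_eq0]). Since the operator is bounded, its
    extension vanishes if and only if [Phi f] is orthogonal to the model space
    of [T2] for all bounded [f] in that of [T1] ([attoeplitz_eq0]).

    If [Phi = (T1 P)^* + T2 Q] with [P], [Q] analytic, then
    [Phi f = P^* (T1^* f) + T2 (Q f)], where the first term has negative spectrum
    and the second lies in [T2 H^2]; so the operator is zero.

    Conversely, test the operator on the columns of two families of bounded
    functions, written with [A1 = Th1 0]: the projections [k_n] of [z ^ n] onto
    the model space ([kfun]) and the difference quotient
    [q = z^-1 (T1 - A1)] ([qfun]). The function [k_0 + z q A1^*] is the constant
    [1 - A1 A1^*], and this is invertible because [Th1] is pure. Therefore
    [Phi = T2 Q + r] with [Q] analytic and [r] antianalytic, that is, with
    spectrum in (-oo, 0] ([antianalytic_part]). Split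
    the analytic function [r^*] as [T1 P + chi], where [P] is the analytic part
    of [T1^* r^*]; by the first direction the symbols [(T1 P)^*] and [T2 Q] give
    the zero operator, hence so does [chi^*], and the claim is [chi = 0].

    Testing [chi^*] on [q] gives [chi^* T1 = z T2 W] with [W] analytic. With
    this, testing on [k_n] gives [z ^ n chi^* = T2 V + s] with [V] analytic and
    [s] of negative spectrum. Assume that the coefficients of [chi] of index
    less than [n] vanish. Then [z ^ n chi^* = c + s'] with [c] the adjoint of the
    next coefficient and [s'] of negative spectrum. So [c - T2 V] is both analytic
    and of negative spectrum, and [c = T2 V]. A constant in [T2 H^2] is zero
    because [Th2] is pure ([const_in_TH2]), and induction on [n] gives [chi = 0]
    ([symbol_split]).

    The calculus of spectra rests on Fourier analysis on the circle, developed
    here from Lebesgue integration: uniqueness of Fourier coefficients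
    ([null_coefs_ae0]), the Riesz projection ([riesz_proj]), additivity of
    spectra under products ([coef_mul_ge]), and the equality of Taylor
    coefficients and Fourier coefficients of boundary values ([bdry_coef]). *)

Set Implicit Arguments.
Unset Strict Implicit.
Unset Printing Implicit Defensive.
Import Order.TTheory GRing.Theory Num.Theory.
Import numFieldNormedType.Exports.
Import HBNNSimple.
Local Open Scope classical_set_scope.
Local Open Scope ring_scope.
Local Open Scope complex_scope.
Local Open Scope sesquilinear_scope.

Local Notation Re := complex.Re.
Local Notation Im := complex.Im.

(** * Integration of complex valued functions on the circle *)

Section ComplexIntegration.
Context {R : realType}.
Implicit Types (f g : R -> R[i]) (h : R -> R).
Notation mu := (@lebesgue_measure R).

Definition normsq (z : R[i]) : R := Re z ^+ 2 + Im z ^+ 2.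
Definition rint h := mu.-integrable angles (EFin \o h).
Definition rmean h : R := (2 * pi)^-1 * \int[mu]_(t in angles) h t.
Definition cmeas g := measurable_fun angles (fun t => Re (g t)) /\
  measurable_fun angles (fun t => Im (g t)).
Definition cint g := rint (fun t => Re (g t)) /\ rint (fun t => Im (g t)).
Definition sL2 g := cmeas g /\ rint (fun t => normsq (g t)).

Lemma ReD (x y : R[i]) : Re (x + y) = Re x + Re y. Proof. by case: x; case: y. Qed.
Lemma ImD (x y : R[i]) : Im (x + y) = Im x + Im y. Proof. by case: x; case: y. Qed.
Lemma ReN (x : R[i]) : Re (- x) = - Re x. Proof. by case: x. Qed.
Lemma ImN (x : R[i]) : Im (- x) = - Im x. Proof. by case: x. Qed.
Lemma ReM (x y : R[i]) : Re (x * y) = Re x * Re y - Im x * Im y.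
Proof. by case: x; case: y. Qed.
Lemma ImM (x y : R[i]) : Im (x * y) = Re x * Im y + Im x * Re y.
Proof. by case: x; case: y. Qed.
Lemma ReJ (x : R[i]) : Re (x^*)%R = Re x. Proof. by case: x. Qed.
Lemma ImJ (x : R[i]) : Im (x^*)%R = - Im x. Proof. by case: x. Qed.
Lemma Re0 : Re (0 : R[i]) = 0. Proof. by []. Qed.
Lemma Im0 : Im (0 : R[i]) = 0. Proof. by []. Qed.
Lemma Re1 : Re (1 : R[i]) = 1. Proof. by []. Qed.
Lemma Im1 : Im (1 : R[i]) = 0. Proof. by []. Qed.
Definition ReImE := (ReD, ImD, ReN, ImN, ReM, ImM, ReJ, ImJ, Re0, Im0, Re1, Im1).

Lemma complex_eq (x y : R[i]) : Re x = Re y -> Im x = Im y -> x = y.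
Proof. by case: x y => [a b] [c d] /= -> ->. Qed.

Lemma normsq_ge0 z : 0 <= normsq z.
Proof. by rewrite addr_ge0 // sqr_ge0. Qed.
Hint Resolve normsq_ge0 : core.

Lemma normsqM x y : normsq (x * y) = normsq x * normsq y.
Proof. rewrite /normsq !ReImE; ring. Qed.

Lemma normsqJ x : normsq (x^*)%R = normsq x.
Proof. rewrite /normsq !ReImE; ring. Qed.

Lemma normsqN x : normsq (- x) = normsq x.
Proof. rewrite /normsq !ReImE; ring. Qed.

Lemma normsq_eq0 z : normsq z = 0 -> z = 0.
Proof.
move=> /eqP; rewrite paddr_eq0 ?sqr_ge0 // !sqrf_eq0 => /andP[/eqP r /eqP i].
exact: complex_eq.
Qed.

Lemma normsqD x y : normsq (x + y) <= 2 * normsq x + 2 * normsq y.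
Proof.
rewrite /normsq !ReImE -subr_ge0.
rewrite [X in 0 <= X](_ : _ = (Re x - Re y) ^+ 2 + (Im x - Im y) ^+ 2); last by ring.
by rewrite addr_ge0 // sqr_ge0.
Qed.

Lemma Re_normsq z : Re z ^+ 2 <= normsq z.
Proof. by rewrite lerDl sqr_ge0. Qed.

Lemma Im_normsq z : Im z ^+ 2 <= normsq z.
Proof. by rewrite lerDr sqr_ge0. Qed.

Lemma mulJ_normsq z : z * (z^*)%R = (normsq z)%:C.
Proof. by apply: complex_eq; rewrite /normsq !ReImE /=; ring. Qed.

Lemma pi2_gt0 : 0 < 2 * pi :> R.
Proof. by rewrite mulr_gt0 // pi_gt0. Qed.

Lemma measurable_angles : measurable (angles : set R).
Proof. exact: measurable_itv. Qed.
Lemma measurable_anglesR : measurable (angles : set (measurableTypeR R)).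
Proof. exact: measurable_itv. Qed.
Hint Resolve measurable_angles measurable_anglesR : core.

Lemma mu_angles : mu (angles : set R) = (2 * pi)%:E.
Proof.
by rewrite /angles lebesgue_measure_itv/= lte_fin pi2_gt0 sube0.
Qed.

Let ae_filter : Filter (nbhs (almost_everywhere mu)).
Proof. typeclasses eauto. Qed.

#[global] Instance circle_ae_filter : Filter (@circle_ae R).
Proof.
rewrite /circle_ae; split.
- exact: aeW.
- by move=> P Q HP HQ; apply: (@filterS2 _ _ ae_filter _ _ _ _ HP HQ) => t p q At; split; [apply: p|apply: q].
- by move=> P Q PQ; apply: (@filterS _ _ ae_filter) => t p At; apply: PQ; exact: p.
Qed.

Lemma rint_meas h : rint h -> measurable_fun angles h.
Proof. by move=> /measurable_int /measurable_EFinP. Qed.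

Lemma rintD h1 h2 : rint h1 -> rint h2 -> rint (fun t => h1 t + h2 t).
Proof. by move=> i1 i2; apply: (eq_integrable measurable_anglesR _ _ _ (integrableD measurable_anglesR i1 i2)). Qed.

Lemma rintZ c h : rint h -> rint (fun t => c * h t).
Proof. by move=> i1; apply: (eq_integrable measurable_anglesR _ _ _ (integrableZl measurable_anglesR c i1)). Qed.

Lemma rintN h : rint h -> rint (fun t => - h t).
Proof. by move=> i1; apply: (eq_integrable measurable_anglesR _ _ _ (integrableN i1)). Qed.

Lemma rintB h1 h2 : rint h1 -> rint h2 -> rint (fun t => h1 t - h2 t).
Proof. by move=> i1 i2; apply: rintD => //; exact: rintN. Qed.

Lemma rint_dom h k : measurable_fun angles h -> rint k ->
  (forall t, angles t -> `|h t| <= k t) -> rint h.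
Proof.
move=> mh ik hk; apply: (le_integrable measurable_anglesR _ _ ik).
  exact/measurable_EFinP.
by move=> t At /=; rewrite lee_fin (le_trans (hk _ At))// ler_norm.
Qed.

Lemma rint_bdd c h : measurable_fun angles h ->
  (forall t, angles t -> `|h t| <= c) -> rint h.
Proof.
move=> mh hc; apply: measurable_bounded_integrable => //.
  by rewrite [X in (X < _)%E]mu_angles ltry.
exists c; split; first by rewrite num_real.
by move=> M cM t At /=; apply: (le_trans (hc _ At)); exact: ltW.
Qed.

Lemma rint_cst c : rint (fun=> c).
Proof. by apply: (@rint_bdd `|c|) => //; exact: measurable_cst. Qed.

(** The integral of a nonnegative function is the supremum of the integrals of
    the simple functions below it, and these can be cut off on a null set. This
    covers the boundary values that are chosen angle by angle, and may fail to
    be measurable. *)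
Lemma ge0_integral_ae_le (u v : R -> \bar R) (N : set (measurableTypeR R)) :
  measurable N -> mu N = 0 -> (forall t, 0 <= u t)%E -> (forall t, 0 <= v t)%E ->
  (forall t, ~ N t -> u t = v t) ->
  (\int[mu]_t u t <= \int[mu]_t v t)%E.
Proof.
move=> mN N0 u0 v0 uv; rewrite !ge0_integralTE//; apply: ge_ereal_sup => _ [s /= su <-].
have mNC : measurable (~` N) by exact: measurableC.
apply: (@le_trans _ _ (sintegral mu (proj_nnsfun s mNC))); last first.
  apply: ereal_sup_ubound; exists (proj_nnsfun s mNC) => //= x.
  rewrite /= mindicE; case: (pselect (N x)) => Nx.
    by rewrite memNset ?mulr0 //; exact.
  by rewrite mem_set //= mulr1 -uv.
rewrite -!integralT_nnsfun (ge0_negligible_integral mN measurableT _ _ N0)//; last 2 first.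
- exact/measurable_EFinP.
- by move=> x _; rewrite lee_fin.
rewrite [leRHS](ge0_negligible_integral mN measurableT _ _ N0)//; last 2 first.
- exact/measurable_EFinP.
- by move=> x _; rewrite lee_fin.
rewrite le_eqVlt; apply/orP; left; apply/eqP; apply: eq_integral => x.
by rewrite inE => -[_ Nx]; rewrite /= mindicE mem_set ?mulr1.
Qed.

Lemma ae_Rintegral h1 h2 : circle_ae (fun t => h1 t = h2 t) ->
  \int[mu]_(t in angles) h1 t = \int[mu]_(t in angles) h2 t.
Proof.
move=> [N [mN N0 subN]].
have key (u v : R -> \bar R) : (forall t, 0 <= u t)%E -> (forall t, 0 <= v t)%E ->
    (forall t, ~ N t -> u t = v t) ->  (\int[mu]_t u t = \int[mu]_t v t)%E.
  move=> u0 v0 uv; apply/eqP; rewrite eq_le.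
  by rewrite !(@ge0_integral_ae_le _ _ N)// => t Nt; rewrite uv.
have eqN t : ~ N t -> ((EFin \o h1) \_ angles) t = ((EFin \o h2) \_ angles) t.
  move=> Nt; rewrite !patchE; case: ifPn => // /set_mem At /=.
  by congr (_%:E); apply: contrapT => h12; apply: Nt; apply: subN => /= /(_ At).
rewrite /Rintegral; congr fine.
rewrite integral_mkcond [RHS]integral_mkcond integralE [RHS]integralE.
by congr (_ - _)%E; apply: key => // t Nt; rewrite ?funeposE ?funenegE eqN.
Qed.

Lemma ae_rint h1 h2 : measurable_fun angles h2 ->
  circle_ae (fun t => h1 t = h2 t) -> rint h1 -> rint h2.
Proof.
move=> m2 ae12 i1; apply/integrableP; split; first exact/measurable_EFinP.
have /integrableP[m1 lty] := i1.
apply: le_lt_trans lty; rewrite le_eqVlt; apply/orP; left; apply/eqP.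
apply: ae_eq_integral => //.
- by apply: measurableT_comp => //; exact/measurable_EFinP.
- by apply: measurableT_comp.
- by move: ae12; rewrite /circle_ae; apply: (@filterS _ _ ae_filter) => t /= + At => ->.
Qed.

Lemma rmeanD h1 h2 : rint h1 -> rint h2 ->
  rmean (fun t => h1 t + h2 t) = rmean h1 + rmean h2.
Proof. by move=> i1 i2; rewrite /rmean RintegralD// mulrDr. Qed.

Lemma rmeanZ c h : rint h -> rmean (fun t => c * h t) = c * rmean h.
Proof. by move=> i1; rewrite /rmean RintegralZl// mulrCA. Qed.

Lemma rmeanN h : rint h -> rmean (fun t => - h t) = - rmean h.
Proof.
move=> i1; rewrite -mulN1r -rmeanZ//; congr (_ * _).
by apply: eq_Rintegral => t _; rewrite mulN1r.
Qed.

Lemma rmeanB h1 h2 : rint h1 -> rint h2 ->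
  rmean (fun t => h1 t - h2 t) = rmean h1 - rmean h2.
Proof. by move=> i1 i2; rewrite rmeanD ?rmeanN//; exact: rintN. Qed.

Lemma rmean_cst c : rmean (fun=> c) = c.
Proof.
rewrite /rmean Rintegral_cst// [X in fine X](mu_angles) /= mulrCA mulVf ?mulr1//.
by rewrite gt_eqF // pi2_gt0.
Qed.

Lemma le_rmean h1 h2 : rint h1 -> rint h2 -> (forall t, angles t -> h1 t <= h2 t) ->
  rmean h1 <= rmean h2.
Proof.
move=> i1 i2 h12; rewrite /rmean ler_wpM2l ?invr_ge0 ?(ltW pi2_gt0)//.
exact: le_Rintegral.
Qed.

Lemma rmean_ge0 h : (forall t, angles t -> 0 <= h t) -> 0 <= rmean h.
Proof.
by move=> h0; rewrite /rmean mulr_ge0 ?invr_ge0 ?(ltW pi2_gt0)// Rintegral_ge0.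
Qed.

Lemma rmean_eq0 h : rint h -> (forall t, angles t -> 0 <= h t) -> rmean h = 0 ->
  circle_ae (fun t => h t = 0).
Proof.
move=> ih h0 /eqP; rewrite mulf_eq0 invr_eq0 gt_eqF ?pi2_gt0//= => /eqP int0.
have /integrableP[mh lty] := ih.
have : (\int[mu]_(t in angles) `|(EFin \o h) t|)%E = 0%E.
  rewrite -[LHS]fineK; last first.
    by rewrite ge0_fin_numE //; apply: integral_ge0.
  congr (_%:E); rewrite -int0; congr fine; apply: eq_integral => t /set_mem At.
  by rewrite /= ger0_norm // h0.
move/(ae_eq_integral_abs _ measurable_anglesR mh); apply: (@filterS _ _ ae_filter) => t /= ht At.
by have [] := ht At.
Qed.

Lemma rmean_ae h1 h2 : circle_ae (fun t => h1 t = h2 t) -> rmean h1 = rmean h2.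
Proof. by move=> /ae_Rintegral e; rewrite /rmean e. Qed.

Lemma rmean_dct (u : nat -> R -> R) h k :
  (forall n, measurable_fun angles (u n)) -> measurable_fun angles h -> rint k ->
  circle_ae (fun t => u n t @[n --> \oo] --> h t) ->
  circle_ae (fun t => forall n, `|u n t| <= k t) ->
  rint h /\ rmean (u n) @[n --> \oo] --> rmean h.
Proof.
move=> mu_ mh ik cv dom.
have [] := @dominated_convergence _ _ _ mu angles measurable_anglesR
  (fun n => EFin \o u n) (EFin \o h) (EFin \o k).
- by move=> n; apply/measurable_EFinP; exact: mu_.
- exact/measurable_EFinP.
- move: cv; rewrite /circle_ae; apply: (@filterS _ _ ae_filter) => t /= + At => /(_ At) cv.
  by apply: cvg_EFin => //; exact: nearW.
- exact: ik.
- by move: dom; rewrite /circle_ae; apply: (@filterS _ _ ae_filter) => t /= dom n At; rewrite lee_fin; exact: dom.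
move=> ih _ cvi; split => //.
apply: cvgMr; apply: fine_cvg; rewrite fineK; first exact: cvi.
exact: integrable_fin_num.
Qed.

End ComplexIntegration.

#[local] Hint Resolve measurable_angles measurable_anglesR : core.
#[local] Hint Extern 0 (is_true (0 <= normsq _)) => exact: normsq_ge0 : core.

Section ComplexMeans.
Context {R : realType}.
Implicit Types (f g : R -> R[i]) (h : R -> R).
Notation mu := (@lebesgue_measure R).
Notation mean := (@circle_mean R).

Lemma rint_dom_ae h k : measurable_fun angles h -> rint k ->
  circle_ae (fun t => `|h t| <= k t) -> rint h.
Proof.
move=> mh ik [N [mN N0 subN]].
have mk := rint_meas ik.
pose k' t := Num.max `|h t| (k t).
apply: (@rint_dom R h k') => //; last by move=> t At; rewrite /k' le_max lexx.
have mk' : measurable_fun angles k'.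
  by apply: measurable_maxr => //; apply: measurableT_comp.
apply: (ae_rint mk' _ ik); exists N; split => // t /= nt; apply: subN => /= H.
by apply: nt => At; rewrite /k' max_r // H.
Qed.

Lemma circle_meanE f : mean f = rmean (fun t => Re (f t)) +i* rmean (fun t => Im (f t)).
Proof. by []. Qed.

Lemma Re_mean f : Re (mean f) = rmean (fun t => Re (f t)). Proof. by []. Qed.
Lemma Im_mean f : Im (mean f) = rmean (fun t => Im (f t)). Proof. by []. Qed.

Lemma eq_mean f g : (forall t, angles t -> f t = g t) -> mean f = mean g.
Proof.
move=> fg; rewrite !circle_meanE /rmean.
by congr (_ * _ +i* (_ * _)); apply: eq_Rintegral => t /set_mem At; rewrite fg.
Qed.

Lemma mean_ae f g : circle_ae (fun t => f t = g t) -> mean f = mean g.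
Proof.
by move=> fg; rewrite !circle_meanE; congr (_ +i* _); apply: rmean_ae;
  apply: filterS fg => t ->.
Qed.

Lemma cint_cmeas f : cint f -> cmeas f.
Proof. by case=> /rint_meas ? /rint_meas. Qed.

Lemma cintD f g : cint f -> cint g -> cint (fun t => f t + g t).
Proof.
move=> [fr fi] [gr gi]; split.
  by rewrite (_ : (fun t => _) = (fun t => Re (f t) + Re (g t)));
     [exact: rintD|apply/funext => t; rewrite ReImE].
by rewrite (_ : (fun t => _) = (fun t => Im (f t) + Im (g t)));
     [exact: rintD|apply/funext => t; rewrite ReImE].
Qed.

Lemma meanD f g : cint f -> cint g -> mean (fun t => f t + g t) = mean f + mean g.
Proof.
move=> [fr fi] [gr gi]; apply: complex_eq; rewrite !ReImE ?Re_mean ?Im_mean.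
  by rewrite -rmeanD//; congr rmean; apply/funext => t; rewrite ReImE.
by rewrite -rmeanD//; congr rmean; apply/funext => t; rewrite ReImE.
Qed.

Lemma cintZ c f : cint f -> cint (fun t => c * f t).
Proof.
move=> [fr fi]; split.
  rewrite (_ : (fun t => _) = (fun t => Re c * Re (f t) - Im c * Im (f t))).
    by apply: rintB; exact: rintZ.
  by apply/funext => t; rewrite ReImE.
rewrite (_ : (fun t => _) = (fun t => Re c * Im (f t) + Im c * Re (f t))).
  by apply: rintD; exact: rintZ.
by apply/funext => t; rewrite ReImE.
Qed.

Lemma meanZ c f : cint f -> mean (fun t => c * f t) = c * mean f.
Proof.
move=> [fr fi]; apply: complex_eq; rewrite !ReImE ?Re_mean ?Im_mean.
  rewrite -!rmeanZ// -rmeanB; [|exact: rintZ..].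
  by congr rmean; apply/funext => t; rewrite ReImE.
rewrite -!rmeanZ// -rmeanD; [|exact: rintZ..].
by congr rmean; apply/funext => t; rewrite ReImE.
Qed.

Lemma cintN f : cint f -> cint (fun t => - f t).
Proof.
move=> /(cintZ (-1)); rewrite (_ : (fun t => _) = (fun t => - f t))//.
by apply/funext => t; rewrite mulN1r.
Qed.

Lemma meanN f : cint f -> mean (fun t => - f t) = - mean f.
Proof.
by move=> i; rewrite -mulN1r -meanZ//; apply: eq_mean => t _; rewrite mulN1r.
Qed.

Lemma meanB f g : cint f -> cint g -> mean (fun t => f t - g t) = mean f - mean g.
Proof. by move=> i j; rewrite meanD ?meanN//; exact: cintN. Qed.

Lemma meanJ f : cint f -> mean (fun t => (f t)^*)%R = ((mean f)^*)%R.
Proof.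
move=> [fr fi]; apply: complex_eq; rewrite !ReImE ?Re_mean ?Im_mean.
  by congr rmean; apply/funext => t; rewrite ReImE.
by rewrite -rmeanN//; congr rmean; apply/funext => t; rewrite ReImE.
Qed.

Lemma cint_cst (c : R[i]) : @cint R (fun=> c).
Proof. by split; exact: rint_cst. Qed.

Lemma mean_cst (c : R[i]) : mean (fun=> c) = c.
Proof. by apply: complex_eq; rewrite ?Re_mean ?Im_mean rmean_cst. Qed.

Lemma cint_sum (I : Type) (s : seq I) (F : I -> R -> R[i]) :
  (forall i, cint (F i)) -> cint (fun t => \sum_(i <- s) F i t).
Proof.
move=> iF; elim: s => [|i s IHs].
  by under eq_fun do rewrite big_nil; exact: cint_cst.
by under eq_fun do rewrite big_cons; exact: cintD.
Qed.

Lemma mean_sum (I : Type) (s : seq I) (F : I -> R -> R[i]) :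
  (forall i, cint (F i)) ->
  mean (fun t => \sum_(i <- s) F i t) = \sum_(i <- s) mean (F i).
Proof.
move=> iF; elim: s => [|i s IHs].
  by under eq_fun do rewrite big_nil; rewrite big_nil mean_cst.
under eq_fun do rewrite big_cons; rewrite big_cons meanD ?IHs//.
exact: cint_sum.
Qed.

Lemma cmeasD f g : cmeas f -> cmeas g -> cmeas (fun t => f t + g t).
Proof.
move=> [fr fi] [gr gi]; split.
  by under eq_fun do rewrite ReImE; exact: measurable_funD.
by under eq_fun do rewrite ReImE; exact: measurable_funD.
Qed.

Lemma cmeasM f g : cmeas f -> cmeas g -> cmeas (fun t => f t * g t).
Proof.
move=> [fr fi] [gr gi]; split.
  by under eq_fun do rewrite ReImE; apply: measurable_funB; exact: measurable_funM.
by under eq_fun do rewrite ReImE; apply: measurable_funD; exact: measurable_funM.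
Qed.

Lemma cmeasJ f : cmeas f -> @cmeas R (fun t => (f t)^*)%R.
Proof.
move=> [fr fi]; split; first by under eq_fun do rewrite ReImE.
by under eq_fun do rewrite ReImE; exact/measurable_funN.
Qed.

Lemma cmeas_cst (c : R[i]) : @cmeas R (fun=> c).
Proof. by split; exact: measurable_cst. Qed.

Lemma cmeas_normsq f : cmeas f -> measurable_fun angles (fun t => normsq (f t)).
Proof. by move=> [fr fi]; apply: measurable_funD; exact: measurable_funX. Qed.

Lemma cmeas_expi (k : R) : cmeas (fun t => expi (k * t)).
Proof.
by split; apply: measurableT_comp => //; do ?exact: measurable_funM; apply: continuous_measurable_fun;
  [exact: continuous_cos|exact: continuous_sin].
Qed.

Lemma expiD (s t : R) : expi (s + t) = expi s * expi t.
Proof. by apply: complex_eq; rewrite !ReImE /= ?cosD // sinD addrC. Qed.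

Lemma expi0 : expi 0 = 1 :> R[i].
Proof. by rewrite /expi cos0 sin0. Qed.

Lemma expiN (t : R) : expi (- t) = ((expi t)^*)%R.
Proof. by apply: complex_eq; rewrite !ReImE /= ?cosN ?sinN. Qed.

Lemma normsq_expi (t : R) : normsq (expi t) = 1.
Proof. by rewrite /normsq /= cos2Dsin2. Qed.

Lemma norm_le_sqr (x y : R) : `|x * y| <= x ^+ 2 + y ^+ 2.
Proof.
have := sqr_ge0 (x - y); have := sqr_ge0 (x + y).
by rewrite ler_norml => *; apply/andP; split; nra.
Qed.

Lemma sL2M f g : sL2 f -> sL2 g -> cint (fun t => f t * g t).
Proof.
move=> [mf sf] [mg sg]; have [mr mi] := cmeasM mf mg.
have sfg := rintD sf sg.
have b : forall x y : R[i], `|Re (x * y)| <= normsq x + normsq y /\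
    `|Im (x * y)| <= normsq x + normsq y.
  move=> x y; rewrite /normsq !ReImE; split.
    apply: (le_trans (ler_normB _ _)).
    have := norm_le_sqr (Re x) (Re y); have := norm_le_sqr (Im x) (Im y); lra.
  apply: (le_trans (ler_normD _ _)).
  have := norm_le_sqr (Re x) (Im y); have := norm_le_sqr (Im x) (Re y); lra.
by split; apply: rint_dom sfg _ => // t _; have [] := b (f t) (g t).
Qed.

Lemma sL2_bdd f c : cmeas f -> (forall t, angles t -> normsq (f t) <= c) -> sL2 f.
Proof.
move=> mf fc; split => //; apply: (@rint_bdd R c); first exact: cmeas_normsq.
by move=> t At; rewrite ger0_norm //; exact: fc.
Qed.

Lemma sL2_cst (c : R[i]) : @sL2 R (fun=> c).
Proof. by apply: (@sL2_bdd _ (normsq c)) => //; exact: cmeas_cst. Qed.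

Lemma sL2_expi (k : R) : sL2 (fun t => expi (k * t)).
Proof.
by apply: (@sL2_bdd _ 1); [exact: cmeas_expi|move=> t _; rewrite normsq_expi].
Qed.

Lemma sL2D f g : sL2 f -> sL2 g -> sL2 (fun t => f t + g t).
Proof.
move=> [mf sf] [mg sg]; split; first exact: cmeasD.
apply: (rint_dom _ (rintD (rintZ 2 sf) (rintZ 2 sg))).
  by apply: cmeas_normsq; exact: cmeasD.
by move=> t _; rewrite ger0_norm //; exact: normsqD.
Qed.

Lemma sL2M_bdd f g c : cmeas f -> circle_ae (fun t => normsq (f t) <= c) ->
  sL2 g -> sL2 (fun t => f t * g t).
Proof.
move=> mf fc [mg sg]; split; first exact: cmeasM.
apply: (rint_dom_ae _ (rintZ c sg)); first by apply: cmeas_normsq; exact: cmeasM.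
apply: filterS fc => t fc.
by rewrite ger0_norm // normsqM; exact: ler_wpM2r.
Qed.

Lemma sL2Z c f : sL2 f -> sL2 (fun t => c * f t).
Proof.
by apply: (@sL2M_bdd _ _ (normsq c)); [exact: cmeas_cst|exact: nearW].
Qed.

Lemma sL2N f : sL2 f -> sL2 (fun t => - f t).
Proof.
move=> /(sL2Z (-1)); rewrite (_ : (fun t => _) = (fun t => - f t))//.
by apply/funext => t; rewrite mulN1r.
Qed.

Lemma sL2B f g : sL2 f -> sL2 g -> sL2 (fun t => f t - g t).
Proof. by move=> i j; apply: sL2D => //; exact: sL2N. Qed.

Lemma sL2J f : sL2 f -> @sL2 R (fun t => (f t)^*)%R.
Proof.
by move=> [mf sf]; split; [exact: cmeasJ|under eq_fun do rewrite normsqJ].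
Qed.

Lemma sL2_sum (I : Type) (s : seq I) (F : I -> R -> R[i]) :
  (forall i, sL2 (F i)) -> sL2 (fun t => \sum_(i <- s) F i t).
Proof.
move=> iF; elim: s => [|i s IHs].
  by under eq_fun do rewrite big_nil; exact: sL2_cst.
by under eq_fun do rewrite big_cons; exact: sL2D.
Qed.

Lemma sL2_cint f : sL2 f -> cint f.
Proof.
move=> /sL2M /(_ (sL2_cst 1)).
by rewrite (_ : (fun t => _) = f)//; apply/funext => t; rewrite mulr1.
Qed.

Lemma sL2_ae f g : cmeas g -> circle_ae (fun t => f t = g t) -> sL2 f -> sL2 g.
Proof.
move=> mg fg [mf sf]; split => //; apply: ae_rint sf; first exact: cmeas_normsq.
by apply: filterS fg => t ->.
Qed.

Lemma mean_dct (u : nat -> R -> R[i]) f h :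
  (forall n, cmeas (u n)) -> cmeas f -> rint h ->
  circle_ae (fun t => Re (u n t) @[n --> \oo] --> Re (f t) /\
                      Im (u n t) @[n --> \oo] --> Im (f t)) ->
  circle_ae (fun t => forall n, normsq (u n t) <= h t ^+ 2) ->
  (forall t, angles t -> 0 <= h t) ->
  [/\ cint f, Re (mean (u n)) @[n --> \oo] --> Re (mean f)
    & Im (mean (u n)) @[n --> \oo] --> Im (mean f)].
Proof.
move=> mu_ [fr fi] ih cv dom h0.
have ae0 : circle_ae (fun t => 0 <= h t) by exact: aeW.
have [] := @rmean_dct R (fun n t => Re (u n t)) (fun t => Re (f t)) h _ fr ih.
- by move=> n; have [] := mu_ n.
- by apply: filterS cv => t [].
- apply: filterS2 ae0 dom => t ht dom n.
  rewrite -ler_sqr ?nnegrE // real_normK ?num_real //.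
  exact: le_trans (Re_normsq _) (dom n).
move=> ir cr.
have [] := @rmean_dct R (fun n t => Im (u n t)) (fun t => Im (f t)) h _ fi ih.
- by move=> n; have [] := mu_ n.
- by apply: filterS cv => t [].
- apply: filterS2 ae0 dom => t ht dom n.
  rewrite -ler_sqr ?nnegrE // real_normK ?num_real //.
  exact: le_trans (Im_normsq _) (dom n).
by move=> ii ci; split.
Qed.

End ComplexMeans.

(** * Uniqueness of Fourier coefficients *)

Section IndicatorApproximation.
Context {R : realType}.
Implicit Types (A th : R) (n m : nat).

(** Both Bernoulli inequalities serve to compare [cut], defined below, with
    geometric sequences. *)
Lemma bernoulli_ge (x : R) m : 0 <= x -> 1 + m%:R * x <= (1 + x) ^+ m.
Proof.
move=> x0; elim: m => [|m IHm]; first by rewrite mul0r addr0 expr0.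
rewrite exprS; apply: (@le_trans _ _ ((1 + x) * (1 + m%:R * x))).
  rewrite -natr1; have : 0 <= m%:R * (x * x) by rewrite !mulr_ge0.
  by move=> ?; nra.
by rewrite ler_wpM2l // addr_ge0.
Qed.

Lemma bernoulli_le (x : R) m : 0 <= x <= 1 -> 1 - m%:R * x <= (1 - x) ^+ m.
Proof.
move=> /andP[x0 x1]; elim: m => [|m IHm]; first by rewrite mul0r subr0 expr0.
rewrite exprS; apply: (@le_trans _ _ ((1 - x) * (1 - m%:R * x))).
  rewrite -natr1; have : 0 <= m%:R * (x * x) by rewrite !mulr_ge0.
  by move=> ?; nra.
by rewrite ler_wpM2l // subr_ge0.
Qed.

(** The exponent sits between [th ^- n] and [th ^- n + 1]: so it is negligible
    against [A ^- n] when [A < th] and dominates it when [th < A]. *)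
Definition cut_exponent th n := (Num.truncn (th ^- n)).+1.

(** Polynomials in [A] (these are the cut-offs of Stone's proof of the
    Weierstrass theorem), with values in [0, 1], that converge to 1 below the
    threshold [th] and to 0 above it. *)
Definition cut th n A := (1 - A ^+ n) ^+ cut_exponent th n.

Lemma cut01 th n A : 0 <= A <= 1 -> 0 <= cut th n A <= 1.
Proof.
move=> /andP[A0 A1]; have x0 : 0 <= A ^+ n by rewrite exprn_ge0.
have x1 : A ^+ n <= 1 by rewrite exprn_ile1.
by rewrite /cut exprn_ge0 ?exprn_ile1 ?subr_ge0// lerBlDr lerDl.
Qed.

Lemma cut_below th A : 0 < th < 1 -> 0 <= A < th ->
  cut th n A @[n --> \oo] --> (1 : R).
Proof.
move=> /andP[th0 th1] /andP[A0 Ath]; have A1 : A < 1 by exact: lt_trans th1.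
have bnd n : 1 - ((A / th) ^+ n + A ^+ n) <= cut th n A <= 1.
  have /andP[_ ->] : 0 <= cut th n A <= 1 by apply: cut01; rewrite A0 ltW.
  rewrite andbT; apply: (le_trans _ (bernoulli_le _ _)); last first.
    by rewrite exprn_ge0 // exprn_ile1 // ltW.
  rewrite lerD2l lerN2 -natr1 mulrDl mul1r lerD2r expr_div_n mulrC.
  by rewrite ler_wpM2l ?exprn_ge0// truncn_le // invr_ge0 exprn_ge0 // ltW.
apply: (@squeeze_cvgr _ _ _ _ (fun n => 1 - ((A / th) ^+ n + A ^+ n)) (fun=> 1)).
- exact: nearW.
- rewrite -[X in _ --> X](subr0 1) -[X in _ --> _ - X](addr0 0).
  apply: cvgB; first exact: cvg_cst.
  apply: cvgD; apply: cvg_expr.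
    by rewrite ger0_norm ?divr_ge0 ?(ltW th0)// ltr_pdivrMr// mul1r.
  by rewrite ger0_norm.
- exact: cvg_cst.
Qed.

Lemma cut_above th A : 0 < th < 1 -> th < A <= 1 ->
  cut th n A @[n --> \oo] --> (0 : R).
Proof.
move=> /andP[th0 th1] /andP[thA A1]; have A0 : 0 < A by exact: lt_trans thA.
have bnd n : 0 <= cut th n A <= (th / A) ^+ n.
  have /andP[-> _] : 0 <= cut th n A <= 1 by apply: cut01; rewrite A1 ltW.
  have x0 : 0 <= A ^+ n by rewrite exprn_ge0 // ltW.
  have x1 : A ^+ n <= 1 by rewrite exprn_ile1 // ltW.
  set m := cut_exponent th n.
  have le1 : cut th n A * (1 + A ^+ n) ^+ m <= 1.
    rewrite /cut -/m -exprMn exprn_ile1 //.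
      by rewrite mulr_ge0 ?subr_ge0 ?addr_ge0.
    have -> : (1 - A ^+ n) * (1 + A ^+ n) = 1 - (A ^+ n) ^+ 2 by ring.
    by rewrite lerBlDr lerDl sqr_ge0.
  have le2 : (A / th) ^+ n <= (1 + A ^+ n) ^+ m.
    apply: le_trans (bernoulli_ge _ x0).
    apply: (@le_trans _ _ (m%:R * A ^+ n)); last by rewrite lerDr.
    rewrite expr_div_n mulrC ler_wpM2r // ltW // truncnS_gt //.
  have pos : 0 < (A / th) ^+ n by rewrite exprn_gt0 // divr_gt0.
  have -> : (th / A) ^+ n = ((A / th) ^+ n)^-1 by rewrite -exprVn invf_div.
  rewrite -(ler_pM2r pos) mulVf ?gt_eqF//; apply: le_trans le1.
  rewrite ler_wpM2l //.
  by have /andP[] : 0 <= cut th n A <= 1 by apply: cut01; rewrite A1 ltW.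
apply: (@squeeze_cvgr _ _ _ _ (fun=> 0) (fun n => (th / A) ^+ n)).
- exact: nearW.
- exact: cvg_cst.
- apply: cvg_expr.
  by rewrite ger0_norm ?divr_ge0 ?(ltW th0) ?(ltW A0)// ltr_pdivrMr// mul1r.
Qed.

Lemma cos_gt_near (r s : R) : 0 < r <= pi -> `|s| < r -> cos r < cos s.
Proof.
move=> /andP[r0 rpi] sr; rewrite -[cos s]cos_norm ltr_cos //.
  by rewrite in_itv /= normr_ge0 (le_trans (ltW sr)).
by rewrite in_itv /= (ltW r0).
Qed.

Lemma cos_lt_far (r s : R) : 0 < r -> r < `|s| < 2 * pi - r -> cos s < cos r.
Proof.
move=> r0 /andP[rs spi]; rewrite -[cos s]cos_norm.
have pi0 := @pi_gt0 R.
have [le|gt] := leP `|s| pi.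
  by rewrite ltr_cos // in_itv /=; apply/andP; split; lra.
have -> : cos `|s| = cos (2 * pi - `|s|).
  by rewrite -[RHS]cosN opprB -[RHS]cosD2pi mulr_natl subrK.
rewrite ltr_cos // ?in_itv /=; try (apply/andP; split); lra.
Qed.

End IndicatorApproximation.

Section Uniqueness.
Context {R : realType}.
Implicit Types (f g : R -> R[i]) (h : R -> R).
Notation mu := (@lebesgue_measure R).
Notation mean := (@circle_mean R).

Definition ek (k : int) (t : R) : R[i] := expi (k%:~R * t).

Lemma ekD j k t : ek (j + k) t = ek j t * ek k t.
Proof. by rewrite /ek -expiD intrD mulrDl. Qed.

Lemma ekN k t : ek (- k) t = ((ek k t)^*)%R.
Proof. by rewrite /ek -expiN intrN mulNr. Qed.

Lemma ek0 t : ek 0 t = 1.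
Proof. by rewrite /ek mul0r expi0. Qed.

Lemma normsq_ek k t : normsq (ek k t) = 1.
Proof. exact: normsq_expi. Qed.

Lemma cmeas_ek k : cmeas (ek k).
Proof. exact: cmeas_expi. Qed.

Lemma sL2_ek k : sL2 (ek k).
Proof. exact: sL2_expi. Qed.

Lemma cintM_bdd f (b : R -> R[i]) c : cmeas b ->
  (forall t, angles t -> normsq (b t) <= c) -> cint f ->
  cint (fun t => f t * b t).
Proof.
move=> mb bc cf; have [mr mi] := cmeasM (cint_cmeas cf) mb.
have [fr fi] := cf.
have ik : rint (fun t => (1 + c) * (`|Re (f t)| + `|Im (f t)|)).
  by apply: rintZ; apply: rintD; [apply: (integrable_norm fr)|apply: (integrable_norm fi)].
have b1 t : angles t -> `|Re (b t)| <= 1 + c /\ `|Im (b t)| <= 1 + c.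
  move=> At; have := bc t At; rewrite /normsq => bt.
  have := sqr_ge0 (Re (b t)); have := sqr_ge0 (Im (b t)).
  have := sqr_ge0 (Re (b t) - 1); have := sqr_ge0 (Im (b t) - 1).
  have := sqr_ge0 (Re (b t) + 1); have := sqr_ge0 (Im (b t) + 1).
  by move=> *; split; rewrite ler_norml; apply/andP; split; nra.
split; apply: rint_dom ik _ => // t At; have [b1t b2t] := b1 _ At; rewrite ReImE.
  apply: (le_trans (ler_normB _ _)); rewrite !normrM mulrDr.
  by apply: lerD; rewrite mulrC ler_wpM2r.
apply: (le_trans (ler_normD _ _)); rewrite !normrM mulrDr.
by apply: lerD; rewrite mulrC ler_wpM2r.
Qed.

(** Orthogonality to all characters, in a form that is stable under
    multiplication by trigonometric polynomials. *)
Definition null_coefs f := cint f /\ forall k, mean (fun t => f t * ek k t) = 0.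

Lemma null_coefsZ c f : null_coefs f -> null_coefs (fun t => c * f t).
Proof.
move=> [cf zf]; split; first exact: cintZ.
move=> k; under eq_fun do rewrite -mulrA.
rewrite meanZ ?zf ?mulr0//.
apply: (@cintM_bdd _ _ 1) => //; first exact: cmeas_ek.
by move=> t _; rewrite normsq_ek.
Qed.

Lemma null_coefsD f g : null_coefs f -> null_coefs g ->
  null_coefs (fun t => f t + g t).
Proof.
move=> [cf zf] [cg zg]; split; first exact: cintD.
move=> k; under eq_fun do rewrite mulrDl.
by rewrite meanD ?zf ?zg ?addr0//; apply: (@cintM_bdd _ _ 1) => //;
  do ?[exact: cmeas_ek|move=> t _; rewrite normsq_ek].
Qed.

Lemma null_coefs_ek j f : null_coefs f -> null_coefs (fun t => f t * ek j t).
Proof.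
move=> [cf zf]; split.
  by apply: (@cintM_bdd _ _ 1) => //; [exact: cmeas_ek|move=> t _; rewrite normsq_ek].
by move=> k; under eq_fun do rewrite -mulrA -ekD.
Qed.

(** The factor is [sin ((t - x) / 2) ^ 2], the trigonometric polynomial that
    measures the distance from [t] to [x] on the circle within [0, 1]. *)
Lemma null_coefs_cos x f : null_coefs f ->
  null_coefs (fun t => f t * ((1 - cos (t - x)) / 2)%:C).
Proof.
move=> zf.
have := null_coefsD (null_coefsZ (2^-1)%:C zf)
  (null_coefsD (null_coefsZ (- 4^-1%:C * expi (- x)) (null_coefs_ek 1 zf))
               (null_coefsZ (- 4^-1%:C * expi x) (null_coefs_ek (-1) zf))).
congr null_coefs; apply/funext => t.
have -> : ek 1 t = expi t by rewrite /ek mul1r.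
have -> : ek (-1) t = expi (- t) by rewrite /ek mulN1r.
by apply: complex_eq; rewrite !ReImE /= cosB !cosN !sinN; field.
Qed.

Lemma null_coefs_cut x th n f : null_coefs f ->
  null_coefs (fun t => f t * (cut th n ((1 - cos (t - x)) / 2))%:C).
Proof.
rewrite /cut; set A := fun t => (1 - cos (t - x)) / 2.
have pow m g : null_coefs g -> null_coefs (fun t => g t * (A t ^+ m)%:C).
  elim: m g => [|m IHm] g zg; first by under eq_fun do rewrite expr0 mulr1.
  by under eq_fun do rewrite exprSr rmorphM mulrA; apply: null_coefs_cos; exact: IHm.
have onem g : null_coefs g -> null_coefs (fun t => g t * (1 - A t ^+ n)%:C).
  move=> zg; have := null_coefsD zg (null_coefsZ (-1) (pow n g zg)).
  by congr null_coefs; apply/funext => t; rewrite rmorphB mulrBr mulr1 mulN1r.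
move=> zf; elim: (cut_exponent th n) => [|m IHm].
  by under eq_fun do rewrite expr0 mulr1.
by under eq_fun do rewrite exprSr rmorphM mulrA; exact: onem.
Qed.

Lemma ae_neq (a : R) : circle_ae (fun t => t != a).
Proof.
exists [set a]; split; [exact: measurable_set1|exact: lebesgue_measure_set1|].
by move=> t /= H; apply: contrapT => ne; apply: H => _; apply/eqP.
Qed.

(** Multiplying [f] by the cut-offs of [sin ((t - x) / 2) ^ 2] keeps the mean
    equal to zero, and in the limit restricts [f] to an arc. *)
Lemma null_coefs_arc f (x r : R) : null_coefs f -> 0 < r -> r < x -> r < 2 * pi - x ->
  \int[mu]_(t in ball x r) Re (f t) = 0.
Proof.
move=> zf r0 rx rpi; have pi0 := @pi_gt0 R.
pose A t := (1 - cos (t - x)) / 2; pose th := (1 - cos r) / 2.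
have [[fr _] _] := zf.
have rpi' : r < pi by lra.
have th01 : 0 < th < 1.
  have h1 : cos r < cos 0 by rewrite ltr_cos // in_itv /=; apply/andP; split; lra.
  have h2 : cos pi < cos r by rewrite ltr_cos // in_itv /=; apply/andP; split; lra.
  by move: h1 h2; rewrite /th cos0 cospi => *; apply/andP; split; lra.
have A01 t : 0 <= A t <= 1.
  have := cos_le1 (t - x); have := cos_geN1 (t - x).
  by rewrite /A => *; apply/andP; split; lra.
have mA n : measurable_fun angles (fun t => cut th n (A t)).
  apply: measurable_funX; apply: measurable_funB; first exact: measurable_cst.
  apply: measurable_funX; apply: measurable_funM; last exact: measurable_cst.
  apply: measurable_funB; first exact: measurable_cst.
  apply: measurableT_comp; first by apply: continuous_measurable_fun; exact: continuous_cos.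
  exact: measurable_funB.
pose u n t := Re (f t) * cut th n (A t).
pose l t := Re (f t) * \1_(ball x r) t.
have u0 n : rmean (u n) = 0.
  have [_ /(_ 0)] := null_coefs_cut x th n zf.
  move=> /(congr1 (@complex.Re R)); rewrite Re_mean Re0 => e; apply: etrans e; congr rmean; apply/funext => t.
  by rewrite ek0 mulr1 ReImE /= mulr0 subr0.
have mf := rint_meas fr.
have ball_meas : measurable (ball x r) by exact: measurable_ball.
have [] := @rmean_dct R u l (fun t => `|Re (f t)|).
- by move=> n; apply: measurable_funM.
- by apply: measurable_funM.
- exact: (integrable_norm fr).
- have n1 : circle_ae (fun t => t != x - r) by exact: ae_neq.
  have n2 : circle_ae (fun t => t != x + r) by exact: ae_neq.
  have n3 : circle_ae (angles : set R) by apply: aeW => t At; exact: At.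
  apply: filterS3 n1 n2 n3 => t t1 t2; rewrite /angles /= in_itv /= => /andP[t0 tpi].
  apply: cvgMr.
  have -> : \1_(ball x r) t = (`|t - x| < r)%R%:R :> R.
    by rewrite indicE; congr (_%:R); congr nat_of_bool;
      apply/idP/idP; rewrite inE /ball /= distrC.
  have [lt|ge] := ltP `|t - x| r.
    apply: cut_below => //; have /andP[-> _] := A01 t.
    have : cos r < cos (t - x) by apply: cos_gt_near => //; rewrite r0 ltW.
    by rewrite /A /th => ?; lra.
  apply: cut_above => //; have /andP[_ ->] := A01 t.
  have gt : r < `|t - x|.
    rewrite lt_neqAle ge andbT; apply/eqP => e.
    case: (ler0P (t - x)) e => _ e.
      by move/eqP: t1; apply; lra.
    by move/eqP: t2; apply; lra.
  have : cos (t - x) < cos r.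
    apply: cos_lt_far => //; rewrite gt /=.
    by rewrite ltr_norml; apply/andP; split; lra.
  by rewrite /A /th => ?; rewrite andbT; lra.
- apply: nearW => t _ n; rewrite /u normrM.
  have /andP[c0 c1] := @cut01 _ th n _ (A01 t).
  by rewrite (ger0_norm c0) ler_piMr.
move=> il; rewrite (_ : (fun n => rmean (u n)) = fun=> 0); last exact/funext.
move=> cl; have /eqP : rmean l = 0.
  by apply: (cvg_unique _ cl); [exact: Rhausdorff|exact: cvg_cst].
rewrite /rmean mulf_eq0 invr_eq0 gt_eqF ?pi2_gt0//= => /eqP l0.
have sub : ball x r `<=` angles.
  move=> t; rewrite /ball /angles /= in_itv /= ltr_norml => /andP[? ?].
  by apply/andP; split; lra.
rewrite -(setIidr sub) Rintegral_mkcondr -[RHS]l0.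
apply: eq_Rintegral => t _; rewrite patchE /l indicE.
by case: ifPn => _; rewrite ?mulr1 ?mulr0.
Qed.

(** The averages over the arcs centred at a point vanish, and so does the
    function at its Lebesgue points. *)
Lemma null_coefs_Re f : null_coefs f -> circle_ae (fun t => Re (f t) = 0).
Proof.
move=> zf; have [[fr _] _] := zf.
pose h := (fun t => Re (f t)) \_ angles.
have li : locally_integrable setT h by exact: integrable_locally_restrict.
pose E (x : R) (n : nat) : set R := ball x (n.+1%:R^-1).
have hE x : nicely_shrinking x (E x).
  split; first by move=> n; exact: measurable_ball.
  exists (1, fun n => PosNum (@divr_gt0 R 1 n.+1%:R ltr01 (ltr0Sn _ n))); split => //=.
  - by under eq_fun do rewrite mul1r; exact: cvg_harmonic.
  - by move=> n; rewrite /E mul1r.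
  - by move=> n; rewrite /E mul1r mul1e.
have := lebesgue_differentiation li.
have n1 : circle_ae (fun t : R => t != 0) by exact: ae_neq.
have n2 : circle_ae (fun t : R => t != 2 * pi) by exact: ae_neq.
have n3 : circle_ae (angles : set R) by apply: aeW => t At; exact: At.
move=> n4; have {}n4 : circle_ae (lebesgue_pt h).
  by move: n4; rewrite /circle_ae; apply: (@filterS _ _ (ae_filter_ringOfSetsType _)).
apply: filterS2 (filterI n1 n2) (filterI n3 n4) => x [x0 xpi] [Ax lx].
have /andP[x0' xpi'] : 0 < x < 2 * pi.
  move: Ax; rewrite /angles /= in_itv /= => /andP[a b].
  by rewrite !lt_neqAle eq_sym x0 a xpi b.
have := nice_lebesgue_differentiation hE li lx.
have m0 : 0 < Num.min x (2 * pi - x) by rewrite lt_min; apply/andP; split; lra.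
have h0 : \forall n \near \oo, ((mu (E x n))^-1 * \int[mu]_(y in E x n) (h y)%:E)%E = 0%E.
  have := near_infty_natSinv_lt (PosNum m0); apply: filterS => n /=.
  rewrite lt_min => /andP[nx npi].
  rewrite (_ : (\int[mu]_(y in E x n) _)%E = 0%E) ?mule0//.
  have sub : E x n `<=` angles.
    move=> t; rewrite /E /ball /angles /= in_itv /= ltr_norml.
    move: nx npi; set e := _^-1 => nx npi /andP[a b].
    by apply/andP; split; lra.
  have mE : measurable (E x n : set (measurableTypeR R)) by exact: measurable_ball.
  transitivity (\int[mu]_(y in E x n) (Re (f y))%:E)%E.
    apply: eq_integral; move=> t /set_mem Et; rewrite /h patchE mem_set //; exact: sub.
  rewrite -[LHS]fineK; last first.
    by apply: integrable_fin_num => //; apply: (integrableS measurable_anglesR mE sub fr).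
  by congr (_%:E); apply: null_coefs_arc zf _ nx _ => //; lra.
move=> cv; have : (0%E : \bar R) = (h x)%:E.
  apply: (cvg_unique _ _ cv); first exact: ereal_hausdorff.
  exact: cvg_near_cst h0.
by rewrite /h patchE mem_set // => -[].
Qed.

(** Multiplying by [-i] turns the imaginary part into a real part. *)
Lemma null_coefs_ae0 f : null_coefs f -> circle_ae (fun t => f t = 0).
Proof.
move=> zf; have := null_coefs_Re zf; have := null_coefs_Re (null_coefsZ (- 'i)%C zf).
apply: filterS2 => t; rewrite ReImE /= => im re.
by apply: complex_eq => //=; move: im; lra.
Qed.

End Uniqueness.

(** * Almost everywhere convergence *)

Section MeasureLimits.
Context {R : realType}.
Implicit Types (h : R -> R).
Notation mu := (@lebesgue_measure R).

(** The upper limit of a sequence of measurable functions is measurable and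
    defined everywhere. *)
Lemma ae_cvg_measurable (w : nat -> R -> R) :
  (forall n, measurable_fun angles (w n)) ->
  circle_ae (fun t => exists l : R, w n t @[n --> \oo] --> l) ->
  exists2 l : R -> R, measurable_fun angles l & circle_ae (fun t => w n t @[n --> \oo] --> l t).
Proof.
move=> mw cw; exists (fun t => fine (limn_esup (fun n => (w n t)%:E))).
  apply: measurableT_comp => //.
  by apply: measurable_fun_limn_esup => n; exact/measurable_EFinP.
apply: filterS cw => t [l wl].
have wlE : (w n t)%:E @[n --> \oo] --> l%:E by apply: cvg_EFin => //; exact: nearW.
rewrite is_cvg_limn_esupE; last by apply/cvg_ex; exists l%:E.
by rewrite (cvg_lim _ wlE).
Qed.

Lemma rint_EFin h : rint h -> (\int[mu]_(t in angles) (h t)%:E)%E = (2 * pi * rmean h)%:E.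
Proof.
move=> ih; rewrite /rmean mulrA mulfV ?mul1r ?gt_eqF ?pi2_gt0//.
by rewrite /Rintegral fineK//; exact: integrable_fin_num.
Qed.

Lemma rmean_fatou (u : nat -> R -> R) h c :
  (forall n, rint (u n)) -> (forall n t, 0 <= u n t) -> (forall n, rmean (u n) <= c) ->
  measurable_fun angles h -> (forall t, 0 <= h t) ->
  circle_ae (fun t => u n t @[n --> \oo] --> h t) -> rint h /\ rmean h <= c.
Proof.
move=> iu u0 uc mh h0 cv.
have mu_ n : measurable_fun angles (fun t => (u n t)%:E).
  by apply/measurable_EFinP; exact: rint_meas.
have lim_le : (limn_einf (fun n => \int[mu]_(t in angles) (u n t)%:E) <= (2 * pi * c)%:E)%E.
  apply: (le_trans (limn_einf_sup _)); rewrite limn_esup_lim.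
  apply: lime_le; first exact: is_cvg_esups.
  apply: nearW => n; apply: ge_ereal_sup => _ [m _ <-].
  by rewrite rint_EFin // lee_fin ler_wpM2l // ltW // pi2_gt0.
have intE : (\int[mu]_(t in angles) (h t)%:E)%E =
    (\int[mu]_(t in angles) limn_einf (fun n => (u n t)%:E))%E.
  apply: ae_eq_integral => //.
  - exact/measurable_EFinP.
  - rewrite /limn_einf; apply: measurableT_comp => //.
    apply: (@measurable_fun_limn_esup _ _ _ _ (fun n t => - (u n t)%:E)%E) => n.
    apply: measurableT_comp => //.
  move: cv; rewrite /circle_ae; apply: (@filterS _ _ (ae_filter_ringOfSetsType _)).
  move=> t /= cv At; have {}cv : (u n t)%:E @[n --> \oo] --> (h t)%:E.
    by apply: cvg_EFin => //; [exact: nearW|exact: cv].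
  by rewrite is_cvg_limn_einfE; [rewrite (cvg_lim _ cv)|apply/cvg_ex; exists (h t)%:E].
have le_c : (\int[mu]_(t in angles) (h t)%:E <= (2 * pi * c)%:E)%E.
  rewrite intE; apply: le_trans lim_le.
  by apply: (@fatou _ _ _ mu angles measurable_anglesR (fun n t => (u n t)%:E)) => // n t _; rewrite lee_fin.
have ih : rint h.
  apply/integrableP; split; first exact/measurable_EFinP.
  apply: le_lt_trans (ltry (2 * pi * c)); apply: le_trans le_c.
  rewrite le_eqVlt; apply/orP; left; apply/eqP.
  by apply: eq_integral => t _; rewrite /= ger0_norm.
by split => //; move: le_c; rewrite rint_EFin // lee_fin ler_pM2l // pi2_gt0.
Qed.

(** The sum of the absolute values is integrable, hence finite almost
    everywhere. *)
Lemma ae_cvg_series (w : nat -> R -> R) : (forall n, rint (w n)) ->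
  (forall n, rmean (fun t => `|w n t|) <= 2 ^- n) ->
  circle_ae (fun t => exists l : R, \sum_(0 <= k < n) w k t @[n --> \oo] --> l).
Proof.
move=> iw bw; have iaw n : rint (fun t => `|w n t|) by exact: integrable_norm (iw n).
pose S t := (\big[+%E/0%R]_(0 <= n <oo) `|w n t|%:E)%E.
have mS n : measurable_fun angles (fun t => `|w n t|%:E).
  by apply/measurable_EFinP; exact: rint_meas (iaw n).
have S0 t : (0 <= S t)%E by apply: nneseries_ge0 => n _ _; rewrite lee_fin.
have bS : (\int[mu]_(t in angles) S t < +oo)%E.
  rewrite /S (integral_nneseries mu measurable_anglesR mS) //.
  apply: le_lt_trans (ltry (2 * pi * 2)); apply: lime_le.
    by apply: is_cvg_nneseries => n _ _; apply: integral_ge0.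
  apply: nearW => n; rewrite (eq_bigr (fun k => (2 * pi * rmean (fun t => `|w k t|))%:E)); last first.
    by move=> k _; rewrite -rint_EFin.
  rewrite sumEFin lee_fin -mulr_sumr ler_wpM2l ?(ltW pi2_gt0)//.
  apply: (@le_trans _ _ (2 - 2 * 2 ^- n)); last by rewrite lerBlDr lerDl mulr_ge0 // invr_ge0 exprn_ge0.
  elim: n => [|n IHn]; first by rewrite big_nil expr0; lra.
  rewrite big_nat_recr //=; apply: (le_trans (lerD IHn (bw n))).
  have -> : 2 ^- n.+1 = 2 ^- n / 2 :> R by rewrite exprSr invfM.
  lra.
have iS : mu.-integrable angles S.
  apply/integrableP; split.
    by apply: (@ge0_emeasurable_sum _ _ _ angles (fun n t => `|w n t|%:E) xpredT) => // k t _ _; rewrite lee_fin.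
  apply: le_lt_trans bS; rewrite le_eqVlt; apply/orP; left; apply/eqP.
  by apply: eq_integral => t _; rewrite gee0_abs.
have := integrable_ae measurable_anglesR iS.
rewrite /circle_ae; apply: (@filterS _ _ (ae_filter_ringOfSetsType _)) => t /= fS At.
have {}fS := fS At.
have : cvg (series (fun n => `|w n t|) @ \oo).
  by apply: nnseries_is_cvg => //; rewrite ltey_eq [X in X || _]fS.
by move/normed_cvg/cvg_ex.
Qed.

End MeasureLimits.

(** * Fourier series and the Riesz projection *)

Section Orthonormality.
Context {R : realType}.
Implicit Types (f g p : R -> R[i]) (h : R -> R).
Notation mu := (@lebesgue_measure R).
Notation mean := (@circle_mean R).

Lemma ek_2pi k : ek k (2 * pi) = 1 :> R[i].
Proof.
have nat_case (n : nat) : ek n (2 * pi) = 1 :> R[i].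
  elim: n => [|n IHn]; first by rewrite ek0.
  rewrite -addn1 PoszD ekD IHn mul1r /ek mul1r /expi.
  have -> : 2 * pi = 0 + pi *+ 2 :> R by rewrite add0r mulr_natl.
  by rewrite cosD2pi sinD2pi cos0 sin0.
case: k => n; first exact: nat_case.
by rewrite NegzE ekN nat_case conjC1.
Qed.

Lemma rmean_FTC h H : continuous h -> (forall x : R, is_derive x 1 H (h x)) ->
  H (2 * pi) = H 0 -> rmean h = 0.
Proof.
move=> ch dH e; have cH x : {for x, continuous H}.
  by apply/differentiable_continuous/derivable1_diffP; apply: ex_derive.
rewrite /rmean /Rintegral (@continuous_FTC2 _ h H) ?pi2_gt0//.
- by rewrite e subee //= mulr0.
- exact: continuous_subspaceT.
- split.
  + by move=> x _; apply: ex_derive.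
  + by apply: cvg_at_right_filter; exact: cH.
  + by apply: cvg_at_left_filter; exact: cH.
- by move=> x _; rewrite derive1E; apply: derive_val.
Qed.

Lemma mean_ek k : mean (ek k) = (k == 0)%:R.
Proof.
have [->|k0] := eqVneq k 0.
  by rewrite -[RHS](mean_cst 1); apply: eq_mean => t _; rewrite ek0.
have c0 : (k%:~R : R) != 0 by rewrite intr_eq0.
have := ek_2pi k; rewrite /ek; set c := k%:~R : R in c0 *.
move=> [c1 s0].
have cl : continuous (fun t : R => c * t) by move=> t; apply: cvgMr; exact: cvg_id.
apply: complex_eq.
  rewrite Re_mean; apply: (@rmean_FTC _ (fun t => c^-1 * sin (c * t))).
  - move=> t; apply: (@continuous_comp _ _ _ (fun t => c * t) cos); first exact: cl.
    exact: continuous_cos.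
  - move=> x; apply: is_derive_eq; rewrite /= /GRing.scale /=.
    by rewrite mulr1 mulrCA mulVf ?mulr1.
  - by rewrite s0 !mulr0 sin0 mulr0.
rewrite Im_mean; apply: (@rmean_FTC _ (fun t => - c^-1 * cos (c * t))).
- move=> t; apply: (@continuous_comp _ _ _ (fun t => c * t) sin); first exact: cl.
  exact: continuous_sin.
- move=> x; apply: is_derive_eq; rewrite /= /GRing.scale /=.
  by rewrite mulr1 mulNr mulNr mulrN opprK mulrCA mulVf ?mulr1.
- by rewrite c1 !mulr0 cos0.
Qed.

Definition ip f g : R[i] := mean (fun t => f t * (g t)^*)%R.
Definition nrm2 f : R := rmean (fun t => normsq (f t)).
Definition coef f (k : int) : R[i] := mean (fun t => f t * ek (- k) t).

Lemma ip_cint f g : sL2 f -> sL2 g -> cint (fun t => f t * (g t)^*)%R.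
Proof. by move=> sf sg; apply: sL2M => //; exact: sL2J. Qed.

Lemma ipC f g : sL2 f -> sL2 g -> ip g f = ((ip f g)^*)%R.
Proof.
move=> sf sg; rewrite /ip -meanJ; last exact: ip_cint.
by apply: eq_mean => t _; rewrite rmorphM /= conjCK mulrC.
Qed.

Lemma ipDl f g p : sL2 f -> sL2 g -> sL2 p ->
  ip (fun t => f t + g t) p = ip f p + ip g p.
Proof.
move=> sf sg sp; rewrite /ip -meanD; [|exact: ip_cint..].
by apply: eq_mean => t _; rewrite mulrDl.
Qed.

Lemma ipZl c f g : sL2 f -> sL2 g -> ip (fun t => c * f t) g = c * ip f g.
Proof.
move=> sf sg; rewrite /ip -meanZ; last exact: ip_cint.
by apply: eq_mean => t _; rewrite mulrA.
Qed.

Lemma ipBl f g p : sL2 f -> sL2 g -> sL2 p ->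
  ip (fun t => f t - g t) p = ip f p - ip g p.
Proof.
move=> sf sg sp; rewrite -mulN1r -ipZl// -ipDl//; last exact: sL2Z.
by apply: eq_mean => t _; rewrite mulN1r.
Qed.

Lemma ipBr f g p : sL2 f -> sL2 g -> sL2 p ->
  ip p (fun t => f t - g t) = ip p f - ip p g.
Proof.
move=> sf sg sp; rewrite ipC ?ipBl//; last exact: sL2B.
by rewrite rmorphB /= -!ipC.
Qed.

Lemma ip_suml (I : Type) (s : seq I) (F : I -> R -> R[i]) g :
  (forall i, sL2 (F i)) -> sL2 g ->
  ip (fun t => \sum_(i <- s) F i t) g = \sum_(i <- s) ip (F i) g.
Proof.
move=> sF sg; rewrite /ip -mean_sum; last by move=> i; exact: ip_cint.
by apply: eq_mean => t _; rewrite mulr_suml.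
Qed.

Lemma nrm2E f : (nrm2 f)%:C = ip f f.
Proof.
apply: complex_eq; rewrite ?Re_mean ?Im_mean /=.
  by congr rmean; apply/funext => t; rewrite mulJ_normsq.
rewrite -[LHS](rmean_cst 0); congr rmean; apply/funext => t.
by rewrite mulJ_normsq.
Qed.

Lemma nrm2_ge0 f : 0 <= nrm2 f.
Proof. by apply: rmean_ge0 => t _. Qed.

Lemma nrm2_eq0 f : sL2 f -> nrm2 f = 0 -> circle_ae (fun t => f t = 0).
Proof.
move=> [_ sf] n0; have := rmean_eq0 sf (fun t _ => normsq_ge0 (f t)) n0.
by apply: filterS => t /normsq_eq0.
Qed.

Lemma nrm2_ae0 f : circle_ae (fun t => f t = 0) -> nrm2 f = 0.
Proof.
move=> f0; rewrite -[RHS](@rmean_cst R); apply: rmean_ae.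
by apply: filterS f0 => t ->; rewrite /normsq /= expr0n /= addr0.
Qed.

Lemma coefE f k : coef f k = ip f (ek k).
Proof. by apply: eq_mean => t _; rewrite ekN. Qed.

Lemma coef_ek j k : coef (ek j) k = (j == k)%:R.
Proof.
rewrite /coef (_ : (fun t => _) = ek (j - k)); first by rewrite mean_ek subr_eq0.
by apply/funext => t; rewrite ekD.
Qed.

Lemma coef_ae f g k : circle_ae (fun t => f t = g t) -> coef f k = coef g k.
Proof. by move=> fg; apply: mean_ae; apply: filterS fg => t ->. Qed.

Lemma coefD f g k : sL2 f -> sL2 g -> coef (fun t => f t + g t) k = coef f k + coef g k.
Proof. by move=> sf sg; rewrite !coefE ipDl//; exact: sL2_ek. Qed.

Lemma coefB f g k : sL2 f -> sL2 g -> coef (fun t => f t - g t) k = coef f k - coef g k.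
Proof. by move=> sf sg; rewrite !coefE ipBl//; exact: sL2_ek. Qed.

Lemma coefZ c f k : sL2 f -> coef (fun t => c * f t) k = c * coef f k.
Proof. by move=> sf; rewrite !coefE ipZl//; exact: sL2_ek. Qed.

Lemma coef_sum (I : Type) (s : seq I) (F : I -> R -> R[i]) k :
  (forall i, sL2 (F i)) ->
  coef (fun t => \sum_(i <- s) F i t) k = \sum_(i <- s) coef (F i) k.
Proof.
move=> sF; rewrite coefE ip_suml//; last exact: sL2_ek.
by apply: eq_bigr => i _; rewrite coefE.
Qed.

Lemma coefJ f k : sL2 f -> coef (fun t => (f t)^*)%R k = ((coef f (- k))^*)%R.
Proof.
move=> sf; rewrite /coef -meanJ.
  by apply: eq_mean => t _; rewrite rmorphM /= -ekN opprK.
by apply: sL2M => //; exact: sL2_ek.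
Qed.

Lemma coef_shift f j k : coef (fun t => f t * ek j t) k = coef f (k - j).
Proof. by apply: eq_mean => t _; rewrite -mulrA -ekD opprB addrC. Qed.

Lemma coef_cst c k : coef (fun=> c) k = c * (k == 0)%:R.
Proof.
rewrite (_ : (fun=> c) = fun t => c * ek 0 t); last first.
  by apply/funext => t; rewrite ek0 mulr1.
by rewrite coefZ ?coef_ek 1?eq_sym//; exact: sL2_ek.
Qed.

Lemma coef_inj f g : sL2 f -> sL2 g -> (forall k, coef f k = coef g k) ->
  circle_ae (fun t => f t = g t).
Proof.
move=> sf sg fg; have : circle_ae (fun t => f t - g t = 0).
  apply: null_coefs_ae0; split; first by apply: sL2_cint; exact: sL2B.
  move=> k; have := fg (- k); move/eqP; rewrite -subr_eq0 -coefB// => /eqP <-.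
  by apply: eq_mean => t _; rewrite opprK.
by apply: filterS => t /eqP; rewrite subr_eq0 => /eqP.
Qed.

Definition tp (c : nat -> R[i]) m n t : R[i] := \sum_(m <= k < n) c k * ek k t.

Lemma sL2_tp c m n : sL2 (tp c m n).
Proof. by apply: sL2_sum => k; apply: sL2Z; exact: sL2_ek. Qed.

Lemma coef_tp c m n k :
  coef (tp c m n) k = \sum_(m <= j < n) c j * (Posz j == k)%:R.
Proof.
rewrite coef_sum; last by move=> j; apply: sL2Z; exact: sL2_ek.
by apply: eq_bigr => j _; rewrite coefZ ?coef_ek//; exact: sL2_ek.
Qed.

Lemma coef_tp_nat c m n (k : nat) : coef (tp c m n) k = if (m <= k < n)%N then c k else 0.
Proof.
rewrite coef_tp; case: ifPn => kmn.
  rewrite (bigD1_seq k) ?mem_index_iota ?iota_uniq //= eqxx mulr1 big1 ?addr0//.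
  by move=> j; rewrite eqz_nat => /negbTE ->; rewrite mulr0.
rewrite big_seq big1 // => j; rewrite mem_index_iota eqz_nat.
by case: eqP => [->|_]; rewrite ?mulr0 // (negbTE kmn).
Qed.

Lemma coef_tp_lt0 c m n (k : int) : k < 0 -> coef (tp c m n) k = 0.
Proof.
move=> k0; rewrite coef_tp big1 // => j _.
by case: eqP => [jk|_]; rewrite ?mulr0 //; move: k0; rewrite -jk.
Qed.

Lemma ip_tp c m n f : sL2 f -> ip f (tp c m n) = \sum_(m <= k < n) coef f k * ((c k)^*)%R.
Proof.
move=> sf; rewrite ipC; [|exact: sL2_tp|by []].
rewrite ip_suml//; last by move=> j; apply: sL2Z; exact: sL2_ek.
rewrite rmorph_sum; apply: eq_bigr => k _.
rewrite ipZl//; last exact: sL2_ek.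
by rewrite rmorphM mulrC /= -ipC ?coefE//; exact: sL2_ek.
Qed.

Lemma nrm2_tp c m n : nrm2 (tp c m n) = \sum_(m <= k < n) normsq (c k).
Proof.
apply: complexI; rewrite nrm2E ip_tp; last exact: sL2_tp.
rewrite rmorph_sum big_seq [RHS]big_seq; apply: eq_bigr => k.
by rewrite mem_index_iota coef_tp_nat => ->; rewrite mulJ_normsq.
Qed.

(** The squared distance from [g] to its partial sum is nonnegative. *)
Lemma bessel g n : sL2 g -> \sum_(0 <= k < n) normsq (coef g k) <= nrm2 g.
Proof.
move=> sg; set c := fun k : nat => coef g k.
have st := sL2_tp c 0 n.
have gt : ip g (tp c 0 n) = (nrm2 (tp c 0 n))%:C.
  by rewrite ip_tp// nrm2_tp rmorph_sum; apply: eq_bigr => k _; rewrite mulJ_normsq.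
have : nrm2 (fun t => g t - tp c 0 n t) = nrm2 g - nrm2 (tp c 0 n).
  apply: complexI; rewrite nrm2E rmorphB /= ipBl//; last exact: sL2B.
  rewrite !ipBr// -!nrm2E [ip (tp c 0 n) g]ipC// gt.
  by apply: complex_eq; rewrite !ReImE /=; lra.
by have := nrm2_ge0 (fun t => g t - tp c 0 n t); rewrite nrm2_tp /c => /[swap] ->; rewrite subr_ge0.
Qed.

End Orthonormality.

Section RieszProjection.
Context {R : realType}.
Implicit Types (f g p : R -> R[i]) (h : R -> R).
Notation mu := (@lebesgue_measure R).
Notation mean := (@circle_mean R).

Lemma small_tail (a : nat -> R) (B e : R) : (forall k, 0 <= a k) ->
  (forall n, \sum_(0 <= k < n) a k <= B) -> 0 < e ->
  exists N, forall n, \sum_(N <= k < n) a k <= e.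
Proof.
move=> a0 aB e0; pose A := range (fun n => \sum_(0 <= k < n) a k).
have hs : has_sup A.
  by split; [exists (\sum_(0 <= k < 0) a k), 0%N|exists B => _ [n _ <-]].
have [_ [N _ <-] ltN] := sup_adherent e0 hs; exists N => n.
have [nN|Nn] := leqP n N; first by rewrite big_geq // ltW.
have : \sum_(0 <= k < n) a k <= sup A by apply: ub_le_sup; [exact: hs.2|exists n].
rewrite (big_cat_nat (n := N)) //=; last exact: ltnW.
by move: ltN; lra.
Qed.

(** The rate [4 ^- j] makes the consecutive differences of a series that
    converges in square mean summable in mean, since their means are then at
    most [2 ^- j]. *)
Lemma fast_subsequence (a : nat -> R) (B : R) : (forall k, 0 <= a k) ->
  (forall n, \sum_(0 <= k < n) a k <= B) ->
  exists N : nat -> nat, [/\ {homo N : i j / (i <= j)%N}, forall j, (j <= N j)%N &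
    forall j n, \sum_(N j <= k < n) a k <= 4 ^- j].
Proof.
move=> a0 aB.
have /choice[M tailM] : forall j : nat, exists N, forall n, \sum_(N <= k < n) a k <= 4 ^- j.
  by move=> j; apply: small_tail a0 aB _; rewrite invr_gt0 exprn_gt0.
pose N j := (\sum_(0 <= i < j.+1) (M i).+1)%N.
have NS j : N j.+1 = (N j + (M j.+1).+1)%N by rewrite /N big_nat_recr.
have homoN : {homo N : i j / (i <= j)%N}.
  by apply: homo_leq => //; [exact: leq_trans|move=> i; rewrite NS leq_addr].
exists N; split => // [j|j n].
  elim: j => // j IHj; rewrite NS.
  by apply: (leq_ltn_trans IHj); rewrite -addSnnS leq_addr.
have MN : (M j <= N j)%N.
  by case: j => [|j]; [rewrite /N big_nat1|rewrite NS -addSnnS leq_addl].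
have [nN|Nn] := leqP n (N j); first by rewrite big_geq // invr_ge0 exprn_ge0.
apply: le_trans (tailM j n); rewrite [leRHS](big_cat_nat (n := N j)) //=; last exact: ltnW.
by rewrite lerDr sumr_ge0.
Qed.

(** The Cauchy-Schwarz inequality against the constant 1, through the inequality
    [2 |h| <= q h ^ 2 + 1 / q] with [q = 2 ^ j]. *)
Lemma rmean_abs_le (h : R -> R) (j : nat) : rint (fun t => h t ^+ 2) ->
  measurable_fun angles h -> rmean (fun t => h t ^+ 2) <= 4 ^- j ->
  rint h /\ rmean (fun t => `|h t|) <= 2 ^- j.
Proof.
move=> ih mh le4; pose q : R := 2 ^+ j.
have q0 : 0 < q by rewrite exprn_gt0.
have bnd t : `|h t| <= q / 2 * h t ^+ 2 + (q^-1) / 2.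
  have := sqr_ge0 (q * `|h t| - 1); rewrite sqrrB exprMn real_normK ?num_real // expr1n mulr1.
  move=> H; rewrite -(ler_pM2l q0).
  by rewrite mulrDr [q * (q^-1 / 2)]mulrA mulfV ?gt_eqF// mul1r; move: H; rewrite mulr2n; nra.
have ik : rint (fun t => q / 2 * h t ^+ 2 + q^-1 / 2).
  by apply: rintD; [exact: rintZ|exact: rint_cst].
have ih' : rint h by apply: rint_dom ik _.
split => //; apply: (le_trans (le_rmean (integrable_norm ih') ik (fun t _ => bnd t))).
rewrite rmeanD; [|exact: rintZ|exact: rint_cst].
rewrite rmeanZ // rmean_cst.
rewrite -/q -[leRHS]/(q^-1).
have e4 : 4 ^- j = q^-1 * q^-1 :> R.
  by rewrite -invfM /q -exprMn -natrM.
rewrite e4 in le4.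
have : q * rmean (fun t => h t ^+ 2) <= q^-1.
  by apply: (le_trans (ler_wpM2l (ltW q0) le4)); rewrite mulrA mulfV ?gt_eqF// mul1r.
by move=> ?; lra.
Qed.

(** Partial sums of the nonnegative half of the Fourier series of [g] converge
    in square mean, along a subsequence fast enough to converge almost
    everywhere. *)
Lemma riesz_fischer g : sL2 g -> exists gp (N : nat -> nat),
  [/\ sL2 gp, forall j, (j <= N j)%N &
    forall j, nrm2 (fun t => gp t - tp (fun k : nat => coef g k) 0 (N j) t) <= 4 ^- j].
Proof.
move=> sg; set c := fun k : nat => coef g k.
have [N [homoN leN tailN]] := fast_subsequence (fun k => normsq_ge0 (c k))
  (fun n => bessel n sg).
pose v j := tp c 0 (N j).
have vB i j t : (i <= j)%N -> v j t - v i t = tp c (N i) (N j) t.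
  move=> ij; rewrite /v /tp [X in X - _](big_cat_nat (n := N i)) //= ?homoN//.
  by rewrite addrAC subrr add0r.
have sv j : sL2 (v j) by exact: sL2_tp.
have vB_le i j : (i <= j)%N -> nrm2 (fun t => v j t - v i t) <= 4 ^- i.
  by move=> ij; rewrite (funext (fun t => vB i j t ij)) nrm2_tp.
have conv (proj : R[i] -> R) :
    (forall x y, proj (x + y) = proj x + proj y) ->
    (forall x y, proj (x - y) = proj x - proj y) ->
    (forall x, proj x ^+ 2 <= normsq x) ->
    (forall f, cmeas f -> measurable_fun angles (fun t => proj (f t))) ->
    exists2 l : R -> R, measurable_fun angles l &
      circle_ae (fun t => proj (v n t) @[n --> \oo] --> l t).
  move=> pD pB ple pm; apply: ae_cvg_measurable.
    by move=> n; apply: pm; have [] := sv n.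
  pose w n t := proj (v n.+1 t - v n t).
  have sw n : sL2 (fun t => v n.+1 t - v n t) by exact: sL2B.
  have H n : rint (w n) /\ rmean (fun t => `|w n t|) <= 2 ^- n.
    have mw : measurable_fun angles (w n) by apply: pm; have [] := sw n.
    have i2 : rint (fun t => w n t ^+ 2).
      apply: (rint_dom _ (sw n).2); first exact: measurable_funX.
      by move=> t _; rewrite ger0_norm ?sqr_ge0 // ple.
    apply: rmean_abs_le => //; apply: le_trans (vB_le n n.+1 (leqnSn n)).
    by apply: le_rmean => // [|t _]; [exact: (sw n).2|exact: ple].
  have := ae_cvg_series (fun n => (H n).1) (fun n => (H n).2).
  apply: filterS => t [l wl]; exists (l + proj (v 0%N t)).
  have -> : (fun n => proj (v n t)) = fun n => \sum_(0 <= k < n) w k t + proj (v 0%N t).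
    apply/funext => n; elim: n => [|n IHn]; first by rewrite big_nil add0r.
    by rewrite big_nat_recr //= addrAC -IHn /w pB addrC subrK.
  by apply: cvgD; [exact: wl|exact: cvg_cst].
have [lr mlr cr] := conv _ ReD (fun x y => etrans (ReD _ _) (congr1 _ (ReN y)))
  Re_normsq (fun f mf => mf.1).
have [li mli ci] := conv _ ImD (fun x y => etrans (ImD _ _) (congr1 _ (ImN y)))
  Im_normsq (fun f mf => mf.2).
pose gp t := lr t +i* li t.
have mgp : cmeas gp by split.
have fat j : rint (fun t => normsq (gp t - v j t)) /\ nrm2 (fun t => gp t - v j t) <= 4 ^- j.
  apply: (@rmean_fatou _ (fun n t => normsq (v (n + j)%N t - v j t))) => //.
  - by move=> n; apply: (sL2B (sv _) (sv _)).2.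
  - by move=> n; apply: vB_le; rewrite leq_addl.
  - apply: cmeas_normsq; apply: cmeasD => //.
    by apply: (sL2N (sv j)).1.
  - apply: filterS2 cr ci => t cr ci; rewrite /normsq !ReImE /=.
    have sh (u : nat -> R) (l : R) : u n @[n --> \oo] --> l -> u (n + j)%N @[n --> \oo] --> l.
      by move=> ul; rewrite cvg_shiftn.
    have r2 : Re (v (n + j)%N t) - Re (v j t) @[n --> \oo] --> lr t - Re (v j t).
      by apply: cvgB; [exact: (sh (fun n => Re (v n t)))|exact: cvg_cst].
    have i2 : Im (v (n + j)%N t) - Im (v j t) @[n --> \oo] --> li t - Im (v j t).
      by apply: cvgB; [exact: (sh (fun n => Im (v n t)))|exact: cvg_cst].
    under eq_fun do rewrite !ReImE.
    by apply: cvgD; [exact: (cvgM r2 r2)|exact: (cvgM i2 i2)].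
exists gp, N; split => //; last by move=> j; have [] := fat j.
have s0 : sL2 (fun t => gp t - v 0%N t).
  split; last by have [] := fat 0%N.
  by apply: cmeasD => //; apply: (sL2N (sv _)).1.
have := sL2D s0 (sv 0%N); rewrite (_ : (fun t => _) = gp) //.
by apply/funext => t; rewrite subrK.
Qed.

End RieszProjection.

Section ScalarHardy.
Context {R : realType}.
Implicit Types (f g p a b u : R -> R[i]) (h : R -> R).
Notation mean := (@circle_mean R).

(** The Cauchy-Schwarz inequality again, through [|x y| <= q x ^ 2 + y ^ 2 / q] with
    [q = 2 ^ j]: integrating against a fixed [b] is continuous in square
    mean. *)
Lemma mean_small u b (j : nat) : sL2 u -> sL2 b -> nrm2 u <= 4 ^- j ->
  `|Re (mean (fun t => u t * b t))| <= 2 ^- j * (1 + nrm2 b) /\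
  `|Im (mean (fun t => u t * b t))| <= 2 ^- j * (1 + nrm2 b).
Proof.
move=> su sb le4; have [ir ii] := sL2M su sb.
pose q : R := 2 ^+ j; have q0 : 0 < q by rewrite exprn_gt0.
have qV : q * q^-1 = 1 by rewrite mulfV ?gt_eqF.
have qV0 : 0 < q^-1 by rewrite invr_gt0.
have e4 : 4 ^- j = q^-1 * q^-1 :> R by rewrite -invfM /q -exprMn -natrM.
have b2 (x y : R) : `|x * y| <= q * x ^+ 2 + q^-1 * y ^+ 2.
  have h1 : 0 <= q^-1 * (q * x - y) ^+ 2 by rewrite mulr_ge0 ?sqr_ge0 ?ltW.
  have h2 : 0 <= q^-1 * (q * x + y) ^+ 2 by rewrite mulr_ge0 ?sqr_ge0 ?ltW.
  have e1 : q^-1 * (q * x - y) ^+ 2 = q * x ^+ 2 - 2 * (x * y) + q^-1 * y ^+ 2.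
    by field; rewrite gt_eqF.
  have e2 : q^-1 * (q * x + y) ^+ 2 = q * x ^+ 2 + 2 * (x * y) + q^-1 * y ^+ 2.
    by field; rewrite gt_eqF.
  rewrite e1 in h1; rewrite e2 in h2.
  have h3 : 0 <= q * x ^+ 2 by rewrite mulr_ge0 ?sqr_ge0 ?ltW.
  have h4 : 0 <= q^-1 * y ^+ 2 by rewrite mulr_ge0 ?sqr_ge0 ?ltW.
  by rewrite ler_norml; apply/andP; split; lra.
pose K t := q * normsq (u t) + q^-1 * normsq (b t).
have iK : rint K by apply: rintD; apply: rintZ; [exact: su.2|exact: sb.2].
have KE : rmean K = q * nrm2 u + q^-1 * nrm2 b.
  rewrite rmeanD; [|by apply: rintZ; exact: su.2|by apply: rintZ; exact: sb.2].
  by rewrite !rmeanZ//; [exact: sb.2|exact: su.2].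
have Kle : rmean K <= q^-1 * (1 + nrm2 b).
  rewrite KE mulrDr mulr1 lerD2r; apply: (le_trans (ler_wpM2l (ltW q0) le4)).
  by rewrite e4 mulrA qV mul1r.
have fin h : rint h -> (forall t, `|h t| <= K t) -> `|rmean h| <= q^-1 * (1 + nrm2 b).
  move=> ih hK; apply: le_trans Kle; rewrite ler_norml; apply/andP; split.
    rewrite -rmeanN //; apply: le_rmean => //; first exact: rintN.
    by move=> t _; have := hK t; rewrite ler_norml => /andP[].
  by apply: le_rmean => // t _; have := hK t; rewrite ler_norml => /andP[].
rewrite Re_mean Im_mean; split; apply: fin => // t; rewrite ReImE /K /normsq.
  apply: (le_trans (ler_normB _ _)).
  by have := b2 (Re (u t)) (Re (b t)); have := b2 (Im (u t)) (Im (b t)); lra.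
apply: (le_trans (ler_normD _ _)).
by have := b2 (Re (u t)) (Im (b t)); have := b2 (Im (u t)) (Re (b t)); lra.
Qed.

Lemma le_pow2_eq0 (x C : R) (J : nat) :
  (forall j, (J <= j)%N -> `|x| <= 2 ^- j * C) -> x = 0.
Proof.
move=> xC; apply/eqP; rewrite -normr_eq0; apply/eqP.
have lim0 : (fun=> `|x|) @ \oo --> (0 : R).
  apply: (@squeeze_cvgr _ _ _ _ (fun=> 0) (fun j : nat => 2 ^- j * C)).
  - by exists J => // j Jj; rewrite /= normr_ge0 xC.
  - exact: cvg_cst.
  - rewrite -[X in _ --> X](mul0r C); apply: cvgMl.
    under eq_fun do rewrite -exprVn.
    by apply: cvg_expr; rewrite ger0_norm ?invr_ge0 // invf_lt1 // ltr1n.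
by apply: (cvg_unique _ _ lim0); [exact: Rhausdorff|exact: cvg_cst].
Qed.

(** Identifies Fourier coefficients through approximations in square mean: the
    means of the products tend to zero by [mean_small]. *)
Lemma mean_lim0 (u : nat -> R -> R[i]) b (z : R[i]) (J : nat) :
  (forall j, sL2 (u j)) -> sL2 b -> (forall j, nrm2 (u j) <= 4 ^- j) ->
  (forall j, (J <= j)%N -> mean (fun t => u j t * b t) = z) -> z = 0.
Proof.
move=> su sb nu uz.
by apply: complex_eq; apply: (@le_pow2_eq0 _ (1 + nrm2 b) J) => j Jj;
  have [] := mean_small (su j) sb (nu j); rewrite uz.
Qed.

Lemma riesz_proj g : sL2 g -> exists2 gp, sL2 gp &
  forall k : int, coef gp k = if 0 <= k then coef g k else 0.
Proof.
move=> sg; have [gp [N [sgp leN nN]]] := riesz_fischer sg.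
exists gp => // k; apply/eqP; rewrite -subr_eq0; apply/eqP.
set c := fun k : nat => coef g k in nN.
apply: (@mean_lim0 (fun j t => gp t - tp c 0 (N j) t) (ek (- k)) _ (absz k).+1) => //.
- by move=> j; apply: sL2B => //; exact: sL2_tp.
- exact: sL2_ek.
move=> j kj; rewrite -/(coef (fun t => gp t - tp c 0 (N j) t) k) coefB//; last exact: sL2_tp.
congr (_ - _); case: ifPn => [|]; last by rewrite -ltNge; exact: coef_tp_lt0.
case: k kj => // k kj _; rewrite coef_tp_nat.
by rewrite (leq_trans kj (leN j)).
Qed.

(** True term by term for the partial sums of [a], which converge to [a] in
    square mean; [coef_inj] identifies their limit with [a]. *)
Lemma mean_hardy0 a b : sL2 a -> sL2 b -> (forall k : int, k < 0 -> coef a k = 0) ->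
  (forall k : int, k <= 0 -> coef b k = 0) -> mean (fun t => a t * b t) = 0.
Proof.
move=> sa sb a0 b0; have [gp [N [sgp leN nN]]] := riesz_fischer sa.
set c := fun k : nat => coef a k in nN.
have agp : circle_ae (fun t => a t = gp t).
  apply: coef_inj => // k; apply/esym/eqP; rewrite -subr_eq0; apply/eqP.
  apply: (@mean_lim0 (fun j t => gp t - tp c 0 (N j) t) (ek (- k)) _ (absz k).+1) => //.
  - by move=> j; apply: sL2B => //; exact: sL2_tp.
  - exact: sL2_ek.
  move=> j kj; rewrite -/(coef (fun t => gp t - tp c 0 (N j) t) k) coefB//; last exact: sL2_tp.
  congr (_ - _); case: (ltP k 0) => k0; first by rewrite coef_tp_lt0 // a0.
  by case: k kj k0 => // k kj _; rewrite coef_tp_nat (leq_trans kj (leN j)).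
rewrite (@mean_ae _ _ (fun t => gp t * b t)); last by apply: filterS agp => t ->.
apply: (@mean_lim0 (fun j t => gp t - tp c 0 (N j) t) b _ 0) => //.
  by move=> j; apply: sL2B => //; exact: sL2_tp.
move=> j _; transitivity (mean (fun t => gp t * b t - tp c 0 (N j) t * b t)).
  by apply: eq_mean => t _; rewrite mulrBl.
have stp := sL2_tp c 0 (N j).
rewrite meanB; [|exact: sL2M..].
rewrite (_ : mean (fun t => tp c 0 (N j) t * b t) = 0) ?subr0 //.
transitivity (\sum_(0 <= k < N j) c k * coef b (- Posz k)).
  rewrite /tp; under eq_fun do rewrite mulr_suml.
  rewrite mean_sum; last first.
    by move=> k; apply: sL2M => //; apply: sL2Z; exact: sL2_ek.
  apply: eq_bigr => k _; rewrite /coef opprK -meanZ.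
    by apply: eq_mean => t _; rewrite -mulrA [ek _ _ * _]mulrC.
  by apply: sL2M => //; exact: sL2_ek.
by rewrite big1 // => k _; rewrite b0 ?mulr0 // oppr_le0.
Qed.

(** Shifting both spectra turns the coefficient into a mean to which
    [mean_hardy0] applies. The product is only integrable, so its Fourier
    series could not be multiplied out directly. *)
Lemma coef_mul_ge a b (m n : int) : sL2 a -> sL2 b ->
  (forall k : int, k < m -> coef a k = 0) -> (forall k : int, k < n -> coef b k = 0) ->
  forall k : int, k < m + n -> coef (fun t => a t * b t) k = 0.
Proof.
move=> sa sb a0 b0 k kmn.
have sh f j : sL2 f -> sL2 (fun t => f t * ek j t).
  move=> sf; rewrite (_ : (fun t => _) = fun t => ek j t * f t); last first.
    by apply/funext => t; rewrite mulrC.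
  apply: (@sL2M_bdd _ _ _ 1) => //; first exact: cmeas_ek.
  by apply: nearW => t _; rewrite normsq_ek.
rewrite -[RHS](@mean_hardy0 (fun t => a t * ek (- m) t) (fun t => b t * ek (m - k) t)).
- by apply: eq_mean => t _; rewrite mulrACA -ekD addrA addNr sub0r.
- exact: sh.
- exact: sh.
- by move=> j j0; rewrite coef_shift a0 // opprK -ltrBrDr subrr.
- move=> j j0; rewrite coef_shift b0 // opprB.
  by move: j0 kmn; lia.
Qed.

End ScalarHardy.

(** * Matrix valued functions and their spectra *)

Section MatrixFunctions.
Context {R : realType}.
Notation mu := (@lebesgue_measure R).
Notation mean := (@circle_mean R).

Lemma adjE m n (A : 'M[R[i]]_(m, n)) i j : (A^t*) i j = ((A j i)^*)%R.
Proof. by rewrite !mxE. Qed.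

Lemma adjM m n p (A : 'M[R[i]]_(m, n)) (B : 'M[R[i]]_(n, p)) :
  (A *m B)^t* = B^t* *m A^t*.
Proof. by rewrite trmx_mul; exact: map_mxM. Qed.

Lemma adjD m n (A B : 'M[R[i]]_(m, n)) : (A + B)^t* = A^t* + B^t*.
Proof. by apply/matrixP => i j; rewrite !mxE rmorphD. Qed.

Lemma adjN m n (A : 'M[R[i]]_(m, n)) : (- A)^t* = - A^t*.
Proof. by apply/matrixP => i j; rewrite !mxE rmorphN. Qed.

Lemma adjZ m n c (A : 'M[R[i]]_(m, n)) : (c *: A)^t* = (c^*)%R *: A^t*.
Proof. by apply/matrixP => i j; rewrite !mxE rmorphM. Qed.

Lemma hsdotE m n (A B : 'M[R[i]]_(m, n)) :
  hsdot A B = \sum_i \sum_j A i j * ((B i j)^*)%R.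
Proof.
by rewrite /hsdot /mxtrace; apply: eq_bigr => i _; rewrite mxE;
  apply: eq_bigr => j _; rewrite adjE.
Qed.

Lemma hsdot_self m n (A : 'M[R[i]]_(m, n)) :
  hsdot A A = (\sum_i \sum_j normsq (A i j))%:C.
Proof.
rewrite hsdotE rmorph_sum; apply: eq_bigr => i _; rewrite rmorph_sum.
by apply: eq_bigr => j _; rewrite mulJ_normsq.
Qed.

Lemma hsdot_mull m n p (T : 'M[R[i]]_(m, n)) (A : 'M[R[i]]_(n, p)) B :
  hsdot (T *m A) B = hsdot A (T^t* *m B).
Proof. by rewrite /hsdot adjM trmxCK [in RHS]mulmxA [RHS]mxtrace_mulC mulmxA. Qed.

Lemma hsnorm_ge0 m n (A : 'M[R[i]]_(m, n)) : 0 <= hsnorm A.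
Proof. exact: sqrtr_ge0. Qed.

Lemma hsnorm_sqr m n (A : 'M[R[i]]_(m, n)) :
  hsnorm A ^+ 2 = \sum_i \sum_j normsq (A i j).
Proof.
rewrite /hsnorm sqr_sqrtr hsdot_self //=.
by apply: sumr_ge0 => i _; apply: sumr_ge0.
Qed.

Lemma entry_hsnorm m n (A : 'M[R[i]]_(m, n)) i j : normsq (A i j) <= hsnorm A ^+ 2.
Proof.
rewrite hsnorm_sqr (bigD1 i) //= (bigD1 j) //= -addrA lerDl.
by rewrite addr_ge0 ?sumr_ge0 // => k _; rewrite sumr_ge0.
Qed.

Section Dims.
Context {m n : nat}.
Implicit Types f g : R -> 'M[R[i]]_(m, n).

Definition mmeas f := forall i j, cmeas (fun t => f t i j).
Definition mL2 f := forall i j, sL2 (fun t => f t i j).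

(** The spectrum, that is the set of indices of the nonzero Fourier coefficients,
    lies in [k, +oo). The Hardy space is the case [k = 0]. *)
Definition spec_ge (k : int) f := forall i j, sL2 (fun t => f t i j) /\
  forall l : int, l < k -> coef (fun t => f t i j) l = 0.

Lemma mL2_meas f : mL2 f -> mmeas f.
Proof. by move=> sf i j; have [] := sf i j. Qed.

Lemma rint_sum (I : Type) (s : seq I) (F : I -> R -> R) :
  (forall i, rint (F i)) -> rint (fun t => \sum_(i <- s) F i t).
Proof.
move=> iF; elim: s => [|i s IHs].
  by under eq_fun do rewrite big_nil; exact: rint_cst.
by under eq_fun do rewrite big_cons; exact: rintD.
Qed.

Lemma L2P f : L2 f <-> mL2 f.
Proof.
split=> [[mf If] i j|sf]; last first.
  split; first by move=> i j; have [[]] := sf i j.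
  have : rint (fun t => hsnorm (f t) ^+ 2).
    under eq_fun do rewrite hsnorm_sqr.
    by do 2!apply: rint_sum => ?; exact: (sf _ _).2.
  move=> /integrableP[_]; apply: le_lt_trans.
  rewrite le_eqVlt; apply/orP; left; apply/eqP; apply: eq_integral => t _.
  by rewrite /= ger0_norm // sqr_ge0.
have mij i' j' : cmeas (fun t => f t i' j') by have [] := mf i' j'.
have mn : measurable_fun angles (fun t => hsnorm (f t) ^+ 2).
  under eq_fun do rewrite hsnorm_sqr.
  by do 2!apply: measurable_sum => ?; exact: cmeas_normsq.
have iN : rint (fun t => hsnorm (f t) ^+ 2).
  apply/integrableP; split; first exact/measurable_EFinP.
  apply: le_lt_trans If; rewrite le_eqVlt; apply/orP; left; apply/eqP.
  by apply: eq_integral => t _; rewrite /= ger0_norm // sqr_ge0.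
split => //; apply: rint_dom iN _; first exact: cmeas_normsq.
by move=> t _; rewrite ger0_norm //; exact: entry_hsnorm.
Qed.

Lemma fourierE f k i j : fourier f k i j = coef (fun t => f t i j) k.
Proof.
rewrite mxE; apply: eq_mean => t _; congr (_ * _).
by rewrite /ek intrN mulNr.
Qed.

Lemma ge_L2 k f : spec_ge k f -> mL2 f.
Proof. by move=> gf i j; have [] := gf i j. Qed.

Lemma H2P f : H2 f <-> spec_ge 0 f.
Proof.
split=> [[/L2P sf f0] i j|gf]; first split => // l l0.
  by rewrite -fourierE f0 // mxE.
split; first by apply/L2P => i j; have [] := gf i j.
by move=> l l0; apply/matrixP => i j; rewrite fourierE mxE (gf i j).2.
Qed.

Lemma mmeasD f g : mmeas f -> mmeas g -> mmeas (fun t => f t + g t).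
Proof. by move=> mf mg i j; under eq_fun do rewrite mxE; exact: cmeasD. Qed.

Lemma mL2D f g : mL2 f -> mL2 g -> mL2 (fun t => f t + g t).
Proof. by move=> mf mg i j; under eq_fun do rewrite mxE; exact: sL2D. Qed.

Lemma mL2N f : mL2 f -> mL2 (fun t => - f t).
Proof. by move=> mf i j; under eq_fun do rewrite mxE; exact: sL2N. Qed.

Lemma mL2B f g : mL2 f -> mL2 g -> mL2 (fun t => f t - g t).
Proof. by move=> mf mg; apply: mL2D => //; exact: mL2N. Qed.

Lemma mL2_ae f g : mmeas g -> circle_ae (fun t => f t = g t) -> mL2 f -> mL2 g.
Proof.
move=> mg fg sf i j; apply: sL2_ae (sf i j) => //.
by apply: filterS fg => t ->.
Qed.

Lemma ge_ae k f g : mmeas g -> circle_ae (fun t => f t = g t) -> spec_ge k f -> spec_ge k g.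
Proof.
move=> mg fg gf i j; split; first exact: (mL2_ae mg fg (ge_L2 gf)).
move=> l lk; rewrite -((gf i j).2 l lk); apply: coef_ae.
by apply: filterS fg => t ->.
Qed.

Lemma ge_weak k l f : l <= k -> spec_ge k f -> spec_ge l f.
Proof.
move=> lk gf i j; have [sf f0] := gf i j; split => // p pl.
by rewrite f0 // (lt_le_trans pl).
Qed.

Lemma geD k f g : spec_ge k f -> spec_ge k g -> spec_ge k (fun t => f t + g t).
Proof.
move=> gf gg i j; have [sf f0] := gf i j; have [sg g0] := gg i j.
under eq_fun do rewrite mxE; split; first exact: sL2D.
by move=> l lk; rewrite coefD ?f0 ?g0 ?addr0.
Qed.

Lemma geN k f : spec_ge k f -> spec_ge k (fun t => - f t).
Proof.
move=> gf i j; have [sf f0] := gf i j; under eq_fun do rewrite mxE; split; first exact: sL2N.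
move=> l lk; have := coefZ (-1) l sf; rewrite f0 // mulr0 => <-.
by apply: eq_mean => t _; rewrite mulN1r.
Qed.

Lemma geB k f g : spec_ge k f -> spec_ge k g -> spec_ge k (fun t => f t - g t).
Proof. by move=> gf gg; apply: geD => //; exact: geN. Qed.

Lemma ge_shift k j f : spec_ge k f -> spec_ge (k + j) (fun t => ek j t *: f t).
Proof.
move=> gf a b; have [sf f0] := gf a b; under eq_fun do rewrite mxE.
split.
  apply: (@sL2M_bdd _ _ _ 1) => //; first exact: cmeas_ek.
  by apply: nearW => t _; rewrite normsq_ek.
move=> l lk; under eq_fun do rewrite mulrC.
by rewrite coef_shift f0 // ltrBlDr.
Qed.

Lemma ge_cst (A : 'M[R[i]]_(m, n)) : spec_ge 0 (fun=> A).
Proof.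
move=> i j; split; first exact: sL2_cst.
by move=> l l0; rewrite coef_cst lt_eqF // mulr0.
Qed.

Lemma L2dotE f g : mL2 f -> mL2 g ->
  L2dot f g = \sum_i \sum_j ip (fun t => f t i j) (fun t => g t i j).
Proof.
move=> sf sg; rewrite /L2dot (eq_mean (fun t _ => hsdotE (f t) (g t))).
rewrite mean_sum.
  by apply: eq_bigr => i _; rewrite mean_sum // => j; exact: ip_cint.
by move=> i; apply: cint_sum => j; exact: ip_cint.
Qed.

Lemma L2dot_cint f g : mL2 f -> mL2 g -> cint (fun t => hsdot (f t) (g t)).
Proof.
move=> sf sg; under eq_fun do rewrite hsdotE.
by apply: cint_sum => i; apply: cint_sum => j; exact: ip_cint.
Qed.

Lemma L2dot_ae f f' g g' : circle_ae (fun t => f t = f' t) ->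
  circle_ae (fun t => g t = g' t) -> L2dot f g = L2dot f' g'.
Proof. by move=> ff gg; apply: mean_ae; apply: filterS2 ff gg => t -> ->. Qed.

Lemma L2dotDl f g h : mL2 f -> mL2 g -> mL2 h ->
  L2dot (fun t => f t + g t) h = L2dot f h + L2dot g h.
Proof.
move=> sf sg sh; rewrite /L2dot -meanD; [|exact: L2dot_cint..].
by apply: eq_mean => t _; rewrite /hsdot mulmxDl mxtraceD.
Qed.

Lemma L2dotBl f g h : mL2 f -> mL2 g -> mL2 h ->
  L2dot (fun t => f t - g t) h = L2dot f h - L2dot g h.
Proof.
move=> sf sg sh; rewrite /L2dot -meanB; [|exact: L2dot_cint..].
by apply: eq_mean => t _; rewrite /hsdot mulmxBl raddfB.
Qed.

Lemma L2dotC f g : mL2 f -> mL2 g -> L2dot g f = ((L2dot f g)^*)%R.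
Proof.
move=> sf sg; rewrite !L2dotE// rmorph_sum; apply: eq_bigr => i _.
by rewrite rmorph_sum; apply: eq_bigr => j _; exact: ipC.
Qed.

Lemma L2dot_self f : mL2 f ->
  L2dot f f = (\sum_i \sum_j nrm2 (fun t => f t i j))%:C.
Proof.
move=> sf; rewrite L2dotE// rmorph_sum; apply: eq_bigr => i _.
by rewrite rmorph_sum; apply: eq_bigr => j _; rewrite -nrm2E.
Qed.

Lemma circle_ae_mx f g :
  (forall i j, circle_ae (fun t => f t i j = g t i j)) -> circle_ae (fun t => f t = g t).
Proof.
move=> fg; have : circle_ae (fun t => forall k : 'I_m * 'I_n, f t k.1 k.2 = g t k.1 k.2).
  apply: (@filter_forall R ('I_m * 'I_n)%type (fun k t => f t k.1 k.2 = g t k.1 k.2)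
    (@circle_ae R)) => -[i j]; exact: fg.
by apply: filterS => t H; apply/matrixP => i j; exact: (H (i, j)).
Qed.

Lemma L2dot_eq0 f : mL2 f -> L2dot f f = 0 -> circle_ae (fun t => f t = 0).
Proof.
move=> sf; rewrite L2dot_self// => -[] /eqP.
rewrite psumr_eq0; last by move=> i _; apply: sumr_ge0 => j _; exact: nrm2_ge0.
move=> /allP/= H; apply: circle_ae_mx => i j; under eq_fun do rewrite mxE.
apply: nrm2_eq0 => //; apply/eqP.
have := H i (mem_index_enum i); rewrite psumr_eq0; last by move=> k _; exact: nrm2_ge0.
by move=> /allP/= /(_ j (mem_index_enum j)).
Qed.

End Dims.

(** The spectrum lies in (-oo, k] (see [spec_leP]); taking adjoints reflects the
    spectrum, so that every fact about [spec_ge] has a mirror image. *)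
Definition spec_le m n (k : int) (f : R -> 'M[R[i]]_(m, n)) := spec_ge (- k) (fun t => (f t)^t*).

Section Dims2.
Context {m n : nat}.
Implicit Types f g : R -> 'M[R[i]]_(m, n).

Lemma mL2_adj f : mL2 f -> mL2 (fun t => (f t)^t*).
Proof. by move=> sf i j; under eq_fun do rewrite adjE; exact: sL2J. Qed.

Lemma mmeas_adj f : mmeas f -> mmeas (fun t => (f t)^t*).
Proof. by move=> sf i j; under eq_fun do rewrite adjE; exact: cmeasJ. Qed.

Lemma spec_leP k f : spec_le k f <-> forall i j, sL2 (fun t => f t i j) /\
  forall l : int, k < l -> coef (fun t => f t i j) l = 0.
Proof.
split=> lf i j.
  have [] := lf j i; under eq_fun do rewrite adjE; move=> sf f0.
  have e : (fun t => f t i j) = (fun t => (((f t i j)^*)^*)%R).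
    by apply/funext => t; rewrite conjCK.
  split; first by rewrite e; exact: sL2J.
  by move=> l kl; rewrite e coefJ// f0 ?conjC0 // ltrN2.
have [sf f0] := lf j i; under eq_fun do rewrite adjE; split; first exact: sL2J.
by move=> l kl; rewrite coefJ// f0 ?conjC0 // ltrNr.
Qed.

Lemma le_L2 k f : spec_le k f -> mL2 f.
Proof. by move=> /spec_leP lf i j; have [] := lf i j. Qed.

Lemma le_ae k f g : mmeas g -> circle_ae (fun t => f t = g t) -> spec_le k f -> spec_le k g.
Proof.
move=> mg fg; apply: ge_ae; first exact: mmeas_adj.
by apply: filterS fg => t ->.
Qed.

Lemma le_weak k l f : k <= l -> spec_le k f -> spec_le l f.
Proof. by move=> kl; apply: ge_weak; rewrite lerN2. Qed.

Lemma leD k f g : spec_le k f -> spec_le k g -> spec_le k (fun t => f t + g t).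
Proof. by move=> lf lg; rewrite /spec_le; under eq_fun do rewrite adjD; exact: geD. Qed.

Lemma leN k f : spec_le k f -> spec_le k (fun t => - f t).
Proof. by move=> lf; rewrite /spec_le; under eq_fun do rewrite adjN; exact: geN. Qed.

Lemma leB k f g : spec_le k f -> spec_le k g -> spec_le k (fun t => f t - g t).
Proof. by move=> gf gg; apply: leD => //; exact: leN. Qed.

Lemma le_shift k j f : spec_le k f -> spec_le (k + j) (fun t => ek j t *: f t).
Proof.
move=> lf; rewrite /spec_le opprD; under eq_fun do rewrite adjZ -ekN.
exact: ge_shift.
Qed.

Lemma le_cst (A : 'M[R[i]]_(m, n)) : spec_le 0 (fun=> A).
Proof. by rewrite /spec_le oppr0; exact: ge_cst. Qed.

Lemma ge_adj k f : spec_ge k f -> spec_le (- k) (fun t => (f t)^t*).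
Proof. by move=> gf; rewrite /spec_le opprK; under eq_fun do rewrite trmxCK. Qed.

Lemma ge_le_eq0 k l f : l < k -> spec_ge k f -> spec_le l f -> circle_ae (fun t => f t = 0).
Proof.
move=> lk gf /spec_leP lf; apply: circle_ae_mx => i j; under eq_fun do rewrite mxE.
have [sf f1] := gf i j; have [_ f2] := lf i j.
apply: coef_inj => //; first exact: sL2_cst.
move=> p; rewrite coef_cst mul0r; have [pk|kp] := ltP p k; first exact: f1.
by apply: f2; exact: lt_le_trans kp.
Qed.

(** The splitting of [L^2] into the Hardy space and its complement. *)
Lemma riesz_proj_mx f : mL2 f ->
  exists2 g, spec_ge 0 g & spec_le (-1) (fun t => f t - g t).
Proof.
move=> sf.
have /choice[P HP] : forall ij : 'I_m * 'I_n, exists g : R -> R[i], sL2 g /\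
    forall k : int, coef g k = if 0 <= k then coef (fun t => f t ij.1 ij.2) k else 0.
  by move=> [i j]; have [g sg Hg] := riesz_proj (sf i j); exists g.
exists (fun t => \matrix_(i, j) P (i, j) t).
  move=> i j; under eq_fun do rewrite mxE; have [sg Hg] := HP (i, j); split => // l l0.
  by rewrite Hg leNgt l0.
apply/spec_leP => i j; have [sg Hg] := HP (i, j).
under eq_fun do rewrite !mxE; split; first exact: sL2B.
move=> l l1; rewrite coefB// Hg; case: ifPn => [_|]; first by rewrite subrr.
by rewrite -ltNge => l0; exfalso; move: l0 l1; lia.
Qed.

(** [mean_hardy0] applied to the conjugate of [f] and to [g], entry by entry. *)
Lemma L2dot_orth f g : spec_le (-1) f -> spec_ge 0 g -> L2dot f g = 0.
Proof.
move=> lf gg; have /spec_leP lf' := lf.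
rewrite L2dotE; [|exact: le_L2 lf|exact: ge_L2 gg].
rewrite big1 // => i _; rewrite big1 // => j _.
have [sf f0] := lf' i j; have [sg g0] := gg i j.
rewrite ipC// -[RHS]conjC0; congr ((_^*)%R).
apply: mean_hardy0 => //; first exact: sL2J.
by move=> k k0; rewrite coefJ// f0 ?conjC0//; move: k0; lia.
Qed.

End Dims2.
End MatrixFunctions.

Section Products.
Context {R : realType}.
Notation mean := (@circle_mean R).

(** Essential boundedness of the entries: multipliers of the square integrable
    functions. *)
Definition mbdd m n (b : R -> 'M[R[i]]_(m, n)) := mmeas b /\
  exists c : R, circle_ae (fun t => forall i j, normsq (b t i j) <= c).

Lemma mL2_mull m n p (b : R -> 'M[R[i]]_(m, n)) (f : R -> 'M[R[i]]_(n, p)) :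
  mbdd b -> mL2 f -> mL2 (fun t => b t *m f t).
Proof.
move=> [mb [c bc]] sf i j; under eq_fun do rewrite mxE.
apply: sL2_sum => k; apply: (@sL2M_bdd _ _ _ c) => //.
by apply: filterS bc.
Qed.

Lemma mL2_mulr m n p (f : R -> 'M[R[i]]_(m, n)) (b : R -> 'M[R[i]]_(n, p)) :
  mbdd b -> mL2 f -> mL2 (fun t => f t *m b t).
Proof.
move=> [mb [c bc]] sf i j; under eq_fun do rewrite mxE.
apply: sL2_sum => k; under eq_fun do rewrite mulrC.
apply: (@sL2M_bdd _ _ _ c) => //.
by apply: filterS bc.
Qed.

Lemma mbdd_cst m n (A : 'M[R[i]]_(m, n)) : mbdd (fun=> A).
Proof.
split; first by move=> i j; exact: cmeas_cst.
exists (\sum_i \sum_j normsq (A i j)); apply: nearW => t _ i j.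
by rewrite -hsnorm_sqr entry_hsnorm.
Qed.

Lemma mbdd_adj m n (b : R -> 'M[R[i]]_(m, n)) : mbdd b -> mbdd (fun t => (b t)^t*).
Proof.
move=> [mb [c bc]]; split; first exact: mmeas_adj.
by exists c; apply: filterS bc => t bc i j; rewrite adjE normsqJ.
Qed.

Lemma mbddD m n (b b' : R -> 'M[R[i]]_(m, n)) : mbdd b -> mbdd b' ->
  mbdd (fun t => b t + b' t).
Proof.
move=> [mb [c bc]] [mb' [c' bc']]; split; first exact: mmeasD.
exists (2 * c + 2 * c'); apply: filterS2 bc bc' => t bc bc' i j.
by rewrite mxE; apply: (le_trans (normsqD _ _)); rewrite lerD // ler_wpM2l.
Qed.

Lemma mbdd_shift m n k (b : R -> 'M[R[i]]_(m, n)) : mbdd b -> mbdd (fun t => ek k t *: b t).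
Proof.
move=> [mb [c bc]]; split.
  by move=> i j; under eq_fun do rewrite mxE; apply: cmeasM => //; exact: cmeas_ek.
by exists c; apply: filterS bc => t bc i j; rewrite mxE normsqM normsq_ek mul1r.
Qed.

Lemma ge_mul m n p k l (f : R -> 'M[R[i]]_(m, n)) (g : R -> 'M[R[i]]_(n, p)) :
  spec_ge k f -> spec_ge l g -> mL2 (fun t => f t *m g t) -> spec_ge (k + l) (fun t => f t *m g t).
Proof.
move=> gf gg sfg i j; split; first exact: sfg.
move=> q qkl; under eq_fun do rewrite mxE.
rewrite /coef; under eq_fun do rewrite mulr_suml.
rewrite mean_sum.
  rewrite big1 // => s _; have [sf f0] := gf i s; have [sg g0] := gg s j.
  exact: (coef_mul_ge sf sg f0 g0).
move=> s; have [sf f0] := gf i s; have [sg g0] := gg s j.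
under eq_fun do rewrite -mulrA mulrC [_ * ek _ _]mulrC.
rewrite (_ : (fun t => _) = fun t => ek (- q) t * g t s j * f t i s) //.
apply: sL2M => //; apply: (@sL2M_bdd _ _ _ 1) => //; first exact: cmeas_ek.
by apply: nearW => t _; rewrite normsq_ek.
Qed.

Lemma le_mul m n p k l (f : R -> 'M[R[i]]_(m, n)) (g : R -> 'M[R[i]]_(n, p)) :
  spec_le k f -> spec_le l g -> mL2 (fun t => f t *m g t) -> spec_le (k + l) (fun t => f t *m g t).
Proof.
move=> lf lg sfg; rewrite /spec_le opprD addrC.
under eq_fun do rewrite adjM; apply: ge_mul => //.
by under eq_fun do rewrite -adjM; exact: mL2_adj.
Qed.

Lemma ge_mulC m n p k (f : R -> 'M[R[i]]_(m, n)) (A : 'M[R[i]]_(n, p)) :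
  spec_ge k f -> spec_ge k (fun t => f t *m A).
Proof.
move=> gf; rewrite -[k]addr0; apply: ge_mul => //; first exact: ge_cst.
by apply: mL2_mulr; [exact: mbdd_cst|exact: ge_L2 gf].
Qed.

Lemma le_mulC m n p k (f : R -> 'M[R[i]]_(m, n)) (A : 'M[R[i]]_(n, p)) :
  spec_le k f -> spec_le k (fun t => f t *m A).
Proof.
move=> gf; rewrite -[k]addr0; apply: le_mul => //; first exact: le_cst.
by apply: mL2_mulr; [exact: mbdd_cst|exact: le_L2 gf].
Qed.

End Products.

(** * Boundary values of bounded analytic functions *)

Section PowerSeries.
Context {R : realType}.
Notation mean := (@circle_mean R).
Implicit Types (z : R[i]) (a : nat -> R[i]) (g : R[i] -> R[i]).

(** Convergence of complex sequences through real and imaginary parts, which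
    matches the entrywise definition of the means. *)
Definition ccvg T (F : set_system T) (u : T -> R[i]) (l : R[i]) :=
  Re (u x) @[x --> F] --> Re l /\ Im (u x) @[x --> F] --> Im l.

Lemma disc_normsq z : (`|z| < 1) = (normsq z < 1).
Proof.
rewrite normc_def -[1]/(1%:C) ltcR -/(normsq z).
by rewrite -[X in _ < X]sqrtr1 ltr_sqrt.
Qed.

Section ccvg.
Context {T : Type} {F : set_system T} {FF : Filter F}.
Implicit Types u v : T -> R[i].

Lemma ccvg_cst l : ccvg F (fun=> l) l.
Proof. by split; exact: cvg_cst. Qed.

Lemma ccvgD u v l l' : ccvg F u l -> ccvg F v l' -> ccvg F (fun x => u x + v x) (l + l').
Proof.
by move=> [ur ui] [vr vi]; split; rewrite ReImE; under eq_fun do rewrite ReImE; exact: cvgD.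
Qed.

Lemma ccvgM u v l l' : ccvg F u l -> ccvg F v l' -> ccvg F (fun x => u x * v x) (l * l').
Proof.
move=> [ur ui] [vr vi]; split; rewrite ReImE; under eq_fun do rewrite ReImE.
  by apply: cvgB; exact: cvgM.
by apply: cvgD; exact: cvgM.
Qed.

Lemma ccvgN u l : ccvg F u l -> ccvg F (fun x => - u x) (- l).
Proof.
by move=> [ur ui]; split; rewrite ReImE; under eq_fun do rewrite ReImE; exact: cvgN.
Qed.

Lemma ccvgB u v l l' : ccvg F u l -> ccvg F v l' -> ccvg F (fun x => u x - v x) (l - l').
Proof. by move=> ul vl; apply: ccvgD => //; exact: ccvgN. Qed.

Lemma ccvg_normsq u l : ccvg F u l -> normsq (u x) @[x --> F] --> normsq l.
Proof.
by move=> [ur ui]; rewrite /normsq; apply: cvgD; [exact: (cvgM ur ur)|exact: (cvgM ui ui)].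
Qed.

Lemma hs_cvgP m n (u : T -> 'M[R[i]]_(m, n)) L :
  hsnorm (u x - L) @[x --> F] --> (0 : R) <->
  forall i j, ccvg F (fun x => u x i j) (L i j).
Proof.
split=> [h i j|uL].
  have sq0 (p : R[i] -> R) : (forall z, p z ^+ 2 <= normsq z) ->
      (forall z z', p (z - z') = p z - p z') ->
      p (u x i j) @[x --> F] --> p (L i j).
    move=> p2 pB; rewrite -[X in _ --> X]add0r.
    have -> : (fun x => p (u x i j)) = fun x => p ((u x - L) i j) + p (L i j).
      by apply/funext => x; rewrite !mxE pB subrK.
    apply: cvgD; last exact: cvg_cst.
    apply: (@squeeze_cvgr _ _ _ _ (fun x => - hsnorm (u x - L)) (fun x => hsnorm (u x - L))) => //.
      apply: nearW => x; rewrite -ler_norml -ler_sqr ?nnegrE ?hsnorm_ge0 //.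
      rewrite real_normK ?num_real //.
      by apply: le_trans (p2 _) _; exact: entry_hsnorm.
    by rewrite -[X in _ --> X]oppr0; exact: cvgN.
  split; apply: sq0; [exact: Re_normsq| |exact: Im_normsq|].
    by move=> z z'; rewrite !ReImE.
  by move=> z z'; rewrite !ReImE.
have lim2 : \sum_i \sum_j normsq ((u x - L) i j) @[x --> F] --> (0 : R).
  rewrite [X in _ --> X](_ : 0 = \sum_(i < m) \sum_(j < n) (0 : R)); last first.
    by rewrite big1 // => i _; rewrite big1.
  have cs (I : Type) (s : seq I) (v : I -> T -> R) (l : I -> R) :
      (forall i, v i x @[x --> F] --> l i) ->
      \sum_(i <- s) v i x @[x --> F] --> \sum_(i <- s) l i.
    move=> vl; elim: s => [|i s IHs].
      by under eq_fun do rewrite big_nil; rewrite big_nil; exact: cvg_cst.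
    by under eq_fun do rewrite big_cons; rewrite big_cons; exact: cvgD.
  apply: (cs) => i; apply: (cs) => j; under eq_fun do rewrite !mxE.
  have := ccvg_normsq (ccvgB (uL i j) (ccvg_cst (L i j))).
  by rewrite subrr /normsq /= expr0n /= addr0.
have -> : (fun x => hsnorm (u x - L)) =
    fun x => Num.sqrt (\sum_i \sum_j normsq ((u x - L) i j)).
  by apply/funext => x; rewrite -hsnorm_sqr sqrtr_sqr ger0_norm // hsnorm_ge0.
rewrite -[X in _ --> X](@sqrtr0 R).
by apply: (continuous_cvg _ _ lim2); exact: sqrt_continuous.
Qed.

End ccvg.

Lemma ccvg_unique T (F : set_system T) {FF : ProperFilter F} (u : T -> R[i]) l l' :
  ccvg F u l -> ccvg F u l' -> l = l'.
Proof.
move=> [ur ui] [vr vi]; apply: complex_eq.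
  by apply: (cvg_unique _ ur vr); exact: Rhausdorff.
by apply: (cvg_unique _ ui vi); exact: Rhausdorff.
Qed.

End PowerSeries.

Section DiscSeries.
Context {R : realType}.
Notation mean := (@circle_mean R).
Implicit Types (z : R[i]) (a : nat -> R[i]) (g : R[i] -> R[i]) (r : R).

Definition psum a N z : R[i] := \sum_(0 <= k < N) z ^+ k * a k.

Definition pser a g := forall z, normsq z < 1 -> ccvg \oo (fun N => psum a N z) (g z).

Lemma normsq_normc z : normsq z = Normc.normc z ^+ 2.
Proof. by case: z => x y; rewrite /normsq /= sqr_sqrtr // addr_ge0 // sqr_ge0. Qed.

Lemma le0_normc z : 0 <= Normc.normc z.
Proof. by case: z => x y; exact: sqrtr_ge0. Qed.

Lemma normcX z k : Normc.normc (z ^+ k) = Normc.normc z ^+ k.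
Proof.
elim: k => [|k IHk]; first by rewrite !expr0 Normc.normc1.
by rewrite !exprS Normc.normcM IHk.
Qed.

Lemma normsq_real r : normsq (r%:C) = r ^+ 2.
Proof. by rewrite /normsq /= expr0n addr0. Qed.

(** The terms are bounded at the radius [s] halfway between [r] and 1, so the
    series is dominated by a geometric one of ratio [r / s] up to the
    radius [r]. *)
Lemma pser_bound a g r : 0 <= r < 1 -> pser a g ->
  exists2 D : R, 0 <= D & forall N z, normsq z <= r ^+ 2 -> normsq (psum a N z) <= D ^+ 2.
Proof.
move=> /andP[r0 r1] ag; pose s := (1 + r) / 2.
have s0 : 0 < s by rewrite /s; lra.
have rs : r < s by rewrite /s; lra.
have s1 : normsq (s%:C) < 1 by rewrite normsq_real expr_lt1 // ?ltW // /s; lra.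
have term0 : normsq (s%:C ^+ k * a k) @[k --> \oo] --> (0 : R).
  have c1 : ccvg \oo (fun N => psum a N.+1 s%:C) (g s%:C).
    by have [cr ci] := ag _ s1; split; [rewrite (cvg_shiftS (fun N => Re (psum a N s%:C)))|
      rewrite (cvg_shiftS (fun N => Im (psum a N s%:C)))].
  have -> : (fun k => normsq (s%:C ^+ k * a k)) =
      fun k => normsq (psum a k.+1 s%:C - psum a k s%:C).
    by apply/funext => k; rewrite /psum big_nat_recr //= addrAC subrr add0r.
  have := ccvg_normsq (ccvgB c1 (ag _ s1)).
  have n0 : normsq (0 : R[i]) = 0 by rewrite /normsq /= expr0n addr0.
  by rewrite subrr n0; apply.
have [M [_ HM]] := cvg_seq_bounded (cvgP _ term0).
pose C := `|M| + 1.
have C0 : 0 <= C by rewrite addr_ge0.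
have termC k : Normc.normc (s%:C ^+ k * a k) <= C.
  rewrite -ler_sqr ?nnegrE ?le0_normc // -normsq_normc.
  apply: (@le_trans _ _ (`|M| + 1)); last first.
    by rewrite -/C expr2 ler_peMr // /C lerDr.
  have M1 : M < `|M| + 1 by rewrite ltr_pwDr // ler_norm.
  exact: le_trans (ler_norm _) (HM _ M1 k I).
pose q := r / s.
have q0 : 0 <= q by rewrite divr_ge0 // ltW.
have q1 : q < 1 by rewrite ltr_pdivrMr // mul1r.
have q10 : 0 <= 1 - q by rewrite subr_ge0 ltW.
have D0 : 0 <= C / (1 - q) by rewrite divr_ge0.
exists (C / (1 - q)) => //.
move=> N z zr; have zr' : Normc.normc z <= r.
  by rewrite -ler_sqr ?nnegrE ?le0_normc // -normsq_normc.
rewrite normsq_normc ler_sqr ?nnegrE ?le0_normc //.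
have tz k : Normc.normc (z ^+ k * a k) <= q ^+ k * C.
  rewrite Normc.normcM normcX.
  apply: (@le_trans _ _ (r ^+ k * Normc.normc (a k))).
    by rewrite ler_wpM2r ?le0_normc // lerXn2r // nnegrE le0_normc.
  have -> : r ^+ k * Normc.normc (a k) =
      q ^+ k * Normc.normc (s%:C ^+ k * a k).
    rewrite Normc.normcM normcX mulrA -exprMn.
    have -> : Normc.normc s%:C = s.
      by rewrite /= expr0n addr0 sqrtr_sqr ger0_norm // ltW.
    by rewrite /q mulfVK // gt_eqF.
  by rewrite ler_wpM2l // exprn_ge0.
have : Normc.normc (psum a N z) <= (1 - q ^+ N) / (1 - q) * C.
  have q1' : 1 - q != 0 by rewrite subr_eq0 eq_sym lt_eqF.
  elim: N => [|N IHN].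
    by rewrite /psum big_nil expr0 subrr !mul0r Normc.normc0.
  rewrite /psum big_nat_recr //=; apply: (le_trans (le_normcD _ _)).
  apply: (le_trans (lerD IHN (tz N))); rewrite -mulrDl exprSr.
  by rewrite le_eqVlt; apply/orP; left; apply/eqP; congr (_ * _); field.
move=> H; apply: (le_trans H).
rewrite [(1 - q ^+ N) / _]mulrC -mulrA mulrC -mulrA ler_piMl //.
  by rewrite gerBl exprn_ge0.
Qed.

Lemma expi_exp (t : R) k : expi t ^+ k = ek (Posz k) t.
Proof.
elim: k => [|k IHk]; first by rewrite expr0 ek0.
by rewrite exprSr IHk -addn1 PoszD ekD /ek mul1r.
Qed.

Lemma psum_circle a N r t :
  psum a N (r%:C * expi t) = tp (fun k => r%:C ^+ k * a k) 0 N t.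
Proof.
apply: eq_bigr => k _; rewrite exprMn expi_exp.
by rewrite mulrAC.
Qed.

Lemma normsq_circle r (t : R) : normsq (r%:C * expi t) = r ^+ 2.
Proof. by rewrite normsqM normsq_real normsq_expi mulr1. Qed.

Lemma cmeas_ccvg (u : nat -> R -> R[i]) (l : R -> R[i]) :
  (forall n, cmeas (u n)) -> (forall t, ccvg \oo (u ^~ t) (l t)) -> cmeas l.
Proof.
move=> mu_ ul; split.
  apply: (@measurable_fun_cvg _ _ _ _ (fun n t => Re (u n t))).
    by move=> n; have [] := mu_ n.
  by move=> t _; have [] := ul t.
apply: (@measurable_fun_cvg _ _ _ _ (fun n t => Im (u n t))).
  by move=> n; have [] := mu_ n.
by move=> t _; have [] := ul t.
Qed.

Lemma circle_cmeas a g r : 0 <= r < 1 -> pser a g ->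
  cmeas (fun t => g (r%:C * expi t)).
Proof.
move=> /andP[r0 r1] ag; apply: (@cmeas_ccvg (fun N t => psum a N (r%:C * expi t))).
  move=> N; under eq_fun do rewrite psum_circle; exact: (sL2_tp _ _ _).1.
by move=> t; apply: ag; rewrite normsq_circle expr_lt1.
Qed.

(** Uniform boundedness of the partial sums on the circle of radius [r] allows
    to integrate them term by term. *)
Lemma circle_coef a g r (k : int) : 0 <= r < 1 -> pser a g ->
  coef (fun t => g (r%:C * expi t)) k = if 0 <= k then r%:C ^+ absz k * a (absz k) else 0.
Proof.
move=> r01 ag; have /andP[r0 r1] := r01; have [D D0 bD] := pser_bound r01 ag.
have [] := @mean_dct R (fun N t => psum a N (r%:C * expi t) * ek (- k) t)
  (fun t => g (r%:C * expi t) * ek (- k) t) (fun=> D) _ _ (rint_cst D) _ _ (fun _ _ => D0).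
- move=> N; apply: cmeasM; last exact: cmeas_ek.
  by under eq_fun do rewrite psum_circle; exact: (sL2_tp _ _ _).1.
- by apply: cmeasM; [exact: circle_cmeas ag|exact: cmeas_ek].
- apply: nearW => t _; apply: ccvgM; last exact: ccvg_cst.
  by apply: ag; rewrite normsq_circle expr_lt1.
- apply: nearW => t _ N; rewrite normsqM normsq_ek mulr1.
  by apply: bD; rewrite normsq_circle.
move=> _ cr ci; apply: (@ccvg_unique _ _ \oo _ (fun N => coef (tp (fun k => r%:C ^+ k * a k) 0 N) k)).
  have -> : (fun N => coef (tp (fun k => r%:C ^+ k * a k) 0 N) k) =
      fun N => mean (fun t => psum a N (r%:C * expi t) * ek (- k) t).
    by apply/funext => N; apply: eq_mean => t _; rewrite psum_circle.
  by split.
have H : \forall N \near \oo, coef (tp (fun k => r%:C ^+ k * a k) 0 N) k =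
    if 0 <= k then r%:C ^+ absz k * a (absz k) else 0.
  exists (absz k).+1 => // N /= kN; case: ifPn => [|]; last first.
    by rewrite -ltNge; exact: coef_tp_lt0.
  by case: k kN {cr ci} => // k kN _; rewrite coef_tp_nat kN.
by split; apply: cvg_near_cst; apply: filterS H => N ->.
Qed.

Definition rad n : R := 1 - n.+1%:R^-1.

Lemma rad01 n : 0 <= rad n < 1.
Proof.
rewrite /rad subr_ge0 invf_le1 ?ltr0Sn // ler1n /=.
by rewrite ltrBlDr ltrDl invr_gt0.
Qed.

Lemma rad_cvg : rad n @[n --> \oo] --> (1 : R).
Proof.
rewrite -[X in _ --> X]subr0; apply: cvgB; first exact: cvg_cst.
exact: cvg_harmonic.
Qed.

Lemma ccvg_rad (u : R -> R[i]) l : ccvg (1^'-) u l -> ccvg \oo (fun n => u (rad n)) l.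
Proof.
have H n : rad n < 1 by have /andP[] := rad01 n.
by move=> [/cvg_at_leftP ur /cvg_at_leftP ui]; split; [apply: ur|apply: ui];
  split=> //; exact: rad_cvg.
Qed.

Lemma bdry_bound g (b : R -> R[i]) c :
  (forall z, normsq z < 1 -> normsq (g z) <= c) ->
  circle_ae (fun t => ccvg (1^'-) (fun r => g (r%:C * expi t)) (b t)) ->
  circle_ae (fun t => normsq (b t) <= c).
Proof.
move=> gc; apply: filterS => t /ccvg_rad/ccvg_normsq cb.
apply: (cvgr_to_le cb); apply: nearW => n; apply: gc.
by have /andP[r0 r1] := rad01 n; rewrite normsq_circle expr_lt1.
Qed.

(** The coefficients on the circles of radii [rad n] are known from
    [circle_coef]; they converge by dominated convergence, the function being
    bounded on the disc. *)
Lemma bdry_coef a g (b : R -> R[i]) c : pser a g ->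
  (forall z, normsq z < 1 -> normsq (g z) <= c) -> cmeas b ->
  circle_ae (fun t => ccvg (1^'-) (fun r => g (r%:C * expi t)) (b t)) ->
  forall k : int, coef b k = if 0 <= k then a (absz k) else 0.
Proof.
move=> ag gc mb gb k.
have c0 : 0 <= c by apply: le_trans (gc 0 _); rewrite // /normsq /= expr0n addr0.
have [] := @mean_dct R (fun n t => g ((rad n)%:C * expi t) * ek (- k) t)
  (fun t => b t * ek (- k) t) (fun=> c + 1) _ _ (rint_cst (c + 1)) _ _
  (fun _ _ => addr_ge0 c0 ler01).
- by move=> n; apply: cmeasM; [exact: circle_cmeas (rad01 n) ag|exact: cmeas_ek].
- by apply: cmeasM => //; exact: cmeas_ek.
- apply: filterS gb => t /ccvg_rad cb.
  by apply: ccvgM; last exact: ccvg_cst.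
- apply: nearW => t _ n; rewrite normsqM normsq_ek mulr1.
  have /andP[r0 r1] := rad01 n.
  apply: (@le_trans _ _ c); first by apply: gc; rewrite normsq_circle expr_lt1.
  by rewrite expr2; nra.
move=> _ cr ci; apply: (@ccvg_unique _ _ \oo _ (fun n => coef (fun t => g ((rad n)%:C * expi t)) k)).
  by split.
have -> : (fun n => coef (fun t => g ((rad n)%:C * expi t)) k) =
    fun n => if 0 <= k then (rad n)%:C ^+ absz k * a (absz k) else 0.
  by apply/funext => n; apply: circle_coef => //; exact: rad01.
case: ifPn => _; last exact: ccvg_cst.
rewrite -[X in ccvg _ _ X]mul1r; apply: ccvgM; last exact: ccvg_cst.
have r1 : ccvg \oo (fun n => (rad n)%:C) 1 by split => /=; [exact: rad_cvg|exact: cvg_cst].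
elim: (absz k) => [|m IHm]; first by under eq_fun do rewrite expr0; exact: ccvg_cst.
by under eq_fun do rewrite exprS; rewrite -[X in ccvg _ _ X]mul1r; exact: ccvgM.
Qed.

End DiscSeries.

Section BoundaryValues.
Context {R : realType}.
Notation mean := (@circle_mean R).
Implicit Types (z : R[i]) (a : nat -> R[i]) (g : R[i] -> R[i]) (r : R) (b : R -> R[i]).

Definition disc_bounded g := exists c, forall z, normsq z < 1 -> normsq (g z) <= c.

(** Scalar counterpart of membership in [Hinf] (see [HinfP]). *)
Definition hol g := (exists a, pser a g) /\ disc_bounded g.

(** Relating a bounded analytic function to its boundary function, rather than
    choosing the latter, lets closure properties be proved for both at
    once. *)
Definition bvs g b := hol g /\
  circle_ae (fun t => ccvg (1^'-) (fun r => g (r%:C * expi t)) (b t)).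

Lemma psum0 a N : psum a N.+1 0 = a 0%N.
Proof.
rewrite /psum big_nat_recl // expr0 mul1r big1_seq ?addr0 // => k _.
by rewrite expr0n mul0r.
Qed.

Lemma normsq0 : normsq (0 : R[i]) = 0.
Proof. by rewrite /normsq /= expr0n addr0. Qed.

Lemma pser_at0 a g : pser a g -> g 0 = a 0%N.
Proof.
move=> /(_ 0); rewrite normsq0 ltr01 => /(_ isT) ag.
apply: (ccvg_unique ag); have e : \forall N \near \oo, psum a N 0 = a 0%N.
  by exists 1%N => // -[|N] //= _; rewrite psum0.
by split; apply: cvg_near_cst; apply: filterS e => N ->.
Qed.

Lemma ccvg_near T (F : set_system T) {FF : Filter F} (u v : T -> R[i]) l :
  (\forall x \near F, u x = v x) -> ccvg F u l -> ccvg F v l.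
Proof.
move=> uv [ur ui]; split.
  by apply: cvg_trans ur; apply: near_eq_cvg; apply: filterS uv => x ->.
by apply: cvg_trans ui; apply: near_eq_cvg; apply: filterS uv => x ->.
Qed.

Lemma bvs_cst c : bvs (fun=> c) (fun=> c).
Proof.
split; last by apply: nearW => t _; exact: ccvg_cst.
split; last by exists (normsq c).
exists (fun k => if k == 0%N then c else 0) => z _.
apply: (@ccvg_near _ _ _ (fun=> c)); last exact: ccvg_cst.
exists 1%N => // -[|N] //= _; rewrite /psum big_nat_recl // expr0 mul1r big1_seq ?addr0 // => k _.
by rewrite mulr0.
Qed.

Lemma bvsD g g' b b' : bvs g b -> bvs g' b' ->
  bvs (fun z => g z + g' z) (fun t => b t + b' t).
Proof.
move=> [[[a ag] [c gc]] gb] [[[a' ag'] [c' gc']] gb']; split; last first.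
  by apply: filterS2 gb gb' => t; exact: ccvgD.
split; last first.
  exists (2 * c + 2 * c') => z z1; apply: (le_trans (normsqD _ _)).
  by rewrite lerD // ler_wpM2l // ?gc ?gc'.
exists (fun k => a k + a' k) => z z1.
have -> : (fun N => psum (fun k => a k + a' k) N z) = fun N => psum a N z + psum a' N z.
  apply/funext => N; rewrite /psum -big_split; apply: eq_bigr => k _.
  by rewrite mulrDr.
by apply: ccvgD; [exact: ag|exact: ag'].
Qed.

Lemma bvsZ c g b : bvs g b -> bvs (fun z => c * g z) (fun t => c * b t).
Proof.
move=> [[[a ag] [k gk]] gb]; split; last first.
  by apply: filterS gb => t gb; apply: ccvgM => //; exact: ccvg_cst.
split; last first.
  exists (normsq c * k) => z z1; rewrite normsqM ler_wpM2l //; exact: gk.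
exists (fun k => c * a k) => z z1.
have -> : (fun N => psum (fun k => c * a k) N z) = fun N => c * psum a N z.
  by apply/funext => N; rewrite /psum mulr_sumr; apply: eq_bigr => l _; rewrite mulrCA.
by apply: ccvgM; [exact: ccvg_cst|exact: ag].
Qed.

Lemma bvsB g g' b b' : bvs g b -> bvs g' b' ->
  bvs (fun z => g z - g' z) (fun t => b t - b' t).
Proof.
move=> gb /(bvsZ (-1)) gb'; have := bvsD gb gb'.
by congr bvs; apply/funext => x; rewrite mulN1r.
Qed.

Lemma bvs_sum (I : Type) (s : seq I) (g : I -> R[i] -> R[i]) (b : I -> R -> R[i]) :
  (forall i, bvs (g i) (b i)) ->
  bvs (fun z => \sum_(i <- s) g i z) (fun t => \sum_(i <- s) b i t).
Proof.
move=> gb; elim: s => [|i s IHs].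
  have := bvs_cst 0; congr bvs; by apply/funext => x; rewrite big_nil.
have := bvsD (gb i) IHs; congr bvs; by apply/funext => x; rewrite big_cons.
Qed.

Lemma ccvg_circle (t : R) : ccvg (1^'-) (fun r => r%:C * expi t) (expi t).
Proof.
rewrite -[X in ccvg _ _ X]mul1r; apply: ccvgM; last exact: ccvg_cst.
by split => /=; [exact: cvg_at_left_filter cvg_id|exact: cvg_cst].
Qed.

Lemma bvs_mulX g b : bvs g b -> bvs (fun z => z * g z) (fun t => ek 1 t * b t).
Proof.
move=> [[[a ag] [c gc]] gb]; split; last first.
  apply: filterS gb => t gb; rewrite /ek mul1r.
  by apply: ccvgM => //; exact: ccvg_circle.
split; last first.
  exists c => z z1; rewrite normsqM; apply: le_trans (gc z z1).
  by rewrite ler_piMl // ltW.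
exists (fun k => if k is l.+1 then a l else 0) => z z1.
apply: (@ccvg_near _ _ _ (fun N => z * psum a N.-1 z)).
  exists 1%N => // -[|N] //= _; rewrite /psum big_nat_recl // mulr0 add0r mulr_sumr.
  by apply: eq_bigr => k _; rewrite exprS mulrA.
apply: ccvgM; first exact: ccvg_cst.
have [cr ci] := ag z z1; split.
  by rewrite -(cvg_shiftS (fun N => Re (psum a N.-1 z))).
by rewrite -(cvg_shiftS (fun N => Im (psum a N.-1 z))).
Qed.

Lemma bvs_mulXn k g b : bvs g b -> bvs (fun z => z ^+ k * g z) (fun t => ek (Posz k) t * b t).
Proof.
move=> gb; elim: k => [|k /bvs_mulX].
  by congr (bvs _ _) : gb; apply/funext => x; rewrite ?expr0 ?ek0 mul1r.
congr bvs; apply/funext => x; first by rewrite exprS mulrA.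
by rewrite mulrA -ekD.
Qed.

(** The difference quotient at the origin stays bounded: away from the origin
    trivially, near it because its power series is bounded on the disc of
    radius 1/2. *)
Lemma bvs_quot g b : bvs g b -> exists2 g', bvs g' (fun t => ek (-1) t * (b t - g 0)) &
  forall z, z != 0 -> g' z = z^-1 * (g z - g 0).
Proof.
move=> gb; have [[[a ag] [c gc]] gbt] := gb.
have a0 := pser_at0 ag.
pose g' z := if z == 0 then a 1%N else z^-1 * (g z - g 0).
have ag' : pser (fun k => a k.+1) g'.
  move=> z z1; rewrite /g'; case: eqP => [->|/eqP z0].
    apply: (@ccvg_near _ _ _ (fun=> a 1%N)); last exact: ccvg_cst.
    by exists 1%N => // -[|N] //= _; rewrite (psum0 (fun k => a k.+1)).
  have -> : (fun N => psum (fun k => a k.+1) N z) = fun N => z^-1 * (psum a N.+1 z - g 0).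
    apply/funext => N; rewrite a0 /psum big_nat_recl // expr0 mul1r addrAC subrr add0r.
    rewrite mulr_sumr; apply: eq_bigr => k _.
    by rewrite exprS -mulrA mulKf.
  apply: ccvgM; first exact: ccvg_cst.
  apply: ccvgB; last exact: ccvg_cst.
  have [cr ci] := ag z z1; split.
    by rewrite (cvg_shiftS (fun N => Re (psum a N z))).
  by rewrite (cvg_shiftS (fun N => Im (psum a N z))).
exists g'; last by move=> z /negbTE z0; rewrite /g' z0.
split; last first.
  apply: filterS gbt => t gbt.
  apply: (@ccvg_near _ _ _ (fun r => (r%:C * expi t)^-1 * (g (r%:C * expi t) - g 0))).
    have : \forall r \near (1 : R)^'-, 0 < r.
      by apply: nbhs_left_gt; exact: ltr01.
    apply: filterS => r r0; rewrite /g' ifF //; apply/negbTE; apply/eqP => e.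
    by have := normsq_circle r t; rewrite e normsq0 => /esym/eqP; rewrite sqrf_eq0 gt_eqF.
  apply: ccvgM; last by apply: ccvgB => //; exact: ccvg_cst.
  have -> : (fun r => (r%:C * expi t)^-1) = fun r => (r^-1)%:C * ek (-1) t.
    apply/funext => r; rewrite invfM; congr (_ * _); first by rewrite -fmorphV.
    rewrite ekN /ek mul1r; apply: (@mulfI _ (expi t)).
      by apply/eqP => e; have := normsq_expi t; rewrite e normsq0 => /eqP; rewrite eq_sym oner_eq0.
    rewrite mulfV ?mulJ_normsq ?normsq_expi //.
    by apply/eqP => e; have := normsq_expi t; rewrite e normsq0 => /eqP; rewrite eq_sym oner_eq0.
  rewrite -[X in ccvg _ _ X]mul1r; apply: ccvgM; last exact: ccvg_cst.
  split => /=; last exact: cvg_cst.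
  rewrite -[X in _ --> X]invr1; apply: cvgV; first exact: oner_neq0.
  exact: cvg_at_left_filter cvg_id.
split; first by exists (fun k => a k.+1).
have half : 0 <= (2^-1 : R) < 1 by apply/andP; split; lra.
have [D D0 bD] := pser_bound half ag'.
exists (D ^+ 2 + 4 * (2 * c + 2 * c)) => z z1.
have c0 : 0 <= c by apply: le_trans (gc z z1).
have [le|gt] := leP (normsq z) (2^-1 ^+ 2).
  have H : normsq (g' z) <= D ^+ 2.
    apply: (cvgr_to_le (ccvg_normsq (ag' z z1))); apply: nearW => N; exact: bD.
  by apply: (le_trans H); rewrite lerDl !(mulr_ge0, addr_ge0).
have z0 : z != 0.
  by apply/eqP => e; move: gt; rewrite e normsq0 ltNge exprn_ge0 // invr_ge0.
have zV : normsq z^-1 <= 4.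
  have : normsq z * normsq z^-1 = 1.
    by rewrite -normsqM mulfV // -[1]/((1:R)%:C) normsq_real expr1n.
  by have := normsq_ge0 z^-1; move: gt; rewrite expr2; nra.
have gg : normsq (g z - g 0) <= 2 * c + 2 * c.
  apply: (le_trans (normsqD _ _)); rewrite normsqN lerD // ler_wpM2l // ?gc //.
  by rewrite normsq0.
rewrite /g' (negbTE z0) normsqM.
apply: (@le_trans _ _ (4 * (2 * c + 2 * c))); first exact: ler_pM.
by rewrite lerDr sqr_ge0.
Qed.

Lemma bvs_coef g b : bvs g b -> cmeas b ->
  [/\ sL2 b, exists c, circle_ae (fun t => normsq (b t) <= c),
    forall k : int, k < 0 -> coef b k = 0 & coef b 0 = g 0].
Proof.
move=> [[[a ag] [c gc]] gb] mb.
have bc := bdry_bound gc gb; have co := bdry_coef ag gc mb gb.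
split.
- have := @sL2M_bdd _ b (fun=> 1) c mb bc (sL2_cst 1).
  by rewrite (_ : (fun t => b t * 1) = b) //; apply/funext => t; rewrite mulr1.
- by exists c.
- by move=> k k0; rewrite co leNgt k0.
- by rewrite co lexx (pser_at0 ag).
Qed.

End BoundaryValues.

Section MatrixBoundary.
Context {R : realType}.

Lemma hsnormE m n (A : 'M[R[i]]_(m, n)) :
  hsnorm A = Num.sqrt (\sum_i \sum_j normsq (A i j)).
Proof. by rewrite -hsnorm_sqr sqrtr_sqr ger0_norm // hsnorm_ge0. Qed.

Lemma hsnormN m n (A : 'M[R[i]]_(m, n)) : hsnorm (- A) = hsnorm A.
Proof.
rewrite !hsnormE; congr Num.sqrt; apply: eq_bigr => i _; apply: eq_bigr => j _.
by rewrite mxE normsqN.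
Qed.

Lemma hsnormZ m n (r : R) (A : 'M[R[i]]_(m, n)) : 0 <= r ->
  hsnorm (r%:C *: A) = r * hsnorm A.
Proof.
move=> r0; apply: (@pexpIrn _ 2) => //; rewrite ?nnegrE ?mulr_ge0 ?hsnorm_ge0 //.
rewrite exprMn !hsnorm_sqr mulr_sumr; apply: eq_bigr => i _.
rewrite mulr_sumr; apply: eq_bigr => j _.
by rewrite mxE normsqM normsq_real.
Qed.

Lemma hsdot_hsnorm m n (A : 'M[R[i]]_(m, n)) : hsdot A A = (hsnorm A ^+ 2)%:C.
Proof. by rewrite hsdot_self hsnorm_sqr. Qed.

Lemma hsnorm_eq0 m n (A : 'M[R[i]]_(m, n)) : hsnorm A = 0 -> A = 0.
Proof.
move=> A0; apply/matrixP => i j; rewrite mxE; apply: normsq_eq0; apply/eqP.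
by rewrite eq_le normsq_ge0 andbT; apply: le_trans (entry_hsnorm A i j) _; rewrite A0 expr0n.
Qed.

Lemma HinfP m n (F : R[i] -> 'M[R[i]]_(m, n)) :
  Hinf F <-> forall i j, hol (fun z => F z i j).
Proof.
have flip (a : nat -> 'M[R[i]]_(m, n)) z : (hsnorm (F z - \sum_(k < N) z ^+ k *: a k) @[N --> \oo] --> (0 : R)) <->
    forall i j, ccvg \oo (fun N => psum (fun k => a k i j) N z) (F z i j).
  rewrite (_ : (fun N => hsnorm _) = fun N => hsnorm (\sum_(k < N) z ^+ k *: a k - F z)).
    rewrite hs_cvgP; have E i j : (fun N => (\sum_(k < N) z ^+ k *: a k) i j) =
        fun N => psum (fun k => a k i j) N z.
      apply/funext => N; rewrite summxE /psum big_mkord; apply: eq_bigr => k _.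
      by rewrite mxE.
    by split=> H i j; have := H i j; rewrite E.
  by apply/funext => N; rewrite -hsnormN opprB.
split=> [[[a aF] [M FM]] i j|HF].
  split.
    exists (fun k => a k i j) => z z1.
    have z1' : `|z| < 1 by rewrite disc_normsq.
    by have /flip := aF z z1'; apply.
  exists (M ^+ 2) => z z1; apply: (le_trans (entry_hsnorm _ i j)).
  by rewrite ler_sqr ?nnegrE ?hsnorm_ge0 //;
    [apply: FM; rewrite disc_normsq|apply: le_trans (FM z _); rewrite ?hsnorm_ge0 ?disc_normsq].
have /choice[a Ha] : forall ij : 'I_m * 'I_n, exists a, pser a (fun z => F z ij.1 ij.2).
  by move=> [i j]; have [[a ag] _] := HF i j; exists a.
have /choice[c Hc] : forall ij : 'I_m * 'I_n, exists c,
    forall z, normsq z < 1 -> normsq (F z ij.1 ij.2) <= c.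
  by move=> [i j]; have [_ [c cg]] := HF i j; exists c.
split.
  pose A k : 'M[R[i]]_(m, n) := \matrix_(i, j) a (i, j) k.
  exists A => z; rewrite disc_normsq => z1.
  apply: (proj2 (flip A z)) => i j; have := Ha (i, j) z z1.
  by congr ccvg; apply/funext => N; apply: eq_bigr => k _; rewrite mxE.
exists (Num.sqrt (\sum_i \sum_j c (i, j))) => z; rewrite disc_normsq => z1.
rewrite hsnormE ler_wsqrtr //; apply: ler_sum => i _; apply: ler_sum => j _.
exact: (Hc (i, j)).
Qed.

Lemma radial_limitP m n (F : R[i] -> 'M[R[i]]_(m, n)) t L :
  radial_limit F t L <->
  forall i j, ccvg (1^'-) (fun r : R => F (r%:C * expi t) i j) (L i j).
Proof. by rewrite /radial_limit hs_cvgP. Qed.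

Lemma circle_ae_forall2 m n (P : 'I_m -> 'I_n -> R -> Prop) :
  (forall i j, circle_ae (P i j)) -> circle_ae (fun t => forall i j, P i j t).
Proof.
move=> HP; have : circle_ae (fun t => forall k : 'I_m * 'I_n, P k.1 k.2 t).
  apply: (@filter_forall R ('I_m * 'I_n)%type (fun k t => P k.1 k.2 t)
    (@circle_ae R)) => -[i j]; exact: HP.
by apply: filterS => t H i j; exact: (H (i, j)).
Qed.

Lemma bv_bvs m n (F : R[i] -> 'M[R[i]]_(m, n)) (f : R -> 'M[R[i]]_(m, n)) :
  (Hinf F /\ circle_ae (fun t => radial_limit F t (f t))) <->
  forall i j, bvs (fun z => F z i j) (fun t => f t i j).
Proof.
split=> [[/HinfP HF lF] i j|H].
  by split; [exact: HF|apply: filterS lF => t /radial_limitP].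
split; first by apply/HinfP => i j; have [] := H i j.
have : circle_ae (fun t => forall i j,
    ccvg (1^'-) (fun r : R => F (r%:C * expi t) i j) (f t i j)).
  by apply: circle_ae_forall2 => i j; have [] := H i j.
by apply: filterS => t H'; apply/radial_limitP.
Qed.

Lemma radial_limit_unique m n (F : R[i] -> 'M[R[i]]_(m, n)) t L L' :
  radial_limit F t L -> radial_limit F t L' -> L = L'.
Proof.
move=> /radial_limitP H /radial_limitP H'; apply/matrixP => i j.
exact: ccvg_unique (H i j) (H' i j).
Qed.

Lemma bdry_unique m n (F : R[i] -> 'M[R[i]]_(m, n)) t L :
  radial_limit F t L -> bdry F t = L.
Proof.
move=> H; rewrite /bdry; case: xgetP => [L' _ H'|H']; last by case: (H' L).
exact: radial_limit_unique H' H.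
Qed.

Lemma hsdotDl m n (A B C : 'M[R[i]]_(m, n)) : hsdot (A + B) C = hsdot A C + hsdot B C.
Proof. by rewrite /hsdot mulmxDl mxtraceD. Qed.

Lemma hsdotDr m n (A B C : 'M[R[i]]_(m, n)) : hsdot C (A + B) = hsdot C A + hsdot C B.
Proof. by rewrite /hsdot adjD mulmxDr mxtraceD. Qed.

Lemma hsdotZl m n c (A B : 'M[R[i]]_(m, n)) : hsdot (c *: A) B = c * hsdot A B.
Proof. by rewrite /hsdot -scalemxAl mxtraceZ. Qed.

Lemma hsdotZr m n c (A B : 'M[R[i]]_(m, n)) : hsdot A (c *: B) = (c^*)%R * hsdot A B.
Proof. by rewrite /hsdot adjZ -scalemxAr mxtraceZ. Qed.

(** The linear system obtained by expanding the squared norms of the images of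
    [x + y] and [x + i y]; here [a] and [b] stand for the two mixed inner
    products. *)
Lemma polarization_solve (F : numFieldType) (i a b a' b' u v w : F) : i * i = -1 ->
  u + a + (b + v) = u + a' + (b' + v) ->
  u + - i * a + (i * b + w) = u + - i * a' + (i * b' + w) -> a = a'.
Proof.
move=> i2 e1 e2; have {}e1 : a + b = a' + b'.
  by apply: (addrI u); apply: (addIr v); move: e1; rewrite !addrA.
have {}e2 : - i * a + i * b = - i * a' + i * b'.
  by apply: (addrI u); apply: (addIr w); move: e2; rewrite !addrA.
have e3 : i * (- i * a + i * b) = i * (- i * a' + i * b') by rewrite e2.
have e4 x y : i * (- i * x + i * y) = x - y.
  have -> : i * (- i * x + i * y) = i * i * (y - x) by ring.
  by rewrite i2; ring.
rewrite !e4 in e3.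
have e5 : 2 * a = 2 * a'.
  have -> : 2 * a = a + b + (a - b) by ring.
  by rewrite e1 e3; ring.
by apply: (mulfI _ e5); rewrite pnatr_eq0.
Qed.

(** Polarization recovers inner products from norms; so [L^* L] has the matrix
    entries of the identity, and in finite dimension a left inverse is also a
    right inverse. *)
Lemma isometry_unitary d (L : 'M[R[i]]_d) : isometrymx L ->
  L^t* *m L = 1%:M /\ L *m L^t* = 1%:M.
Proof.
move=> isoL.
have q (x : 'cV[R[i]]_d) : hsdot (L *m x) (L *m x) = hsdot x x by rewrite !hsdot_hsnorm isoL.
have pol (x y : 'cV[R[i]]_d) : hsdot (L *m x) (L *m y) = hsdot x y.
  have iJ : (('i%C : R[i])^*)%R = - 'i%C by apply: complex_eq => //=; rewrite oppr0.
  have i2 : ('i%C : R[i]) * 'i%C = -1 by rewrite -expr2 sqr_i.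
  have := q (x + y); rewrite mulmxDr !(hsdotDl, hsdotDr) !q => e1.
  have := q (x + 'i%C *: y); rewrite mulmxDr -scalemxAr.
  rewrite !(hsdotDl, hsdotDr) !(hsdotZl, hsdotZr) !q iJ => e2.
  exact: polarization_solve i2 e1 e2.
have LL : L^t* *m L = 1%:M.
  apply/matrixP => i j.
  have := pol (delta_mx j 0 : 'cV_d) (delta_mx i 0); rewrite !hsdotE.
  have colE k (l : 'I_1) (p : 'I_d) : (L *m (delta_mx p 0 : 'cV_d)) k l = L k p.
    rewrite mxE (bigD1 p) //= !mxE eqxx /= ord1 eqxx mulr1 big1 ?addr0 // => s sp.
    by rewrite mxE (negbTE sp) mulr0.
  under eq_bigr do rewrite big_ord1 !colE mulrC.
  under [RHS]eq_bigr do rewrite big_ord1 !mxE.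
  move=> e; rewrite mxE; transitivity (\sum_k ((L k i)^*)%R * L k j).
    by apply: eq_bigr => k _; rewrite adjE.
  rewrite e (bigD1 j) //= big1 ?addr0 => [|s sj]; last by rewrite (negbTE sj) mul0r.
  by rewrite !eqxx /= mul1r mxE rmorph_nat eq_sym andbT.
by split => //; exact: mulmx1C.
Qed.

Lemma normsq_sum (I : Type) (s : seq I) (u : I -> R[i]) :
  normsq (\sum_(i <- s) u i) <= 2 ^+ size s * \sum_(i <- s) normsq (u i).
Proof.
elim: s => [|i s IHs]; first by rewrite !big_nil normsq0 mulr0.
rewrite !big_cons /= exprS; apply: (le_trans (normsqD _ _)).
rewrite -mulrA -mulrDr ler_wpM2l // mulrDr lerD //.
by rewrite ler_peMl // exprn_ege1 // ler1n.
Qed.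

(** The operator norm is a supremum in the real numbers, so an explicit bound on
    the unit ball is needed before it can be compared with its members. *)
Lemma opnorm_lt1 d (A : 'M[R[i]]_d) (x : 'cV[R[i]]_d) : opnorm A < 1 -> x != 0 ->
  hsnorm (A *m x) < hsnorm x.
Proof.
move=> A1 x0.
have n0 : 0 < hsnorm x.
  by rewrite lt_neqAle hsnorm_ge0 andbT eq_sym; apply: contra x0 => /eqP/hsnorm_eq0 ->.
pose y := (hsnorm x)^-1%:C *: x.
have y1 : hsnorm y = 1 by rewrite hsnormZ ?invr_ge0 ?ltW // mulVf ?gt_eqF.
have ub : has_ubound [set hsnorm (A *m x) | x in [set x : 'cV[R[i]]_d | hsnorm x <= 1]].
  exists (Num.sqrt (\sum_(i < d) \sum_(j < 1) (2 ^+ size (index_enum 'I_d) * \sum_k normsq (A i k)))).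
  move=> _ [v /= v1 <-]; rewrite hsnormE ler_wsqrtr //.
  apply: ler_sum => i _; apply: ler_sum => j _; rewrite mxE.
  apply: (le_trans (normsq_sum _ _)); rewrite ler_wpM2l ?exprn_ge0 //.
  apply: ler_sum => k _; rewrite normsqM ler_piMr //.
  apply: (le_trans (entry_hsnorm v k j)).
  by rewrite expr_le1 // hsnorm_ge0.
have : hsnorm (A *m y) < 1.
  by apply: le_lt_trans A1; apply: ub_le_sup => //; exists y => //=; rewrite y1.
by rewrite -scalemxAr hsnormZ ?invr_ge0 ?ltW // mulrC ltr_pdivrMr // mul1r.
Qed.

(** A row vector killed by the defect operator yields [y] with
    [hsnorm (A *m y) = hsnorm y], which a strict contraction excludes unless
    [y] is zero. *)
Lemma pure_unitmx d (A : 'M[R[i]]_d) : opnorm A < 1 -> 1%:M - A *m A^t* \in unitmx.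
Proof.
move=> A1; rewrite -row_free_unit -kermx_eq0; apply: contraT => /rowV0Pn[v /sub_kermxP vK v0].
pose x := v^t*; pose y := A^t* *m x.
have xE : A *m y = x.
  have := congr1 (fun M => M^t*) vK; rewrite adjM adjD adjN adjM trmxCK.
  rewrite [X in X *m _](_ : _ = 1%:M - A *m A^t*).
    rewrite mulmxBl mul1mx trmx0 map_mx0 => /eqP; rewrite subr_eq0 => /eqP e.
    by rewrite /y mulmxA; exact: esym e.
  by congr (_ - _); rewrite trmx1 map_mx1.
have yx : hsnorm y = hsnorm x.
  suff e : hsdot y y = hsdot x x by rewrite /hsnorm e.
  by rewrite {1}/y hsdot_mull trmxCK xE.
have y0 : y != 0.
  apply: contra v0 => /eqP y0; have x0 : x = 0 by rewrite -xE y0 mulmx0.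
  by rewrite -(trmxCK v) -/x x0 trmx0 map_mx0.
by have := opnorm_lt1 A1 y0; rewrite xE yx ltxx.
Qed.

Lemma bvs_mbdd m n (f : R -> 'M[R[i]]_(m, n)) : mmeas f ->
  (forall i j, exists g, bvs g (fun t => f t i j)) -> mbdd f.
Proof.
move=> mf bf; split; first exact: mf.
have /choice[c Hc] : forall ij : 'I_m * 'I_n, exists c : R,
    circle_ae (fun t => normsq (f t ij.1 ij.2) <= c).
  by move=> [i j]; have [g bg] := bf i j; have [] := bvs_coef bg (mf i j).
exists (\sum_i \sum_j `|c (i, j)|).
have : circle_ae (fun t => forall i j, normsq (f t i j) <= c (i, j)).
  by apply: circle_ae_forall2 => i j; exact: (Hc (i, j)).
apply: filterS => t H i j; apply: (le_trans (H i j)).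
rewrite (bigD1 i) //= (bigD1 j) //= -addrA; apply: (le_trans (ler_norm _)).
by rewrite lerDl addr_ge0 ?sumr_ge0 // => k _; rewrite sumr_ge0.
Qed.

(** The function [T] represents the radial limits of [Th]. They are chosen angle
    by angle, hence need not form a measurable function; [T] is measurable, and
    agrees with them almost everywhere. The bundled properties are all that is
    used later of an inner function. *)
Definition boundary_of d (Th : R[i] -> 'M[R[i]]_d) (T : R -> 'M[R[i]]_d) :=
  [/\ mbdd T, spec_ge 0 T & circle_ae (fun t => bdry Th t = T t)] /\
  [/\ circle_ae (fun t => (T t)^t* *m T t = 1%:M /\ T t *m (T t)^t* = 1%:M),
    forall i j, bvs (fun z => Th z i j) (fun t => T t i j)
    & forall i j, coef (fun t => T t i j) 0 = Th 0 i j].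

(** The limit along the radii [1 - 1 / (n + 1)] is a limit of a sequence of
    measurable functions; it equals the radial limit wherever the latter
    exists. *)
Lemma inner_boundary d (Th : R[i] -> 'M[R[i]]_d) : inner_function Th ->
  exists T, boundary_of Th T.
Proof.
move=> [HTh aeL].
have /HinfP hol_ij := HTh.
have /choice[T HT] : forall ij : 'I_d * 'I_d, exists b : R -> R[i], cmeas b /\
    circle_ae (fun t => ccvg \oo (fun n => Th ((rad n)%:C * expi t) ij.1 ij.2) (b t)).
  move=> [i j] /=; have [[a ag] _] := hol_ij i j.
  have mu_ n := circle_cmeas (rad01 n) ag.
  have cv : circle_ae (fun t => exists l, ccvg \oo (fun n => Th ((rad n)%:C * expi t) i j) l).
    apply: filterS aeL => t [L /radial_limitP/(_ i j)/ccvg_rad H _].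
    by exists (L i j).
  have cvr : circle_ae (fun t => exists l : R,
      Re (Th ((rad n)%:C * expi t) i j) @[n --> \oo] --> l).
    by apply: filterS cv => t [l [cr _]]; exists (Re l).
  have cvi : circle_ae (fun t => exists l : R,
      Im (Th ((rad n)%:C * expi t) i j) @[n --> \oo] --> l).
    by apply: filterS cv => t [l [_ ci]]; exists (Im l).
  have [lr mlr cr] := @ae_cvg_measurable R (fun n t => Re (Th ((rad n)%:C * expi t) i j))
    (fun n => (mu_ n).1) cvr.
  have [li mli ci] := @ae_cvg_measurable R (fun n t => Im (Th ((rad n)%:C * expi t) i j))
    (fun n => (mu_ n).2) cvi.
  exists (fun t => lr t +i* li t); split; first by split.
  by apply: filterS2 cr ci.
pose TT t : 'M[R[i]]_d := \matrix_(i, j) T (i, j) t.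
have lim : circle_ae (fun t => radial_limit Th t (TT t) /\ isometrymx (TT t)).
  have : circle_ae (fun t => forall i j,
      ccvg \oo (fun n => Th ((rad n)%:C * expi t) i j) (T (i, j) t)).
    by apply: circle_ae_forall2 => i j; have [] := HT (i, j).
  apply: filterS2 aeL => t [L lL iL] cT.
  suff -> : TT t = L by [].
  apply/matrixP => i j; rewrite mxE; apply: (ccvg_unique (cT i j)).
  by have /radial_limitP/(_ i j)/ccvg_rad := lL.
have TE i j : (fun t => TT t i j) = T (i, j) by apply/funext => t; rewrite mxE.
have bT : forall i j, bvs (fun z => Th z i j) (fun t => TT t i j).
  by apply/bv_bvs; split => //; apply: filterS lim => t [].
have mT i j : cmeas (fun t => TT t i j) by rewrite TE; have [] := HT (i, j).
exists TT; split; split => //.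
- by apply: bvs_mbdd => // i j; exists (fun z => Th z i j).
- by move=> i j; have [sT _ T0 _] := bvs_coef (bT i j) (mT i j).
- by apply: filterS lim => t [/bdry_unique].
- by apply: filterS lim => t [_ /isometry_unitary].
- by move=> i j; have [] := bvs_coef (bT i j) (mT i j).
Qed.

End MatrixBoundary.

(** * Model spaces on the circle *)

Section ModelSpaces.
Context {R : realType} {d : nat}.

Implicit Types (Th : R[i] -> 'M[R[i]]_d) (T : R -> 'M[R[i]]_d).

(** The model space of the inner function with boundary function [T], described
    by spectra (see [model_spaceP]). Several columns are allowed, so that the
    test functions below can be matrices. *)
Definition inK n T (f : R -> 'M[R[i]]_(d, n)) :=
  spec_ge 0 f /\ spec_le (-1) (fun t => (T t)^t* *m f t).

(** Orthogonality to the model space: the complement of [K] in [L^2] is the sum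
    of [T H^2] and the functions with negative spectrum (see [perpK_orth] and
    [orth_perpK]). *)
Definition perpK n T (g : R -> 'M[R[i]]_(d, n)) :=
  exists2 h, spec_ge 0 h & spec_le (-1) (fun t => g t - T t *m h t).

Lemma L2dot_mull n T (f g : R -> 'M[R[i]]_(d, n)) :
  L2dot (fun t => T t *m f t) g = L2dot f (fun t => (T t)^t* *m g t).
Proof. by apply: eq_mean => t _; exact: hsdot_mull. Qed.

(** Fourier coefficients are inner products with functions that may be tested
    against in the definition of the model space. *)
Lemma L2dot_shift_delta (g : R -> 'cV[R[i]]_d) (k : int) (i : 'I_d) : mL2 g ->
  L2dot g (fun t => ek k t *: delta_mx i 0) = coef (fun t => g t i 0) k.
Proof.
move=> sg; rewrite /L2dot coefE; apply: eq_mean => t _.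
rewrite hsdotE (bigD1 i) //= big_ord1 !mxE eqxx /= mulr1 big1 ?addr0 //.
by move=> j ji; rewrite big_ord1 !mxE (negbTE ji) mulr0 rmorph0 mulr0.
Qed.

Lemma spec_le_eq m n k (f g : R -> 'M[R[i]]_(m, n)) :
  (forall t, f t = g t) -> spec_le k f -> spec_le k g.
Proof. by move=> /funext ->. Qed.

Lemma spec_ge_eq m n k (f g : R -> 'M[R[i]]_(m, n)) :
  (forall t, f t = g t) -> spec_ge k f -> spec_ge k g.
Proof. by move=> /funext ->. Qed.

Section OneInner.
Context {Th : R[i] -> 'M[R[i]]_d} {T : R -> 'M[R[i]]_d} (bT : boundary_of Th T).

Lemma T_bdd : mbdd T. Proof. by have [[]] := bT. Qed.
Lemma T_ge : spec_ge 0 T. Proof. by have [[]] := bT. Qed.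
Lemma Tadj_bdd : mbdd (fun t => (T t)^t*). Proof. exact: mbdd_adj T_bdd. Qed.
Lemma T_ge_mul n (h : R -> 'M[R[i]]_(d, n)) :
  spec_ge 0 h -> spec_ge 0 (fun t => T t *m h t).
Proof.
move=> gh; rewrite -[0]addr0; apply: ge_mul => //; first exact: T_ge.
by apply: mL2_mull; [exact: T_bdd|exact: ge_L2 gh].
Qed.

Lemma T_bdry n (h : R -> 'M[R[i]]_(d, n)) :
  circle_ae (fun t => bdry Th t *m h t = T t *m h t).
Proof. by have [[_ _ e] _] := bT; apply: filterS e => t ->. Qed.

Lemma TadjT n (h : R -> 'M[R[i]]_(d, n)) :
  circle_ae (fun t => (T t)^t* *m (T t *m h t) = h t).
Proof. by have [_ [u _ _]] := bT; apply: filterS u => t [u _]; rewrite mulmxA u mul1mx. Qed.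

Lemma T_defect : spec_ge 1 (fun t => T t - Th 0).
Proof.
move=> i j; have [sT T0] := T_ge i j; have [_ [_ _ TTh]] := bT.
have e : (fun t => (T t - Th 0) i j) = fun t => T t i j - Th 0 i j.
  by apply/funext => t; rewrite !mxE.
rewrite e; split; first by apply: sL2B => //; exact: sL2_cst.
move=> l l1; rewrite coefB ?coef_cst //; last exact: sL2_cst.
have [l0|l0] := ltP l 0; first by rewrite T0 // lt_eqF // mulr0 subrr.
have -> : l = 0 by move: l0 l1; lia.
by rewrite TTh eqxx mulr1 subrr.
Qed.

Lemma inKB n (f g : R -> 'M[R[i]]_(d, n)) : inK T f -> inK T g ->
  inK T (fun t => f t - g t).
Proof.
move=> [gf lf] [gg lg]; split; first exact: geB.
by have := leB lf lg; congr spec_le; apply/funext => t; rewrite mulmxBr.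
Qed.

Lemma model_spaceP (f : R -> 'cV[R[i]]_d) : model_space Th f <-> inK T f.
Proof.
have dotE h : mL2 h -> mL2 f -> L2dot f (fun t => bdry Th t *m h t) =
    L2dot (fun t => (T t)^t* *m f t) h.
  move=> sh sf; rewrite (@L2dot_ae _ _ _ f f _ (fun t => T t *m h t)).
  - by apply: eq_mean => t _; rewrite hsdot_mull trmxCK.
  - exact: nearW.
  - exact: T_bdry.
split=> [[Hf orth]|[gf lf]].
  have gf := (H2P f).1 Hf; have sf := ge_L2 gf.
  have sTf : mL2 (fun t => (T t)^t* *m f t) by apply: mL2_mull; [exact: Tadj_bdd|].
  split => //; apply/spec_leP => i j; split; first exact: sTf.
  move=> l l1; rewrite (ord1 j) -L2dot_shift_delta // -dotE //.
    apply: orth; apply/H2P; apply: (@ge_weak _ _ _ (0 + l)); first by move: l1; lia.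
    by apply: ge_shift; exact: ge_cst.
  by apply: ge_L2; apply: ge_shift; exact: ge_cst.
split; first exact/H2P.
move=> h /H2P gh; rewrite dotE; [|exact: ge_L2 gh|exact: ge_L2 gf].
exact: L2dot_orth.
Qed.

(** Project [g] to its analytic part [gp], then remove from [gp] the product of
    [T] with the analytic part of [T^* gp]; what is left of [T^* gp] has
    negative spectrum, and this is membership in the model space. *)
Lemma decomposition n (g : R -> 'M[R[i]]_(d, n)) : mL2 g ->
  exists k h, [/\ inK T k, spec_ge 0 h & spec_le (-1) (fun t => g t - (k t + T t *m h t))].
Proof.
move=> sg; have [gp ggp lgp] := riesz_proj_mx sg.
have sTg : mL2 (fun t => (T t)^t* *m gp t).
  by apply: mL2_mull; [exact: Tadj_bdd|exact: ge_L2 ggp].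
have [h gh lh] := riesz_proj_mx sTg.
have gk : spec_ge 0 (fun t => gp t - T t *m h t) by apply: geB => //; exact: T_ge_mul.
exists (fun t => gp t - T t *m h t), h.
split; [|exact: gh|by apply: spec_le_eq lgp => t; rewrite subrK].
split; first exact: gk.
apply: le_ae lh.
  by apply: mL2_meas; apply: mL2_mull; [exact: Tadj_bdd|exact: ge_L2 gk].
by apply: filterS (TadjT h) => t e; rewrite mulmxBr e.
Qed.

Lemma perpK_orth n (g k : R -> 'M[R[i]]_(d, n)) : perpK T g -> inK T k -> L2dot g k = 0.
Proof.
move=> [h gh lh] [gk lk].
have sTh := ge_L2 (T_ge_mul gh); have sk := ge_L2 gk.
have -> : g = fun t => (g t - T t *m h t) + T t *m h t.
  by apply/funext => t; rewrite subrK.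
rewrite L2dotDl //; last exact: le_L2 lh.
rewrite L2dot_orth // add0r L2dot_mull L2dotC; [|exact: le_L2 lk|exact: ge_L2 gh].
by rewrite L2dot_orth // conjC0.
Qed.

Lemma orth_perpK n (g : R -> 'M[R[i]]_(d, n)) : mL2 g ->
  (forall k, inK T k -> L2dot g k = 0) -> perpK T g.
Proof.
move=> sg orth; have [k [h [Kk gh lg]]] := decomposition sg.
have sTh := ge_L2 (T_ge_mul gh); have sk : mL2 k := ge_L2 Kk.1.
have sR := le_L2 lg.
have Pk : perpK T (fun t => g t - k t).
  exists h; first exact: gh.
  by apply: spec_le_eq lg => t; rewrite opprD addrA.
have k0 : circle_ae (fun t => k t = 0).
  apply: L2dot_eq0 => //; have := perpK_orth Pk Kk.
  by rewrite L2dotBl // orth // sub0r => /eqP; rewrite oppr_eq0 => /eqP.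
exists h; first exact: gh.
apply: le_ae lg.
  by apply: mL2_meas; exact: mL2B.
by apply: filterS k0 => t ->; rewrite add0r.
Qed.

Lemma perpK_columns n (g : R -> 'M[R[i]]_(d, n)) :
  (forall j, perpK T (fun t => col j (g t))) -> perpK T g.
Proof.
move=> /(_ _) Hj.
have /choice[h Hh] : forall j, exists h : R -> 'cV[R[i]]_d, spec_ge 0 h /\
    spec_le (-1) (fun t => col j (g t) - T t *m h t).
  by move=> j; have [h gh lh] := Hj j; exists h.
exists (fun t => \matrix_(i, j) h j t i 0).
  by move=> i j; have [gh _] := Hh j; under eq_fun do rewrite mxE; exact: gh i 0.
apply/spec_leP => i j; have [_ lh] := Hh j; have /spec_leP/(_ i 0) := lh.
have -> : (fun t => (g t - T t *m (\matrix_(k, l) h l t k 0)) i j) =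
    (fun t => (col j (g t) - T t *m h j t) i 0); last by [].
apply/funext => t; rewrite mxE [RHS]mxE; congr (_ + _); first by rewrite mxE.
rewrite mxE [RHS]mxE; congr (- _); rewrite mxE [RHS]mxE.
by apply: eq_bigr => k _; congr (_ * _); rewrite mxE.
Qed.

(** The projection is specified by a choice; the decomposition shows that there is
    something to choose. *)
Lemma orth_proj_spec (g : R -> 'cV[R[i]]_d) : mL2 g ->
  inK T (orth_proj (model_space Th) g) /\
  forall k, inK T k -> L2dot (fun t => g t - orth_proj (model_space Th) g t) k = 0.
Proof.
move=> sg; rewrite /orth_proj; case: xgetP => [p _ [/model_spaceP Kp Hp]|none].
  by split => // k /model_spaceP; exact: Hp.
exfalso; have [k [h [Kk gh lg]]] := decomposition sg.
case: (none k); split; first exact/model_spaceP.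
move=> k' /model_spaceP Kk'; apply: perpK_orth Kk'; exists h; first exact: gh.
by apply: spec_le_eq lg => t; rewrite opprD addrA.
Qed.

Lemma orth_proj_eq0 (g : R -> 'cV[R[i]]_d) : mL2 g ->
  circle_ae (fun t => orth_proj (model_space Th) g t = 0) <-> perpK T g.
Proof.
move=> sg; have [Kp Hp] := orth_proj_spec sg.
set p := orth_proj _ _ in Kp Hp *.
have sp : mL2 p := ge_L2 Kp.1.
split=> [p0|Pg].
  apply: (orth_perpK sg) => k Kk; apply: etrans (Hp k Kk).
  apply: L2dot_ae; last exact: nearW.
  by apply: filterS p0 => t ->; rewrite subr0.
apply: L2dot_eq0 => //; have := Hp p Kp; rewrite L2dotBl // (perpK_orth Pg Kp).
by rewrite sub0r => /eqP; rewrite oppr_eq0 => /eqP.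
Qed.

Lemma orth_proj_unique (g p : R -> 'cV[R[i]]_d) : mL2 g -> inK T p ->
  (forall k, inK T k -> L2dot (fun t => g t - p t) k = 0) ->
  circle_ae (fun t => orth_proj (model_space Th) g t = p t).
Proof.
move=> sg Kp Hp; have [Kq Hq] := orth_proj_spec sg.
set q := orth_proj _ _ in Kq Hq *.
have sp : mL2 p := ge_L2 Kp.1; have sq : mL2 q := ge_L2 Kq.1.
have Kpq := inKB Kp Kq; have spq := mL2B sp sq.
have : circle_ae (fun t => p t - q t = 0).
  apply: L2dot_eq0 => //; rewrite -[RHS](subrr (0 : R[i])) -{1}(Hq _ Kpq) -(Hp _ Kpq).
  rewrite -L2dotBl; [|exact: mL2B|exact: mL2B|by []].
  apply: eq_mean => t _; congr hsdot.
  by rewrite opprB [RHS]addrC addrA subrK.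
by apply: filterS => t /eqP; rewrite subr_eq0 => /eqP.
Qed.

(** The bounded extension of an element of the model space may be given one
    coordinate at a time. *)
Lemma model_space_infP (f : R -> 'cV[R[i]]_d) : model_space_inf Th f <->
  inK T f /\ forall i, exists g, bvs g (fun t => f t i 0).
Proof.
split=> [[/model_spaceP Kf [F HF lF]]|[Kf /choice[g bg]]].
  split => // i; exists (fun z => F z i 0).
  by have /bv_bvs := conj HF lF.
split; first exact/model_spaceP.
have /bv_bvs[HF lF] : forall i j, bvs (fun z => (\col_i g i z : 'cV[R[i]]_d) i j)
    (fun t => f t i j).
  by move=> i j; rewrite (ord1 j); under eq_fun do rewrite mxE.
by exists (fun z => \col_i g i z).
Qed.

End OneInner.
End ModelSpaces.

(** * Test functions and purity *)

Section Symbol.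
Context {R : realType} {d : nat}.

Section TestFunctions.
Context {Th : R[i] -> 'M[R[i]]_d} {T : R -> 'M[R[i]]_d} (bT : boundary_of Th T).

Definition has_extension n (f : R -> 'M[R[i]]_(d, n)) :=
  forall i j, exists g, bvs g (fun t => f t i j).

(** The Taylor coefficients of the inner function. *)
Definition That (s : nat) : 'M[R[i]]_d := \matrix_(i, j) coef (fun t => T t i j) s.

(** The analytic part of [z ^ n T^*] (see [kpoly_le]). *)
Definition kpoly n (t : R) : 'M[R[i]]_d :=
  \sum_(s < n.+1) ek (Posz (n - s)) t *: (That s)^t*.

(** The projection onto the model space of [z ^ n] times the identity: the part
    that is removed is [T] times the analytic part of [z ^ n T^*]. *)
Definition kfun n (t : R) : 'M[R[i]]_d := ek (Posz n) t *: 1%:M - T t *m kpoly n t.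

(** The difference quotient at the origin. It is in the model space because
    [T^* qfun] is [z ^ -1] times the antianalytic function [1 - T^* Th(0)]. *)
Definition qfun (t : R) : 'M[R[i]]_d := ek (-1) t *: (T t - Th 0).

Lemma mbdd_sum m n (I : Type) (s : seq I) (F : I -> R -> 'M[R[i]]_(m, n)) :
  (forall i, mbdd (F i)) -> mbdd (fun t => \sum_(i <- s) F i t).
Proof.
move=> bF; elim: s => [|i s IHs].
  by under eq_fun do rewrite big_nil; exact: mbdd_cst.
by under eq_fun do rewrite big_cons; exact: mbddD.
Qed.

Lemma ge_sum m n k (I : Type) (s : seq I) (F : I -> R -> 'M[R[i]]_(m, n)) :
  (forall i, spec_ge k (F i)) -> k <= 0 -> spec_ge k (fun t => \sum_(i <- s) F i t).
Proof.
move=> gF k0; elim: s => [|i s IHs].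
  by under eq_fun do rewrite big_nil; apply: ge_weak k0 _; exact: ge_cst.
by under eq_fun do rewrite big_cons; exact: geD.
Qed.

Lemma kpoly_bdd n : mbdd (kpoly n).
Proof. by apply: mbdd_sum => s; apply: mbdd_shift; exact: mbdd_cst. Qed.

Lemma kpoly_ge n : spec_ge 0 (kpoly n).
Proof.
apply: ge_sum => // s; apply: (@ge_weak _ _ _ (0 + Posz (n - s))); first by rewrite add0r.
by apply: ge_shift; exact: ge_cst.
Qed.

(** Only the summand with [s = n - l] contributes. For [l > n] there is none, and
    the right-hand side vanishes because [T] is analytic. *)
Lemma kpoly_coef n i j (l : int) : 0 <= l ->
  coef (fun t => kpoly n t i j) l = ((coef (fun t => T t j i) (Posz n - l))^*)%R.
Proof.
move=> l0; have [_ T0] := T_ge bT j i.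
rewrite (_ : (fun t => _) = fun t => \sum_(s < n.+1) ((That s j i)^*)%R * ek (Posz (n - s)) t); last first.
  apply/funext => t; rewrite /kpoly summxE; apply: eq_bigr => s _.
  by rewrite mxE adjE mulrC.
rewrite coef_sum; last by move=> s; apply: sL2Z; exact: sL2_ek.
rewrite (eq_bigr (fun s : 'I_n.+1 => ((That s j i)^*)%R * (Posz (n - s) == l)%:R)); last first.
  by move=> s _; rewrite coefZ ?coef_ek //; exact: sL2_ek.
case: l l0 => // l _; have [ln|nl] := leqP l n.
  have sn : (n - l < n.+1)%N by rewrite ltnS leq_subr.
  rewrite (bigD1 (Ordinal sn)) //= subKn // eqxx mulr1 big1 ?addr0.
    by rewrite mxE -subzn.
  move=> s /eqP ne; rewrite eqz_nat; case: eqP => [e|_]; last by rewrite mulr0.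
  exfalso; apply: ne; apply/val_inj => /=; rewrite -e subKn //.
  by rewrite -ltnS.
rewrite T0 ?conjC0; last by lia.
rewrite big1 // => s _; rewrite eqz_nat; case: eqP => [e|_]; last by rewrite mulr0.
by exfalso; move: nl; rewrite -e; lia.
Qed.

Lemma kpoly_le n : spec_le (-1) (fun t => ek (Posz n) t *: (T t)^t* - kpoly n t).
Proof.
apply/spec_leP => i j.
have e : (fun t => (ek (Posz n) t *: (T t)^t* - kpoly n t) i j) =
    fun t => ek (Posz n) t * ((T t j i)^*)%R - kpoly n t i j.
  by apply/funext => t; rewrite !mxE.
have sT : sL2 (fun t => T t j i) := (T_ge bT j i).1.
have sk : sL2 (fun t => kpoly n t i j) := (kpoly_ge n i j).1.
have se : sL2 (fun t => ek (Posz n) t * ((T t j i)^*)%R).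
  apply: (@sL2M_bdd _ _ _ 1); [exact: cmeas_ek| |exact: sL2J].
  by apply: nearW => t _; rewrite normsq_ek.
rewrite e; split; first exact: sL2B.
move=> l l1; rewrite coefB // kpoly_coef; last by move: l1; lia.
under eq_fun do rewrite mulrC.
by rewrite coef_shift coefJ // opprB subrr.
Qed.

Lemma kfun_inK n : inK T (kfun n).
Proof.
have g1 : spec_ge 0 (fun t : R => ek (Posz n) t *: (1%:M : 'M[R[i]]_d)).
  apply: (@ge_weak _ _ _ (0 + Posz n)); first by rewrite add0r.
  by apply: ge_shift; exact: ge_cst.
have gk : spec_ge 0 (kfun n).
  by apply: geB; [exact: g1|apply: (T_ge_mul bT); exact: kpoly_ge].
split; first exact: gk.
apply: le_ae (kpoly_le n).
  by apply: mL2_meas; apply: mL2_mull; [exact: (Tadj_bdd bT)|exact: ge_L2 gk].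
apply: filterS (TadjT bT (kpoly n)) => t e.
by rewrite /kfun mulmxBr e -scalemxAr mulmx1.
Qed.

Lemma kfun_ext n : has_extension (kfun n).
Proof.
have [_ [_ bE _]] := bT.
move=> i j.
have B1 := bvs_mulXn n (bvs_cst ((1%:M : 'M[R[i]]_d) i j)).
have B2 := bvs_sum (index_enum 'I_d) (fun k => bvs_sum (index_enum 'I_n.+1) (fun s =>
  bvsZ ((That s)^t* k j) (bvs_mulXn (n - s) (bE i k)))).
have B := bvsB B1 B2; eexists; move: B; congr bvs; apply/funext => t.
rewrite /kfun [RHS]mxE; congr (_ + _); first by rewrite [RHS]mxE.
rewrite [RHS]mxE; congr (- _); rewrite [RHS]mxE; apply: eq_bigr => k _.
rewrite /kpoly summxE mulr_sumr; apply: eq_bigr => s _.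
by rewrite !mxE; ring.
Qed.

Lemma qfun_inK : inK T qfun.
Proof.
have gq : spec_ge 0 qfun.
  have -> : (0 : int) = 1 + (-1) by [].
  by apply: ge_shift; exact: (T_defect bT).
split; first exact: gq.
have lq : spec_le (-1) (fun t => ek (-1) t *: (1%:M - (T t)^t* *m Th 0)).
  have -> : (-1 : int) = 0 + (-1) by [].
  apply: le_shift; apply: leB; first exact: le_cst.
  by apply: le_mulC; rewrite -oppr0; apply: ge_adj; exact: (T_ge bT).
apply: le_ae lq.
  by apply: mL2_meas; apply: mL2_mull; [exact: (Tadj_bdd bT)|exact: ge_L2 gq].
have := TadjT bT (fun=> 1%:M : 'M[R[i]]_d).
apply: filterS => t; rewrite mulmx1 => e.
by rewrite /qfun -scalemxAr mulmxBr e.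
Qed.

Lemma qfun_ext : has_extension qfun.
Proof.
have [_ [_ bE _]] := bT.
move=> i j; have [g bg _] := bvs_quot (bE i j); exists g; move: bg.
by congr bvs; apply/funext => t; rewrite /qfun !mxE.
Qed.

End TestFunctions.

Section Purity.
Context {Th2 : R[i] -> 'M[R[i]]_d} {T2 : R -> 'M[R[i]]_d} (b2 : boundary_of Th2 T2).
Let A2 := Th2 0.
Hypothesis u2 : 1%:M - A2 *m A2^t* \in unitmx.

(** Let [A2 = Th2 0], [D = c - A2 A2^* c]. From [c = T2 V], that is
    [V = T2^* c], follows [(T2 - A2) V = D - A2 (T2 - A2)^* c]. The spectrum
    of the left-hand side lies in [1, +oo), that of the right-hand side in
    (-oo, 0], so both vanish. Then [D = A2 (T2 - A2)^* c] has its spectrum in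
    (-oo, -1], and the constant [D] is zero; purity makes [1 - A2 A2^*]
    invertible. *)
Lemma const_in_TH2 (c : 'M[R[i]]_d) (V : R -> 'M[R[i]]_d) : spec_ge 0 V ->
  circle_ae (fun t => c = T2 t *m V t) -> c = 0.
Proof.
move=> gV cV.
pose D := c - A2 *m A2^t* *m c.
have lT : spec_le (-1) (fun t => (T2 t)^t* - A2^t*).
  have := ge_adj (T_defect b2); apply: spec_le_eq => t.
  by rewrite adjD adjN.
have lB : spec_le (-1) (fun t => A2 *m ((T2 t)^t* - A2^t*) *m c).
  apply: le_mulC; have -> : (-1 : int) = 0 + (-1) by [].
  apply: le_mul; [exact: le_cst|exact: lT|].
  by apply: mL2_mull; [exact: mbdd_cst|exact: le_L2 lT].
have bD2 : mbdd (fun t => T2 t - A2).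
  by apply: mbddD; [exact: (T_bdd b2)|exact: mbdd_cst].
have gC : spec_ge 1 (fun t => (T2 t - A2) *m V t).
  have -> : (1 : int) = 1 + 0 by [].
  apply: ge_mul; [exact: (T_defect b2)|exact: gV|].
  by apply: mL2_mull; [exact: bD2|exact: ge_L2 gV].
have e1 : circle_ae (fun t => (T2 t - A2) *m V t = D - A2 *m ((T2 t)^t* - A2^t*) *m c).
  apply: filterS2 cV (TadjT b2 V) => t e eV.
  have {}eV : (T2 t)^t* *m c = V t by rewrite {1}e eV.
  by rewrite mulmxBl -e -eV /D mulmxBr mulmxBl !mulmxA opprB addrA subrK.
have lE : spec_le 0 (fun t => D - A2 *m ((T2 t)^t* - A2^t*) *m c).
  by apply: leB; [exact: le_cst|apply: le_weak lB].
have gE : spec_ge 1 (fun t => D - A2 *m ((T2 t)^t* - A2^t*) *m c).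
  by apply: ge_ae e1 gC; apply: mL2_meas; exact: le_L2 lE.
have E0 := ge_le_eq0 ltr01 gE lE.
have lD : spec_le (-1) (fun=> D).
  apply: le_ae lB; first by move=> i j; exact: cmeas_cst.
  by apply: filterS E0 => t /eqP; rewrite subr_eq0 => /eqP.
have D0 : D = 0.
  apply/matrixP => i j; have /spec_leP lD' := lD; rewrite [RHS]mxE.
  by have := (lD' i j).2 0 isT; rewrite coef_cst eqxx mulr1.
have : (1%:M - A2 *m A2^t*) *m c = 0 by rewrite mulmxBl mul1mx.
by move=> /(congr1 (mulmx (invmx (1%:M - A2 *m A2^t*)))); rewrite mulKmx // mulmx0.
Qed.

End Purity.
End Symbol.

(** * The symbol of the zero operator *)

Arguments kfun {R d} T n t.
Arguments qfun {R d} Th T t.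

Section SymbolSplit.
Context {R : realType} {d : nat}.
Context {Th1 Th2 : R[i] -> 'M[R[i]]_d} {T1 T2 : R -> 'M[R[i]]_d}.
Hypothesis (b1 : boundary_of Th1 T1) (b2 : boundary_of Th2 T2).
Let A1 := Th1 0.
Let A2 := Th2 0.
Hypothesis (u1 : 1%:M - A1 *m A1^t* \in unitmx) (u2 : 1%:M - A2 *m A2^t* \in unitmx).

Lemma ge_shift0 m n k j (f : R -> 'M[R[i]]_(m, n)) (l : int) : spec_ge k f -> l = k + j ->
  spec_ge l (fun t => ek j t *: f t).
Proof. by move=> gf ->; exact: ge_shift. Qed.

Lemma le_shift0 m n k j (f : R -> 'M[R[i]]_(m, n)) (l : int) : spec_le k f -> l = k + j ->
  spec_le l (fun t => ek j t *: f t).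
Proof. by move=> gf ->; exact: le_shift. Qed.

Lemma sub_rearrange (V : zmodType) (a b x y : V) : a + x + y - b - x = a - (b - y).
Proof.
have -> : a + x + y = a + y + x by rewrite addrAC.
by rewrite [LHS]addrAC addrK opprB addrA.
Qed.

Lemma ext_bdd (f : R -> 'M[R[i]]_d) : inK T1 f -> has_extension f -> mbdd f.
Proof. by move=> [gf _] ef; apply: bvs_mbdd ef; apply: mL2_meas; exact: ge_L2 gf. Qed.

(** With [S] for the value of the boundary function and [X] for that of the
    difference quotient, [1 - S A^* + z X A^* = 1 - A A^*]. *)
Lemma kernel_recombine (P S A B B' : 'M[R[i]]_d) (z : R[i]) (M := 1%:M - A *m A^t*) :
  M \in unitmx -> forall X, z *: X = S - A ->
  (P *m (1%:M - S *m A^t*) - B + z *: ((P *m X - B') *m A^t*)) *m invmx M =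
  P - (B + z *: (B' *m A^t*)) *m invmx M.
Proof.
move=> uM X zX.
have e1 : z *: ((P *m X - B') *m A^t*) = P *m (S *m A^t* - A *m A^t*) - z *: (B' *m A^t*).
  rewrite mulmxBl scalerBr; congr (_ - _).
  by rewrite scalemxAl scalemxAr zX -mulmxA mulmxBl.
have e2 : 1%:M - S *m A^t* + (S *m A^t* - A *m A^t*) = M by rewrite addrA subrK.
rewrite e1 addrACA -mulmxDr e2 -opprD mulmxBl.
by rewrite -[P *m M *m _]mulmxA mulmxV // mulmx1.
Qed.

(** The combination [kfun 0 + z qfun A1^*], with [A1 = Th1 0], is the constant
    [1 - A1 A1^*], which purity makes invertible. Multiplication by [z] raises
    spectra by one only, so the symbol lies in [T2 H^2] up to a function with
    spectrum in (-oo, 0]. *)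
Lemma antianalytic_part (Phi : R -> 'M[R[i]]_d) : mL2 Phi ->
  perpK T2 (fun t => Phi t *m kfun T1 0 t) ->
  perpK T2 (fun t => Phi t *m qfun Th1 T1 t) ->
  exists2 Q, spec_ge 0 Q & spec_le 0 (fun t => Phi t - T2 t *m Q t).
Proof.
move=> sPhi [B gB lB] [B' gB' lB'].
pose U := invmx (1%:M - A1 *m A1^t*).
have gQ : spec_ge 0 (fun t => (B t + ek 1 t *: (B' t *m A1^t*)) *m U).
  apply: ge_mulC; apply: geD; first exact: gB.
  by apply: (@ge_weak _ _ _ 1) => //; apply: (@ge_shift0 _ _ 0) => //; exact: ge_mulC.
exists (fun t => (B t + ek 1 t *: (B' t *m A1^t*)) *m U); first exact: gQ.
have l1 : spec_le 0 (fun t => ek 1 t *: ((Phi t *m qfun Th1 T1 t - T2 t *m B' t) *m A1^t*)).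
  by apply: (@le_shift0 _ _ (-1)) => //; exact: le_mulC.
have l0 : spec_le 0 (fun t => Phi t *m kfun T1 0 t - T2 t *m B t).
  by apply: le_weak lB.
apply: spec_le_eq (le_mulC U (leD l0 l1)) => t.
have k0 : kfun T1 0 t = 1%:M - T1 t *m A1^t*.
  rewrite /kfun /kpoly ek0 scale1r big_ord1 scale1r; congr (_ - _ *m _ ^t*).
  by have [_ [_ _ TTh]] := b1; apply/matrixP => i j; rewrite mxE TTh.
have q0 : ek 1 t *: qfun Th1 T1 t = T1 t - A1.
  by rewrite /qfun scalerA -ekD ek0 scale1r.
rewrite k0 (kernel_recombine _ _ _ u1 q0); congr (_ - _).
by rewrite [RHS]mulmxA mulmxDr -scalemxAr mulmxA.
Qed.

Lemma le_sub_mean m n (f : R -> 'M[R[i]]_(m, n)) : spec_le 0 f ->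
  spec_le (-1) (fun t => f t - \matrix_(i, j) coef (fun t => f t i j) 0).
Proof.
move=> /spec_leP lf; apply/spec_leP => i j; have [sf f0] := lf i j.
set c := \matrix_(_, _) _.
have e : (fun t => (f t - c) i j) = fun t => f t i j - c i j.
  by apply/funext => t; rewrite !mxE.
rewrite e; split; first by apply: sL2B => //; exact: sL2_cst.
move=> l l1; rewrite coefB ?coef_cst //; last exact: sL2_cst.
have [l0|l0] := ltP 0 l; first by rewrite f0 // gt_eqF // mulr0 subrr.
have -> : l = 0 by move: l0 l1; lia.
by rewrite eqxx mulr1 mxE subrr.
Qed.

Lemma adjmul_recombine (C S1 S2 W K B : 'M[R[i]]_d) (z w x : R[i]) : w * z = 1 ->
  z *: (C *m S1) = S2 *m W ->
  C *m (x *: 1%:M - S1 *m K) - S2 *m B = x *: C - S2 *m (B + w *: (W *m K)).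
Proof.
move=> wz e; have {}e : C *m S1 = w *: (S2 *m W) by rewrite -e scalerA wz scale1r.
have e1 : C *m (x *: 1%:M - S1 *m K) = x *: C - w *: (S2 *m W *m K).
  by rewrite mulmxBr -scalemxAr mulmx1 [C *m (_ *m _)]mulmxA e -scalemxAl.
have e2 : S2 *m (w *: (W *m K)) = w *: (S2 *m W *m K) by rewrite -scalemxAr mulmxA.
by rewrite e1 mulmxDr e2 opprD addrA addrAC.
Qed.

(** Starting from [antianalytic_part], the adjoint of the antianalytic rest is
    split as [chi + T1 P] with [T1^* chi] of negative spectrum, and it remains
    to see that [chi] vanishes. This is proved coefficient by coefficient:
    if [chi] starts at index [n], then [z ^ n chi^*] is a constant plus a
    function with negative spectrum; the test functions put that constant into
    [T2 H^2], where [const_in_TH2] kills it. *)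
Lemma symbol_split (Phi : R -> 'M[R[i]]_d) : mL2 Phi ->
  (forall f : R -> 'M[R[i]]_d, inK T1 f -> has_extension f -> perpK T2 (fun t => Phi t *m f t)) ->
  exists P Q, [/\ spec_ge 0 P, spec_ge 0 Q &
    circle_ae (fun t => Phi t = (T1 t *m P t)^t* + T2 t *m Q t)].
Proof.
move=> sPhi perp.
have bk n := ext_bdd (kfun_inK b1 n) (kfun_ext b1 n).
have bq := ext_bdd (qfun_inK b1) (qfun_ext b1).
have [Q gQ lPs] := antianalytic_part sPhi (perp _ (kfun_inK b1 0) (kfun_ext b1 0))
  (perp _ (qfun_inK b1) (qfun_ext b1)).
pose P0 t := (Phi t - T2 t *m Q t)^t*.
have gP0 : spec_ge 0 P0 by have := lPs; rewrite /spec_le oppr0.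
have sT1P0 : mL2 (fun t => (T1 t)^t* *m P0 t).
  by apply: mL2_mull; [exact: (Tadj_bdd b1)|exact: ge_L2 gP0].
have [P gP lP] := riesz_proj_mx sT1P0.
pose chi t := P0 t - T1 t *m P t.
have gchi : spec_ge 0 chi by apply: geB; [exact: gP0|exact: (T_ge_mul b1)].
have lchi : spec_le (-1) (fun t => (T1 t)^t* *m chi t).
  apply: le_ae lP.
    by apply: mL2_meas; apply: mL2_mull; [exact: (Tadj_bdd b1)|exact: ge_L2 gchi].
  by apply: filterS (TadjT b1 P) => t e; rewrite /chi mulmxBr e.
have PhiE t : Phi t = (chi t)^t* + (P t)^t* *m (T1 t)^t* + T2 t *m Q t.
  by rewrite -adjM -adjD /chi subrK /P0 trmxCK subrK.
have sPhiadj : spec_le 0 (fun t => (P t)^t*) by rewrite -oppr0; exact: ge_adj.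
have lchiadj : spec_le 0 (fun t => (chi t)^t*) by rewrite -oppr0; exact: ge_adj.
have schi : mL2 (fun t => (chi t)^t*) := le_L2 lchiadj.
(* The two other parts of the symbol map the model space of Th1 into the
   orthogonal complement of that of Th2, so chi^* inherits the hypothesis. *)
have reduce (f : R -> 'M[R[i]]_d) : inK T1 f -> has_extension f -> exists2 V, spec_ge 0 V &
    spec_le (-1) (fun t => (chi t)^t* *m f t - T2 t *m V t).
  move=> Kf ef; have bf := ext_bdd Kf ef; have [B gB lB] := perp f Kf ef.
  have gQf : spec_ge 0 (fun t => Q t *m f t).
    rewrite -[0]addr0; apply: ge_mul; [exact: gQ|exact: Kf.1|].
    by apply: mL2_mulr; [exact: bf|exact: ge_L2 gQ].
  exists (fun t => B t - Q t *m f t); first exact: geB.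
  have lPf : spec_le (-1) (fun t => (P t)^t* *m ((T1 t)^t* *m f t)).
    have -> : (-1 : int) = 0 + -1 by [].
    apply: le_mul; [exact: sPhiadj|exact: Kf.2|].
    have : mL2 (fun t => ((P t)^t* *m (T1 t)^t*) *m f t).
      apply: mL2_mulr; first exact: bf.
      by apply: mL2_mulr; [exact: (Tadj_bdd b1)|exact: le_L2 sPhiadj].
    by congr mL2; apply/funext => t; rewrite mulmxA.
  apply: spec_le_eq (leB lB lPf) => t.
  rewrite PhiE !mulmxDl mulmxBr !mulmxA.
  exact: sub_rearrange.
have [W gW lW] := reduce _ (qfun_inK b1) (qfun_ext b1).
have gchiT : spec_ge 1 (fun t => (chi t)^t* *m T1 t).
  by have := lchi; apply: spec_ge_eq => t; rewrite adjM trmxCK.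
have schiT := ge_L2 gchiT.
(* The spectrum of the left-hand side is in [0, +oo) and in (-oo, -1]. *)
have star : circle_ae (fun t => ek (-1) t *: ((chi t)^t* *m T1 t) - T2 t *m W t = 0).
  apply: (@ge_le_eq0 _ _ _ 0 (-1)); [by []| |].
    by apply: geB; [exact: (ge_shift0 gchiT)|exact: (T_ge_mul b2)].
  have lc : spec_le (-1) (fun t => ek (-1) t *: ((chi t)^t* *m A1)).
    by apply: (@le_shift0 _ _ 0) => //; exact: le_mulC.
  apply: spec_le_eq (leD lW lc) => t.
  by rewrite /qfun -scalemxAr mulmxBr scalerBr addrAC subrK.
(* By star, chi^* T1 = z T2 W, so that the subtracted term of kfun contributes an
   element of T2 H^2. *)
have step n : exists2 V, spec_ge 0 V &
    spec_le (-1) (fun t => ek (Posz n) t *: (chi t)^t* - T2 t *m V t).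
  have [B gB lB] := reduce _ (kfun_inK b1 n) (kfun_ext b1 n).
  have gWp : spec_ge 0 (fun t => ek 1 t *: (W t *m @kpoly R d T1 n t)).
    apply: (@ge_weak _ _ _ 1) => //; apply: (@ge_shift0 _ _ 0) => //.
    rewrite -[0]addr0; apply: ge_mul; [exact: gW|exact: kpoly_ge|].
    by apply: mL2_mulr; [exact: kpoly_bdd|exact: ge_L2 gW].
  have gV : spec_ge 0 (fun t => B t + ek 1 t *: (W t *m @kpoly R d T1 n t)).
    by apply: geD; [exact: gB|exact: gWp].
  exists (fun t => B t + ek 1 t *: (W t *m @kpoly R d T1 n t)); first exact: gV.
  apply: le_ae lB.
    apply: mL2_meas; apply: mL2B; last exact: ge_L2 (T_ge_mul b2 gV).
    exact: le_L2 (le_shift (Posz n) lchiadj).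
  apply: filterS star => t /eqP; rewrite subr_eq0 => /eqP e.
  by apply: adjmul_recombine e; rewrite -ekD addrN ek0.
(* Here c is the adjoint of the coefficient of index n of chi. *)
have all n : spec_ge (Posz n) chi.
  elim: n => [|n IHn]; first exact: gchi.
  have [V gV lV] := step n.
  have lf : spec_le 0 (fun t => ek (Posz n) t *: (chi t)^t*).
    by apply: (le_shift0 (ge_adj IHn)); rewrite addNr.
  have := le_sub_mean lf; set c := \matrix_(_, _) _ => lfc.
  have lc : spec_le (-1) (fun t => c - T2 t *m V t).
    apply: spec_le_eq (leB lV lfc) => t.
    by rewrite opprB addrC addrA subrK.
  have gc : spec_ge 0 (fun t => c - T2 t *m V t).
    by apply: geB; [exact: ge_cst|exact: (T_ge_mul b2)].
  have c0 : c = 0.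
    apply: (const_in_TH2 b2 u2 gV).
    have : circle_ae (fun t => c - T2 t *m V t = 0).
      by apply: (@ge_le_eq0 _ _ _ 0 (-1)); [by []|exact: gc|exact: lc].
    by apply: filterS => t /eqP; rewrite subr_eq0 => /eqP.
  move=> i j; have [sij nij] := IHn i j; split; first exact: sij.
  move=> l ln; have [|nl] := ltP l n; first exact: nij.
  have -> : l = n by move: ln nl; lia.
  have : c j i = 0 by rewrite c0 mxE.
  rewrite mxE (_ : (fun t => _) = fun t => ((chi t i j)^*)%R * ek (Posz n) t); last first.
    by apply/funext => t; rewrite !mxE mulrC.
  by rewrite coef_shift coefJ // sub0r opprK => /eqP; rewrite conjC_eq0 => /eqP.
have chi0 : circle_ae (fun t => chi t = 0).
  apply: circle_ae_mx => i j; under eq_fun do rewrite [X in _ = X]mxE.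
  apply: coef_inj; [by case: (gchi i j)|exact: sL2_cst|] => k.
  by rewrite coef_cst mul0r; apply: (all `|k|.+1 i j).2; lia.
exists P, Q; split; [exact: gP|exact: gQ|].
by apply: filterS chi0 => t c0; rewrite PhiE c0 trmx0 map_mx0 add0r adjM.
Qed.
End SymbolSplit.

(** * The operator and its continuous extension *)

Section Norm.
Context {R : realType}.

Lemma nrm2D (f g : R -> R[i]) : sL2 f -> sL2 g ->
  nrm2 (fun t => f t + g t) <= 2 * nrm2 f + 2 * nrm2 g.
Proof.
move=> sf sg; have sfg := sL2D sf sg.
have i1 : rint (fun t => 2 * normsq (f t)) by apply: rintZ; exact: sf.2.
have i2 : rint (fun t => 2 * normsq (g t)) by apply: rintZ; exact: sg.2.
rewrite /nrm2 -(rmeanZ 2 sf.2) -(rmeanZ 2 sg.2) -rmeanD //.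
apply: le_rmean; [exact: sfg.2|exact: rintD|].
by move=> t _; exact: normsqD.
Qed.

Context {m n : nat}.
Implicit Types f g : R -> 'M[R[i]]_(m, n).

Lemma L2norm_sqr f : mL2 f -> L2norm f ^+ 2 = \sum_i \sum_j nrm2 (fun t => f t i j).
Proof.
move=> sf; rewrite /L2norm L2dot_self //= sqr_sqrtr //.
by apply: sumr_ge0 => i _; apply: sumr_ge0 => j _; exact: nrm2_ge0.
Qed.

Lemma L2norm_eq0 f : mL2 f -> L2norm f = 0 -> circle_ae (fun t => f t = 0).
Proof.
move=> sf f0; apply: L2dot_eq0 => //; rewrite L2dot_self // -L2norm_sqr // f0.
by rewrite expr0n.
Qed.

Lemma L2norm_ae f g : circle_ae (fun t => f t = g t) -> L2norm f = L2norm g.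
Proof. by move=> fg; rewrite /L2norm (L2dot_ae fg fg). Qed.

Lemma L2norm_ae0 f : circle_ae (fun t => f t = 0) -> L2norm f = 0.
Proof.
move=> f0; have s0 : mL2 (fun=> 0 : 'M[R[i]]_(m, n)).
  by move=> i j; under eq_fun do rewrite mxE; exact: sL2_cst.
apply: etrans (L2norm_ae f0) _; rewrite /L2norm (L2dot_self s0) big1 ?sqrtr0 // => i _.
rewrite big1 // => j _; apply: nrm2_ae0; apply: nearW => t _.
by rewrite mxE.
Qed.

(** Twice the sum of squares stands in for the triangle inequality. *)
Lemma L2norm_le f g : mL2 f -> mL2 g ->
  L2norm f ^+ 2 <= 2 * L2norm (fun t => g t - f t) ^+ 2 + 2 * L2norm g ^+ 2.
Proof.
move=> sf sg; have sN := mL2B sf sg.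
have eN : L2norm (fun t => g t - f t) = L2norm (fun t => f t - g t).
  suff e : L2dot (fun t => g t - f t) (fun t => g t - f t) =
      L2dot (fun t => f t - g t) (fun t => f t - g t) by rewrite /L2norm e.
  apply: eq_mean => t _.
  by rewrite -(opprB (f t)) /hsdot adjN mulNmx mulmxN opprK.
rewrite eN.
rewrite [X in X <= _](L2norm_sqr sf) [X in _ <= 2 * X + _](L2norm_sqr sN).
rewrite [X in _ <= _ + 2 * X](L2norm_sqr sg) !mulr_sumr -big_split /=; apply: ler_sum => i _.
rewrite !mulr_sumr -big_split /=; apply: ler_sum => j _.
have e : nrm2 (fun t => f t i j) = nrm2 (fun t => (f t - g t) i j + g t i j).
  by congr nrm2; apply/funext => t; rewrite !mxE subrK.
by rewrite e; exact: nrm2D (sN i j) (sg i j).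
Qed.

End Norm.

Lemma le_squares_cvg0 {R : realType} (a M : R) (x y : nat -> R) :
  x k @[k --> \oo] --> (0 : R) -> y k @[k --> \oo] --> (0 : R) ->
  (forall k, a ^+ 2 <= 2 * (M * x k) ^+ 2 + 2 * y k ^+ 2) -> a = 0.
Proof.
move=> x0 y0 axy; have Mx0 : M * x k @[k --> \oo] --> (0 : R).
  by rewrite -(mulr0 M); apply: cvgM; [exact: cvg_cst|exact: x0].
have lim : 2 * (M * x k) ^+ 2 + 2 * y k ^+ 2 @[k --> \oo] -->
    2 * (0 * 0) + 2 * (0 * 0 : R).
  by apply: cvgD; (apply: cvgM; [exact: cvg_cst|exact: cvgM]).
apply/eqP; rewrite -sqrf_eq0 eq_le sqr_ge0 andbT.
rewrite (_ : 0 = 2 * (0 * 0) + 2 * (0 * 0 : R)); last by rewrite !mulr0 addr0.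
exact: ler_cvg_to (cvg_cst (a ^+ 2)) lim (nearW _ axy).
Qed.

Section Operator.
Context {R : realType} {d : nat}.
Context {Th1 Th2 : R[i] -> 'M[R[i]]_d} {T1 T2 : R -> 'M[R[i]]_d}.
Hypothesis (b1 : boundary_of Th1 T1) (b2 : boundary_of Th2 T2).
Context {Phi : R -> 'M[R[i]]_d} (sPhi : mL2 Phi).

Lemma model_space_infB (f g : R -> 'cV[R[i]]_d) :
  model_space_inf Th1 f -> model_space_inf Th1 g ->
  model_space_inf Th1 (fun t => f t - g t).
Proof.
move=> /(model_space_infP b1)[Kf bf] /(model_space_infP b1)[Kg bg].
apply/(model_space_infP b1); split; first exact: (inKB Kf Kg).
move=> i; have [F bF] := bf i; have [G bG] := bg i.
exists (fun z => F z - G z); have := bvsB bF bG.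
by congr bvs; apply/funext => t; rewrite !mxE.
Qed.

Lemma model_space_inf_bdd (f : R -> 'cV[R[i]]_d) : model_space_inf Th1 f -> mbdd f.
Proof.
move=> /(model_space_infP b1)[Kf bf]; apply: bvs_mbdd.
  by apply: mL2_meas; exact: ge_L2 Kf.1.
by move=> i j; rewrite (ord1 j); exact: bf.
Qed.

Lemma symbol_mul_L2 (f : R -> 'cV[R[i]]_d) : model_space_inf Th1 f ->
  mL2 (fun t => Phi t *m f t).
Proof. by move=> /model_space_inf_bdd bf; exact: mL2_mulr. Qed.

Notation A0 := (attoeplitz0 Th2 Phi).

Lemma attoeplitz0B (f g : R -> 'cV[R[i]]_d) :
  model_space_inf Th1 f -> model_space_inf Th1 g ->
  circle_ae (fun t => A0 (fun s => f s - g s) t = A0 f t - A0 g t).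
Proof.
move=> Kf Kg; have Kfg := model_space_infB Kf Kg.
have sf := symbol_mul_L2 Kf; have sg := symbol_mul_L2 Kg.
have [Kpf Hf] := orth_proj_spec b2 sf; have [Kpg Hg] := orth_proj_spec b2 sg.
have spf := ge_L2 Kpf.1; have spg := ge_L2 Kpg.1.
apply: (orth_proj_unique b2 (symbol_mul_L2 Kfg) (inKB Kpf Kpg)) => k Kk.
have sk := ge_L2 Kk.1.
have sF := mL2B sf spf; have sG := mL2B sg spg.
have e : L2dot (fun t => (Phi t *m f t - A0 f t) - (Phi t *m g t - A0 g t)) k = 0.
  apply: etrans (L2dotBl sF sG sk) _.
  exact: etrans (congr2 (fun x y => x - y) (Hf k Kk) (Hg k Kk)) (subrr 0).
apply: etrans e; apply: eq_mean => t _; congr hsdot.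
by rewrite mulmxBr !opprD addrACA -!opprD.
Qed.

Lemma attoeplitz0_eq0 (f : R -> 'cV[R[i]]_d) : model_space_inf Th1 f ->
  circle_ae (fun t => A0 f t = 0) <-> perpK T2 (fun t => Phi t *m f t).
Proof. by move=> Kf; exact: (orth_proj_eq0 b2 (symbol_mul_L2 Kf)). Qed.

Lemma attoeplitz0_L2 (f : R -> 'cV[R[i]]_d) : model_space_inf Th1 f -> mL2 (A0 f).
Proof. by move=> /symbol_mul_L2 /(orth_proj_spec b2)[[/ge_L2]]. Qed.

(** Boundedness makes the value of the extension at [f] independent of the
    approximating sequence; at a bounded [f] it therefore agrees with the value
    given directly by the projection. *)
Lemma attoeplitz_eq0 : attoeplitz_bounded Th1 Th2 Phi ->
  (forall f, model_space Th1 f -> circle_ae (fun t => attoeplitz Th1 Th2 Phi f t = 0))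
  <-> (forall f, model_space_inf Th1 f -> circle_ae (fun t => A0 f t = 0)).
Proof.
move=> [M HM]; split=> [A_0 f Kf|A_0 f Kf].
  have sAf := attoeplitz0_L2 Kf.
  have := A_0 f Kf.1; rewrite /attoeplitz.
  case: xgetP => [g _ [_ [u [Ku uf ug]]] g0|none _]; last first.
    exfalso; apply: (none (A0 f)).
    have zz h : L2norm (fun t => h t - h t : 'cV[R[i]]_d) = 0.
      by apply: L2norm_ae0; apply: nearW => t _; exact: subrr.
    split.
      by apply/(model_spaceP b2); case: (orth_proj_spec b2 (symbol_mul_L2 Kf)).
    exists (fun=> f); split => //.
      under eq_fun do rewrite zz; exact: cvg_cst.
    under eq_fun do rewrite zz; exact: cvg_cst.
  have ge k : L2norm (A0 f) ^+ 2 <=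
      2 * (M * L2norm (fun t => u k t - f t)) ^+ 2 + 2 * L2norm (A0 (u k)) ^+ 2.
    apply: (le_trans (L2norm_le sAf (attoeplitz0_L2 (Ku k)))).
    rewrite lerD2r ler_wpM2l // ler_sqr ?nnegrE ?sqrtr_ge0 //.
      rewrite -(L2norm_ae (attoeplitz0B (Ku k) Kf)).
      exact: HM (model_space_infB (Ku k) Kf).
    apply: le_trans (HM _ (model_space_infB (Ku k) Kf)).
    exact: sqrtr_ge0.
  have ug0 : L2norm (A0 (u k)) @[k --> \oo] --> (0 : R).
    apply: cvg_trans ug; apply: near_eq_cvg; apply: nearW => k.
    apply: L2norm_ae; apply: filterS g0 => t ->.
    by rewrite subr0.
  by apply: (L2norm_eq0 sAf); exact: (le_squares_cvg0 uf ug0 ge).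
rewrite /attoeplitz; case: xgetP => [g _ [Kg [u [Ku uf ug]]]|_]; last exact: nearW.
have sg : mL2 g by have /(model_spaceP b2)[/ge_L2] := Kg.
have e k : L2norm (fun t => A0 (u k) t - g t) = L2norm (fun t => 0 - g t).
  by apply: L2norm_ae; apply: filterS (A_0 _ (Ku k)) => t ->.
have ng : L2norm (fun t => 0 - g t) = 0.
  have ug' : L2norm (fun t => A0 (u k) t - g t) @[k --> \oo] -->
      L2norm (fun t => 0 - g t) by under eq_fun do rewrite e; exact: cvg_cst.
  exact: cvg_unique ug' ug.
have s0g : mL2 (fun t => 0 - g t).
  by under eq_fun do rewrite sub0r; exact: mL2N.
apply: filterS (L2norm_eq0 s0g ng) => t /eqP.
by rewrite sub0r oppr_eq0 => /eqP.
Qed.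

End Operator.

Theorem theorem4p4 (R : realType) (d : nat)
    (Theta1 Theta2 : R[i] -> 'M[R[i]]_d) (Phi : R -> 'M[R[i]]_d)
    (inner1 : inner_function Theta1) (inner2 : inner_function Theta2)
    (pure1 : pure_function Theta1) (pure2 : pure_function Theta2)
    (nonconst1 : nonconstant Theta1) (nonconst2 : nonconstant Theta2)
    (Phi_L2 : L2 Phi) (bounded : attoeplitz_bounded Theta1 Theta2 Phi) :
  (forall f, model_space Theta1 f ->
     circle_ae (fun t => attoeplitz Theta1 Theta2 Phi f t = 0))
  <-> addset (adjset (mulH2 Theta1)) (mulH2 Theta2) Phi.
Proof.
have [T1 b1] := inner_boundary inner1.
have [T2 b2] := inner_boundary inner2.
have sPhi : mL2 Phi by exact/L2P.
apply: iff_trans (attoeplitz_eq0 b1 b2 sPhi bounded) _; split=> [A0 | ].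
  have perp (f : R -> 'M[R[i]]_d) : inK T1 f -> has_extension f ->
      perpK T2 (fun t => Phi t *m f t).
    move=> [gf lf] ef; apply: perpK_columns => j.
    have Kj : model_space_inf Theta1 (fun t => col j (f t)).
      apply/(model_space_infP b1); split; last first.
        move=> i; have [g bg] := ef i j; exists g; move: bg.
        by congr bvs; apply/funext => t; rewrite mxE.
      split.
        by move=> i k; under eq_fun do rewrite mxE; exact: gf.
      move/spec_leP: lf => lf; apply/spec_leP => i k.
      have e : (fun t => ((T1 t)^t* *m col j (f t)) i k) =
          fun t => ((T1 t)^t* *m f t) i j.
        by apply/funext => t; rewrite colE mulmxA -colE mxE.
      by rewrite e; exact: lf.
    have := (attoeplitz0_eq0 b1 b2 sPhi Kj).1 (A0 _ Kj).
    by congr perpK; apply/funext => t; rewrite !colE mulmxA.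
  have [P [Q [gP gQ e]]] := symbol_split b1 b2 (pure_unitmx pure1) (pure_unitmx pure2)
    sPhi perp.
  exists (fun t => (bdry Theta1 t *m P t)^t*), (fun t => bdry Theta2 t *m Q t); split.
  - exists (fun t => bdry Theta1 t *m P t); last exact: nearW.
    by exists P; [exact/H2P|exact: nearW].
  - by exists Q; [exact/H2P|exact: nearW].
  - apply: filterS2 e (filterI (T_bdry b1 P) (T_bdry b2 Q)) => t h0 [h1 h2].
    by rewrite h0 -h1 -h2.
move=> [F [G [[F1 [P /H2P gP F1E] FE] [Q /H2P gQ GE] PhiE]]] f Kf.
apply/(attoeplitz0_eq0 b1 b2 sPhi Kf).
have bf := model_space_inf_bdd b1 Kf.
have [gf lf] : inK T1 f by have /(model_space_infP b1)[] := Kf.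
exists (fun t => Q t *m f t).
  rewrite -[0]addr0; apply: ge_mul; [exact: gQ|exact: gf|].
  by apply: mL2_mulr; [exact: bf|exact: ge_L2 gQ].
have lP : spec_le 0 (fun t => (P t)^t*) by rewrite -oppr0; exact: ge_adj.
have lPf : spec_le (-1) (fun t => (P t)^t* *m ((T1 t)^t* *m f t)).
  rewrite -[-1]add0r; apply: le_mul; [exact: lP|exact: lf|].
  have : mL2 (fun t => ((P t)^t* *m (T1 t)^t*) *m f t).
    apply: mL2_mulr; first exact: bf.
    by apply: mL2_mulr; [exact: (Tadj_bdd b1)|exact: le_L2 lP].
  by congr mL2; apply/funext => t; rewrite mulmxA.
apply: le_ae lPf.
  apply: mL2_meas; apply: mL2B; first exact: (symbol_mul_L2 b1 sPhi Kf).
  apply: mL2_mull; first exact: (T_bdd b2).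
  by apply: mL2_mulr; [exact: bf|exact: ge_L2 gQ].
have e1 : circle_ae (fun t => F t = (P t)^t* *m (T1 t)^t*).
  apply: filterS3 FE F1E (T_bdry b1 P) => t -> -> ->.
  by rewrite adjM.
have e2 : circle_ae (fun t => G t = T2 t *m Q t).
  by apply: filterS2 GE (T_bdry b2 Q) => t -> ->.
apply: filterS3 PhiE e1 e2 => t -> -> ->.
by rewrite mulmxDl !mulmxA addrK.
Qed.
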